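(* Let $n\geq 3$ and let $\mathbb{T}^{2n}$ be a tensor space of order $2n$ (in the sense of the context). If $\mathbb{T}^{2n}$ is even-harmonic, then $\mathfrak{I}(\mathbb{T}^{2n})=\mathfrak{I}(\mathbb{S}^{2n})$; otherwise $\mathfrak{I}(\mathbb{T}^{2n})=\mathfrak{I}(\mathbb{G}^{2n})$.
   Context: $\mathrm{SO}(3)$ acts on $\otimes^{m}\mathbb{R}^3$ by $(g\cdot T)_{i_1\dots i_m}=g_{i_1j_1}\cdots g_{i_mj_m}T_{j_1\dots j_m}$. $\mathbb{G}^{m}=\otimes^m\mathbb{R}^3$ is the space of $m$-th order tensors with no index symmetries and $\mathbb{S}^{m}\subseteq\mathbb{G}^m$ the subspace of completely symmetric tensors. A tensor space of order $m$ is a subspace $\mathbb{T}^m$ of $\otimes^m\mathbb{R}^3$ defined by index symmetries (hence $\mathrm{SO}(3)$-stable) with $\mathbb{S}^{m}\subseteq\mathbb{T}^{m}\subseteq\mathbb{G}^{m}$. For a representation $V$ of $\mathrm{SO}(3)$, the isotropy (symmetry) group of $x\in V$ is $\Sigma_x=\{g\in\mathrm{SO}(3): g\cdot x=x\}$, and $\mathfrak{I}(V)=\{[\Sigma_x]: x\in V\}$ is the set of symmetry classes, where $[K]$ denotes the conjugacy class of a subgroup $K$ in $\mathrm{SO}(3)$. Let $\mathbb{H}^k$ denote the irreducible $\mathrm{SO}(3)$-representation of dimension $2k+1$ (harmonic tensors of order $k$: completely symmetric traceless tensors). Every $\mathbb{T}^{2n}$ decomposes as $\mathbb{T}^{2n}\simeq\bigoplus_{k=0}^{2n}\alpha_k\mathbb{H}^k$;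 it is called even-harmonic if $\alpha_{2p+1}=0$ for all $0\leq p\leq n-1$. *)

(* Defs.v *)
From HB Require Import structures.
From mathcomp Require Import all_boot all_order all_algebra all_fingroup.
From mathcomp Require Import reals.
Set Implicit Arguments. Unset Strict Implicit. Unset Printing Implicit Defensive.
Import Order.TTheory GRing.Theory Num.Theory.
Local Open Scope ring_scope.

Definition tensor (R : realType) (m : nat) := {ffun m.-tuple 'I_3 -> R}.

Definition SO3 (R : realType) (g : 'M[R]_3) : Prop :=
  g *m g^T = 1%:M /\ \det g = 1.

Definition act (R : realType) (m : nat) (g : 'M[R]_3) (t : tensor R m)
  : tensor R m :=
  [ffun i : m.-tuple 'I_3 =>
     \sum_(j : m.-tuple 'I_3) (\prod_(k < m) g (tnth i k) (tnth j k)) * t j].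

Definition tperm (m : nat) (s : 'S_m) (i : m.-tuple 'I_3) : m.-tuple 'I_3 :=
  [tuple tnth i (s k) | k < m].

Definition tspace (R : realType) (m : nat) (G : {set 'S_m}) (t : tensor R m)
  : Prop := forall s, s \in G -> forall i, t (tperm s i) = t i.

Definition Sspace (R : realType) (m : nat) := @tspace R m [set: 'S_m].
Definition Gspace (R : realType) (m : nat) := @tspace R m set0.

Definition tset2 (k : nat) (i : k.-tuple 'I_3) (p q : 'I_k) (a : 'I_3)
  : k.-tuple 'I_3 :=
  [tuple if (l == p) || (l == q) then a else tnth i l | l < k].

Definition harmonic (R : realType) (k : nat) (t : tensor R k) : Prop :=
  Sspace t /\
  forall (p q : 'I_k), p != q -> forall i, \sum_(a < 3) t (tset2 i p q a) = 0.

Definition isotropy (R : realType) (m : nat) (t : tensor R m) : 'M[R]_3 -> Prop :=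
  fun g => SO3 g /\ act g t = t.

Definition conj_sub (R : realType) (K L : 'M[R]_3 -> Prop) : Prop :=
  exists g, SO3 g /\ forall h, L h <-> K (invmx g *m h *m g).

(* union of the symmetry classes of V: K is in it iff [K] is in I(V) *)
Definition sym_classes (R : realType) (m : nat) (V : tensor R m -> Prop)
  : ('M[R]_3 -> Prop) -> Prop :=
  fun K => exists t, V t /\ conj_sub (isotropy t) K.

Definition same_classes (R : realType) (m : nat) (V W : tensor R m -> Prop)
  : Prop := forall K, sym_classes V K <-> sym_classes W K.

(* alpha_k(V) = 0, i.e. Hom_SO(3)(H^k, V) = 0: every linear SO(3)-equivariant
   map from H^k into V is zero. *)
Definition no_Hk (R : realType) (m k : nat) (V : tensor R m -> Prop) : Prop :=
  forall f : tensor R k -> tensor R m,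
    (forall x y : tensor R k, f (x + y) = f x + f y) ->
    (forall (c : R) (x : tensor R k),
       f [ffun i => c * x i] = [ffun i => c * f x i]) ->
    (forall x : tensor R k, harmonic x -> V (f x)) ->
    (forall g (x : tensor R k), SO3 g -> harmonic x -> f (act g x) = act g (f x)) ->
    forall x : tensor R k, harmonic x -> f x = 0.

Definition even_harmonic (R : realType) (n : nat) (V : tensor R (2 * n) -> Prop)
  : Prop := forall p, (p < n)%N -> no_Hk (2 * p).+1 V.

(* Main.v *)
(** Symmetric tensors are handled as homogeneous forms, and arbitrary tensors
    through their weights under the rotations about e3.  Consider the isotropy
    group K of a tensor of order 2n.  If K preserves a line, then after a
    rotation it is [Zd d] (rotations of angle in (2 pi / d) Z, all of them when
    d = 0) or [Dd d] (the same with the flips) with d <= 2n, since d is the gcd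
    of the weights that occur.  Otherwise K is SO(3) (if it contains infinitely
    many rotations) or, by Burnside's count of poles, one of the three groups of
    orders 12, 24 and 60.  Explicit forms show that S^2n realises all of these
    classes except possibly [Zd d] for d = 0, 2n-1, 2n.

    These three decide the question.  If H^k with k odd occurs in T, it
    contains an e3-invariant tensor that flips negate and whose symmetric part
    vanishes; added to a symmetric tensor with isotropy [Dd d] it gives [Zd d].
    If T is even-harmonic, every equivariant map from S^k to T with k < 2n odd
    vanishes.  Weight-0 tensors, rotated so that e3 becomes x, depend
    polynomially on x on the sphere, with odd part of degree 2n-1; so the odd
    part vanishes and SO(2)-invariant tensors are flip-invariant.  Applied to
    the weight-0 projections of rotated tensors, the same fact makes the
    coefficients of weight 2n-1 agree, which forces a flip and excludes [Zd d]
    for these three d. *)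
Require Import Defs.
From HB Require Import structures.
From mathcomp Require Import all_boot all_order all_algebra all_fingroup.
From mathcomp Require Import reals boolp complex polyrcf.
From mathcomp Require Import ring lra zify.
Set Implicit Arguments. Unset Strict Implicit. Unset Printing Implicit Defensive.
Import Order.TTheory GRing.Theory Num.Theory Normc.
Local Open Scope ring_scope.

(** Neither Haar measure nor topology is used. Angles are complex numbers of modulus 1, forms are
    compared as polynomials, and discreteness comes from the bound m on weights: in a group
    containing no full circle, every nontrivial rotation stays at an explicit distance from the
    identity. Axial and tetrahedral classes are realised by forms whose maxima on the sphere are
    known: symmetries permute the maxima, which leaves a stabiliser to compute. For orders 24 and 60
    a sum of 2n-th powers over an orbit of poles suffices, since these orders divide no other
    admissible one; 12 divides both, so the tetrahedral group needs an invariant of degree 6. That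
    degree and the inequality 2n + 1 >= 7 use n >= 3. Excluding flips takes two coefficients of
    equal weight and different phase, and the second costs two more degrees: this is why d = 2n - 1
    and d = 2n resist. For d = 0, a form of even degree invariant under all rotations about e3 is
    flip-invariant anyway. The even-harmonic hypothesis speaks only of equivariant maps out of H^k,
    so a tensor is shown to vanish by exhibiting it as the image of a power of e3 under such a
    map. *)

(** * Linear and permutation actions on tensors, tensor powers, the scalar product *)

Section TensorAction.
Variable A : comNzRingType.
Implicit Types (m : nat) (g h : 'M[A]_3) (v : 'cV[A]_3).

Lemma sum_tuple_prod m (F : 'I_m -> 'I_3 -> A) :
  \sum_(j : m.-tuple 'I_3) \prod_(k < m) F k (tnth j k) =
  \prod_(k < m) \sum_(a < 3) F k a.
Proof.
rewrite bigA_distr_bigA /=.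
rewrite (reindex (fun f : {ffun 'I_m -> 'I_3} => [tuple f k | k < m])) /=.
  by apply: eq_bigr => f _; apply: eq_bigr => k _; rewrite tnth_mktuple.
exists (fun t : m.-tuple 'I_3 => [ffun k => tnth t k]) => x _.
  by apply/ffunP => k; rewrite ffunE tnth_mktuple.
by apply: eq_from_tnth => k; rewrite tnth_mktuple ffunE.
Qed.

(** The formula of [act] over any commutative ring: over [R[i]] the rotations about e3 become
    diagonal. *)
Definition gact m g (t : {ffun m.-tuple 'I_3 -> A}) : {ffun m.-tuple 'I_3 -> A} :=
  [ffun i : m.-tuple 'I_3 =>
     \sum_(j : m.-tuple 'I_3) (\prod_(k < m) g (tnth i k) (tnth j k)) * t j].

Definition tscale m (c : A) (t : {ffun m.-tuple 'I_3 -> A}) :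
  {ffun m.-tuple 'I_3 -> A} := [ffun i => c * t i].

Lemma gactM m g h (t : {ffun m.-tuple 'I_3 -> A}) :
  gact (g *m h) t = gact g (gact h t).
Proof.
apply/ffunP => i; rewrite !ffunE.
under [RHS]eq_bigr => j _ do rewrite ffunE mulr_sumr.
rewrite exchange_big /=; apply: eq_bigr => l _.
under [RHS]eq_bigr => j _ do rewrite mulrA -big_split /=.
rewrite -mulr_suml; congr (_ * _).
rewrite (sum_tuple_prod (fun k a => g (tnth i k) a * h a (tnth l k))).
by apply: eq_bigr => k _; rewrite mxE.
Qed.

Lemma prod_eq_tuple m (i j : m.-tuple 'I_3) :
  \prod_(k < m) ((tnth i k == tnth j k)%:R : A) = (i == j)%:R.
Proof.
case: eqP => [->|ne].
  by rewrite big1 // => k _; rewrite eqxx.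
have [k hk] : exists k, tnth i k != tnth j k.
  apply/existsP; apply: contra_notT ne => /existsPn h.
  by apply: eq_from_tnth => k; apply/eqP; move: (h k); rewrite negbK.
by rewrite (bigD1 k) //= (negbTE hk) mul0r.
Qed.

Lemma sum_delta_tuple m (i : m.-tuple 'I_3) (f : m.-tuple 'I_3 -> A) :
  \sum_j (i == j)%:R * f j = f i.
Proof.
rewrite (bigD1 i) //= eqxx mul1r big1 ?addr0 // => j ne.
by rewrite eq_sym (negbTE ne) mul0r.
Qed.

Lemma gact1 m (t : {ffun m.-tuple 'I_3 -> A}) : gact 1%:M t = t.
Proof.
apply/ffunP => i; rewrite ffunE.
under eq_bigr => j _ do (under eq_bigr => k _ do rewrite mxE);
  under eq_bigr => j _ do rewrite prod_eq_tuple.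
exact: sum_delta_tuple.
Qed.

Lemma gactD m g (t s : {ffun m.-tuple 'I_3 -> A}) :
  gact g (t + s) = gact g t + gact g s.
Proof.
apply/ffunP => i; rewrite !ffunE -big_split /=.
by apply: eq_bigr => j _; rewrite ffunE mulrDr.
Qed.

Lemma gactN m g (t : {ffun m.-tuple 'I_3 -> A}) : gact g (- t) = - gact g t.
Proof.
apply/ffunP => i; rewrite !ffunE -sumrN.
by apply: eq_bigr => j _; rewrite ffunE mulrN.
Qed.

Lemma gactB m g (t s : {ffun m.-tuple 'I_3 -> A}) :
  gact g (t - s) = gact g t - gact g s.
Proof. by rewrite gactD gactN. Qed.

Lemma gact0 m g : gact g (0 : {ffun m.-tuple 'I_3 -> A}) = 0.
Proof. by have := gactB g (0 : {ffun m.-tuple 'I_3 -> A}) 0; rewrite !subrr. Qed.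

Lemma gact_sum m g (I : Type) (r : seq I) (F : I -> {ffun m.-tuple 'I_3 -> A}) :
  gact g (\sum_(i <- r) F i) = \sum_(i <- r) gact g (F i).
Proof.
elim: r => [|x r IH]; first by rewrite !big_nil gact0.
by rewrite !big_cons gactD IH.
Qed.

Lemma gactZ m g c (t : {ffun m.-tuple 'I_3 -> A}) :
  gact g (tscale c t) = tscale c (gact g t).
Proof.
apply/ffunP => i; rewrite !ffunE mulr_sumr.
by apply: eq_bigr => j _; rewrite ffunE mulrCA.
Qed.

Definition pact m (s : 'S_m) (t : {ffun m.-tuple 'I_3 -> A}) :
  {ffun m.-tuple 'I_3 -> A} := [ffun i => t (Defs.tperm s i)].

Lemma tpermM m (s r : 'S_m) (i : m.-tuple 'I_3) :
  Defs.tperm s (Defs.tperm r i) = Defs.tperm (s * r)%g i.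
Proof. by apply: eq_from_tnth => k; rewrite !tnth_mktuple permM. Qed.

Lemma tperm1 m (i : m.-tuple 'I_3) : Defs.tperm 1%g i = i.
Proof. by apply: eq_from_tnth => k; rewrite tnth_mktuple perm1. Qed.

Lemma tpermK m (s : 'S_m) : cancel (@Defs.tperm m s) (Defs.tperm s^-1%g).
Proof. by move=> i; rewrite tpermM mulVg tperm1. Qed.

Lemma tpermKV m (s : 'S_m) : cancel (@Defs.tperm m s^-1%g) (Defs.tperm s).
Proof. by move=> i; rewrite tpermM mulgV tperm1. Qed.

Lemma tperm_bij m (s : 'S_m) : bijective (@Defs.tperm m s).
Proof. exists (Defs.tperm s^-1%g); [exact: tpermK | exact: tpermKV]. Qed.

Lemma pact_gact m (s : 'S_m) g (t : {ffun m.-tuple 'I_3 -> A}) :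
  pact s (gact g t) = gact g (pact s t).
Proof.
apply/ffunP => i; rewrite !ffunE.
rewrite (reindex (Defs.tperm s)) /=; last exact/onW_bij/tperm_bij.
apply: eq_bigr => j _; rewrite ffunE; congr (_ * _).
rewrite [RHS](reindex_inj (@perm_inj _ s)) /=.
by apply: eq_bigr => k _; rewrite !tnth_mktuple.
Qed.

(** The tensor power of [v]. Pairing a tensor with it evaluates at [v] the form of its symmetric
    part, see [tdot_symt_pw]. *)
Definition pw m v : {ffun m.-tuple 'I_3 -> A} :=
  [ffun i => \prod_(k < m) v (tnth i k) 0].

Lemma gact_pw m g v : gact g (pw m v) = pw m (g *m v).
Proof.
apply/ffunP => i; rewrite !ffunE.
under eq_bigr => j _ do rewrite ffunE -big_split /=.
rewrite (sum_tuple_prod (fun k a => g (tnth i k) a * v a 0)).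
by apply: eq_bigr => k _; rewrite mxE.
Qed.

Lemma pact_pw m (s : 'S_m) v : pact s (pw m v) = pw m v.
Proof.
apply/ffunP => i; rewrite !ffunE.
rewrite [RHS](reindex_inj (@perm_inj _ s)) /=.
by apply: eq_bigr => k _; rewrite tnth_mktuple.
Qed.

Definition tdot m (t s : {ffun m.-tuple 'I_3 -> A}) : A := \sum_i t i * s i.

Lemma tdotC m (t s : {ffun m.-tuple 'I_3 -> A}) : tdot t s = tdot s t.
Proof. by apply: eq_bigr => i _; rewrite mulrC. Qed.

Lemma tdotDl m (t s u : {ffun m.-tuple 'I_3 -> A}) :
  tdot (t + s) u = tdot t u + tdot s u.
Proof. by rewrite -big_split; apply: eq_bigr => i _; rewrite !ffunE mulrDl. Qed.

Lemma tdotBl m (t s u : {ffun m.-tuple 'I_3 -> A}) :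
  tdot (t - s) u = tdot t u - tdot s u.
Proof. by rewrite -sumrB; apply: eq_bigr => i _; rewrite !ffunE mulrBl. Qed.

Lemma tdotZl m c (t u : {ffun m.-tuple 'I_3 -> A}) :
  tdot (tscale c t) u = c * tdot t u.
Proof. by rewrite mulr_sumr; apply: eq_bigr => i _; rewrite !ffunE mulrA. Qed.

Lemma tdot0l m (u : {ffun m.-tuple 'I_3 -> A}) : tdot 0 u = 0.
Proof. by rewrite /tdot big1 // => i _; rewrite ffunE mul0r. Qed.

Lemma tdotDr m (t s u : {ffun m.-tuple 'I_3 -> A}) :
  tdot u (t + s) = tdot u t + tdot u s.
Proof. by rewrite tdotC tdotDl !(tdotC u). Qed.

Lemma tdotZr m c (t u : {ffun m.-tuple 'I_3 -> A}) :
  tdot u (tscale c t) = c * tdot u t.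
Proof. by rewrite tdotC tdotZl tdotC. Qed.

Lemma tdot_suml m (I : Type) (r : seq I) (P : pred I)
  (F : I -> {ffun m.-tuple 'I_3 -> A}) u :
  tdot (\sum_(i <- r | P i) F i) u = \sum_(i <- r | P i) tdot (F i) u.
Proof.
elim/big_rec2: _ => [|i y x _ <-]; first exact: tdot0l.
exact: tdotDl.
Qed.

Lemma tdot_gact m g (t s : {ffun m.-tuple 'I_3 -> A}) :
  tdot (gact g t) s = tdot t (gact g^T s).
Proof.
rewrite /tdot; under eq_bigr => i _ do rewrite ffunE mulr_suml.
rewrite exchange_big /=; apply: eq_bigr => j _.
rewrite ffunE mulr_sumr; apply: eq_bigr => i _.
under [in RHS]eq_bigr => k _ do rewrite mxE.
by rewrite mulrCA mulrA.
Qed.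

Lemma tdot_pact m (s : 'S_m) (t u : {ffun m.-tuple 'I_3 -> A}) :
  tdot (pact s t) u = tdot t (pact s^-1%g u).
Proof.
rewrite /tdot [RHS](reindex (Defs.tperm s)) /=; last exact/onW_bij/tperm_bij.
by apply: eq_bigr => i _; rewrite !ffunE tpermK.
Qed.

Lemma tdot_pw m u v : tdot (pw m u) (pw m v) = ((u^T *m v) 0 0) ^+ m.
Proof.
rewrite /tdot; under eq_bigr => i _ do rewrite !ffunE -big_split /=.
rewrite (sum_tuple_prod (fun k a => u a 0 * v a 0)) prodr_const card_ord.
by congr (_ ^+ _); rewrite mxE; apply: eq_bigr => a _; rewrite mxE.
Qed.

End TensorAction.

(** * Symmetrisation, polarization, and isotropy of homogeneous forms *)

Section SymmetricTensors.
Variable R : realType.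
Implicit Types (m : nat) (g h : 'M[R]_3) (v x : 'cV[R]_3).

Lemma actE m g (t : tensor R m) : Defs.act g t = gact g t. Proof. by []. Qed.

Lemma tspaceP m (G : {set 'S_m}) (t : tensor R m) :
  tspace G t <-> forall s, s \in G -> pact s t = t.
Proof.
split=> [h s sG|h s sG i]; first by apply/ffunP => i; rewrite ffunE h.
by have /ffunP/(_ i) := h s sG; rewrite ffunE.
Qed.

Lemma SspaceP m (t : tensor R m) : Sspace t <-> forall s, pact s t = t.
Proof. by rewrite /Sspace tspaceP; split=> h s => [|_]; exact: h. Qed.

Lemma tspace_gact m (G : {set 'S_m}) g (t : tensor R m) :
  tspace G t -> tspace G (gact g t).
Proof. by move=> /tspaceP h; apply/tspaceP => s sG; rewrite pact_gact h. Qed.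

Lemma Sspace_pw m v : Sspace (pw m v : tensor R m).
Proof. by apply/SspaceP => s; rewrite pact_pw. Qed.

Lemma pactD m (s : 'S_m) (t u : tensor R m) : pact s (t + u) = pact s t + pact s u.
Proof. by apply/ffunP => i; rewrite !ffunE. Qed.

Lemma pactZ m (s : 'S_m) c (t : tensor R m) :
  pact s (tscale c t) = tscale c (pact s t).
Proof. by apply/ffunP => i; rewrite !ffunE. Qed.

Lemma pact_sum m (s : 'S_m) (I : finType) (P : pred I) (F : I -> tensor R m) :
  pact s (\sum_(i | P i) F i) = \sum_(i | P i) pact s (F i).
Proof. by apply/ffunP => i; rewrite !(ffunE, sum_ffunE); apply: eq_bigr => ? _; rewrite ffunE. Qed.

Lemma pactM m (s r : 'S_m) (t : tensor R m) :
  pact s (pact r t) = pact (r * s)%g t.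
Proof. by apply/ffunP => i; rewrite !ffunE tpermM. Qed.

Lemma tspaceD m (G : {set 'S_m}) (t u : tensor R m) :
  tspace G t -> tspace G u -> tspace G (t + u).
Proof.
by move=> /tspaceP h /tspaceP k; apply/tspaceP => s sG; rewrite pactD h ?k.
Qed.

Lemma tspaceZ m (G : {set 'S_m}) c (t : tensor R m) :
  tspace G t -> tspace G (tscale c t).
Proof. by move=> /tspaceP h; apply/tspaceP => s sG; rewrite pactZ h. Qed.

Lemma tspaceB m (G : {set 'S_m}) (t u : tensor R m) :
  tspace G t -> tspace G u -> tspace G (t - u).
Proof.
move=> h k; have -> : t - u = t + tscale (- 1) u.
  by apply/ffunP => i; rewrite !ffunE mulN1r.
exact/tspaceD/tspaceZ.
Qed.

Lemma Sspace_sub m (G : {set 'S_m}) (t : tensor R m) : Sspace t -> tspace G t.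
Proof. by move=> h s _; apply: h; rewrite inE. Qed.

(** The Reynolds projection onto [tspace G] when [G] is a group; it commutes with rotations. *)
Definition gavg m (G : {set 'S_m}) (t : tensor R m) : tensor R m :=
  tscale (#|G|%:R^-1) (\sum_(s in G) pact s t).

Lemma gavg_tspace m (G : {group 'S_m}) (t : tensor R m) : tspace G (gavg G t).
Proof.
apply/tspaceP => s sG; rewrite /gavg pactZ pact_sum; congr tscale.
under eq_bigr => r _ do rewrite pactM.
by rewrite [RHS](reindex_acts 'R%act _ sG) //=; apply/actsP => a aG b /=; rewrite groupMr.
Qed.

Lemma gavg_id m (G : {group 'S_m}) (t : tensor R m) : tspace G t -> gavg G t = t.
Proof.
move=> /tspaceP h; apply/ffunP => i; rewrite !(ffunE, sum_ffunE).
rewrite (eq_bigr (fun _ => t i)) => [|s sG]; last by rewrite h.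
by rewrite sumr_const -[t i *+ _]mulr_natl mulKf // pnatr_eq0 -lt0n cardG_gt0.
Qed.

Lemma gavg_gact m (G : {set 'S_m}) g (t : tensor R m) :
  gavg G (gact g t) = gact g (gavg G t).
Proof.
rewrite /gavg gactZ; congr tscale; rewrite -!big_enum gact_sum.
by apply: eq_bigr => s _; rewrite pact_gact.
Qed.

Lemma gavgD m (G : {set 'S_m}) (t u : tensor R m) :
  gavg G (t + u) = gavg G t + gavg G u.
Proof.
apply/ffunP => i; rewrite !(ffunE, sum_ffunE) -mulrDr -big_split; congr (_ * _).
by apply: eq_bigr => s _; rewrite !ffunE.
Qed.

Lemma gavgZ m (G : {set 'S_m}) c (t : tensor R m) :
  gavg G (tscale c t) = tscale c (gavg G t).
Proof.
apply/ffunP => i; rewrite !(ffunE, sum_ffunE) mulrCA; congr (_ * _).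
by rewrite mulr_sumr; apply: eq_bigr => s _; rewrite !ffunE.
Qed.

Definition symt m (t : tensor R m) : tensor R m := gavg [set: 'S_m]%G t.

Lemma symt_S m (t : tensor R m) : Sspace (symt t).
Proof. exact: gavg_tspace. Qed.

Lemma symt_id m (t : tensor R m) : Sspace t -> symt t = t.
Proof. exact: gavg_id. Qed.

Lemma tdot_symt m (t u : tensor R m) : tdot (symt t) u = tdot t (symt u).
Proof.
rewrite /symt /gavg tdotZl tdotZr; congr (_ * _).
rewrite tdot_suml [in RHS]tdotC tdot_suml.
rewrite [RHS](reindex_inj invg_inj) /=; apply: eq_big => s; first by rewrite !inE.
by rewrite tdot_pact tdotC.
Qed.

Lemma tdot_symt_pw m (t : tensor R m) v : tdot (symt t) (pw m v) = tdot t (pw m v).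
Proof. by rewrite tdot_symt symt_id //; exact: Sspace_pw. Qed.

Lemma Sspace_perm_eq m (s : tensor R m) (i j : m.-tuple 'I_3) :
  Sspace s -> perm_eq i j -> s i = s j.
Proof.
move=> sS /tuple_permP[r rE]; rewrite -(sS r _ j) ?inE //.
by congr (s _); exact: val_inj.
Qed.

Lemma poly_fun0 (P : {poly R}) : (forall l, P.[l] = 0) -> P = 0.
Proof.
move=> h; apply/eqP; apply: contraT => Pn0.
have := @max_poly_roots R P [seq k%:R | k <- iota 0 (size P)] Pn0.
rewrite size_map size_iota ltnn; apply.
  by apply/allP => _ /mapP[k _ ->]; rewrite rootE h.
rewrite map_inj_uniq ?iota_uniq // => a b /eqP.
by rewrite eqr_nat => /eqP.
Qed.

(* Evaluation on the curve (1, l, l^(m+1)) turns a form into a polynomial in l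
   whose exponents determine the content of a multi-index. *)
Lemma polarization m (s : tensor R m) :
  Sspace s -> (forall v, tdot s (pw m v) = 0) -> s = 0.
Proof.
move=> sS h.
pose e (a : 'I_3) : nat := [:: 0; 1; m.+1]%N`_a.
pose deg (i : m.-tuple 'I_3) := (\sum_(k < m) e (tnth i k))%N.
pose P : {poly R} := \sum_(i : m.-tuple 'I_3) s i *: 'X^(deg i).
have P0 : P = 0.
  apply: poly_fun0 => l; rewrite horner_sum -[RHS](h (\col_a l ^+ e a)).
  apply: eq_bigr => i _; rewrite hornerZ hornerXn ffunE; congr (_ * _).
  by rewrite -prodrXr; apply: eq_bigr => k _; rewrite mxE.
have dE i : deg i = (count_mem (inord 1) i + m.+1 * count_mem (inord 2) i)%N.
  rewrite /deg -(big_tuple _ _ i predT e).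
  elim: (val i) => [|a l IH]; first by rewrite big_nil muln0.
  rewrite big_cons IH /= mulnDr addnACA; congr (_ + _)%N.
  by case: a => [[|[|[|]]] //= ha]; rewrite -!val_eqE /= !inordK ?muln0 ?muln1.
have deq i j : deg i = deg j -> exists r : 'S_m, j = Defs.tperm r i.
  rewrite !dE => dij.
  have c1 l : (count_mem (inord 1 : 'I_3) (l : m.-tuple 'I_3) < m.+1)%N.
    by rewrite ltnS -[X in (_ <= X)%N](size_tuple l) count_size.
  have e1 : count_mem (inord 1) i = count_mem (inord 1) j.
    have := congr1 (modn^~ m.+1) dij.
    by rewrite ![(_ + m.+1 * _)%N]addnC ![(m.+1 * _)%N]mulnC !modnMDl !modn_small.
  have e2 : count_mem (inord 2) i = count_mem (inord 2) j.
    by apply/eqP; move/eqP: dij; rewrite e1 eqn_add2l eqn_pmul2l.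
  have cs (l : m.-tuple 'I_3) : (count_mem (inord 0) l + count_mem (inord 1) l + count_mem (inord 2) l = m)%N.
    rewrite -[RHS](size_tuple l); elim: (val l) => [|a r IH] //=.
    rewrite -[in RHS]IH (addnACA _ (count _ r)) (addnACA _ (count _ r + _)) -[RHS]add1n.
    congr (_ + _)%N.
    by case: a => [[|[|[|]]] //= ha]; rewrite -!val_eqE /= !inordK.
  have : perm_eq j i.
    apply/allP => a _ /=; apply/eqP.
    have := etrans (cs i) (esym (cs j)); rewrite e1 e2 => /addIn /addIn e0.
    case: a => [[|[|[|]]] //= ha].
    - by have -> : Ordinal ha = inord 0 by apply/val_inj; rewrite /= inordK.
    - by have -> : Ordinal ha = inord 1 by apply/val_inj; rewrite /= inordK.
    - by have -> : Ordinal ha = inord 2 by apply/val_inj; rewrite /= inordK.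
  case/tuple_permP => r rE; exists r; exact/val_inj.
apply/ffunP => i; rewrite ffunE.
have := congr1 (fun p : {poly R} => p`_(deg i)) P0.
rewrite coef0 coef_sum (bigID (fun j => deg j == deg i)) /=.
rewrite [X in _ + X]big1 ?addr0 => [|j /negbTE nj]; last first.
  by rewrite coefZ coefXn eq_sym nj mulr0.
rewrite (eq_bigr (fun _ => s i)) => [|j /eqP ej]; last first.
  rewrite coefZ coefXn ej eqxx mulr1.
  by have [r ->] := deq i j (esym ej); rewrite sS ?inE.
rewrite sumr_const => /eqP; rewrite mulrn_eq0 => /orP[|/eqP //].
by rewrite -leqn0 leqNgt => /negP[]; apply/card_gt0P; exists i; exact: eqxx.
Qed.

Lemma pw_span m (y x : tensor R m) :
  (forall v, tdot y (pw m v) = 0) -> Sspace x -> tdot y x = 0.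
Proof.
move=> h xS; rewrite -(symt_id xS) -tdot_symt.
have -> : symt y = 0; last exact: tdot0l.
by apply: polarization; [exact: symt_S | move=> v; rewrite tdot_symt_pw].
Qed.

(** Homogeneous polynomial functions of degree m. The representing tensor need not be symmetric, so
    that multiplication by a coordinate is immediate; [formS] symmetrises once at the end. *)
Definition form m (F : 'cV[R]_3 -> R) :=
  exists t : tensor R m, forall x, tdot t (pw m x) = F x.

Lemma form_ext m (F G : 'cV[R]_3 -> R) : F =1 G -> form m F -> form m G.
Proof. by move=> e [t h]; exists t => x; rewrite h e. Qed.

Lemma formD m (F G : 'cV[R]_3 -> R) :
  form m F -> form m G -> form m (fun x => F x + G x).
Proof. by move=> [t ht] [u hu]; exists (t + u) => x; rewrite tdotDl ht hu. Qed.

Lemma formZ m c (F : 'cV[R]_3 -> R) : form m F -> form m (fun x => c * F x).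
Proof. by move=> [t ht]; exists (tscale c t) => x; rewrite tdotZl ht. Qed.

Lemma form_const c : form 0 (fun _ => c).
Proof.
exists [ffun _ => c] => x; rewrite /tdot (bigD1 [tuple]) //= big1 ?addr0 => [|i /negP[]].
  by rewrite !ffunE big_ord0 mulr1.
by apply/eqP/val_inj; case: i => [[]].
Qed.

Definition tcontr m (a : 'I_3) (u : tensor R m.+1) : tensor R m :=
  [ffun i => u (cons_tuple a i)].

Definition tmulX m (a : 'I_3) (t : tensor R m) : tensor R m.+1 :=
  [ffun i => (thead i == a)%:R * t [tuple of behead i]].

Lemma tdot_tmulX m (a : 'I_3) (t : tensor R m) (u : tensor R m.+1) :
  tdot (tmulX a t) u = tdot t (tcontr a u).
Proof.
rewrite /tdot (reindex (fun p : 'I_3 * m.-tuple 'I_3 => cons_tuple p.1 p.2)) /=; last first.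
  exists (fun i : m.+1.-tuple 'I_3 => (thead i, [tuple of behead i])) => [[b i] _|i _] /=.
    by rewrite theadE; congr pair; apply: val_inj.
  by case/tupleP: i => b i; apply: val_inj; rewrite /= theadE.
rewrite -(pair_bigA _ (fun b (i : m.-tuple 'I_3) =>
  tmulX a t (cons_tuple b i) * u (cons_tuple b i))) /=.
rewrite (bigD1 a) //= [X in _ + X]big1 ?addr0 => [|b nb].
  apply: eq_bigr => i _; rewrite !ffunE theadE eqxx mul1r.
  by congr (t _ * _); apply: val_inj.
by rewrite big1 // => i _; rewrite !ffunE theadE (negbTE nb) !mul0r.
Qed.

Lemma tcontr_pw m (a : 'I_3) v : tcontr a (pw m.+1 v) = tscale (v a 0) (pw m v).
Proof.
apply/ffunP => i; rewrite !ffunE big_ord_recl; congr (_ * _).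
by apply: eq_bigr => k _; rewrite !(tnth_nth a).
Qed.

Lemma form_mulX m (a : 'I_3) (F : 'cV[R]_3 -> R) :
  form m F -> form m.+1 (fun x => x a 0 * F x).
Proof.
by move=> [t ht]; exists (tmulX a t) => x; rewrite tdot_tmulX tcontr_pw tdotZr ht.
Qed.

Lemma formS m (F : 'cV[R]_3 -> R) : form m F ->
  exists2 s : tensor R m, Sspace s & forall x, tdot s (pw m x) = F x.
Proof.
move=> [t ht]; exists (symt t); first exact: symt_S.
by move=> x; rewrite tdot_symt_pw.
Qed.

Lemma SO3_mul g h : SO3 g -> SO3 h -> SO3 (g *m h).
Proof.
case=> go gd [ho hd]; split; last by rewrite det_mulmx gd hd mulr1.
by rewrite trmx_mul mulmxA -[g *m h *m _]mulmxA ho mulmx1.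
Qed.

Lemma SO3_1 : SO3 (1%:M : 'M[R]_3).
Proof. by split; rewrite ?det1 // trmx1 mulmx1. Qed.

Lemma SO3_trK g : SO3 g -> g^T *m g = 1%:M.
Proof. by case=> /mulmx1C. Qed.

Lemma SO3_tr g : SO3 g -> SO3 g^T.
Proof. by move=> gS; split; [rewrite trmxK SO3_trK | rewrite det_tr; case: gS]. Qed.

Lemma SO3_K m g (x : 'M[R]_(3, m)) : SO3 g -> g^T *m (g *m x) = x.
Proof. by move=> gS; rewrite mulmxA SO3_trK // mul1mx. Qed.

Lemma SO3_KV m g (x : 'M[R]_(3, m)) : SO3 g -> g *m (g^T *m x) = x.
Proof. by case=> go _; rewrite mulmxA go mul1mx. Qed.

Lemma SO3_mulI m g : SO3 g -> injective (mulmx g : 'M[R]_(3, m) -> 'M[R]_(3, m)).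
Proof. by move=> gS x y e; rewrite -(SO3_K x gS) e SO3_K. Qed.

Lemma SO3_conjK h g : SO3 h -> h *m (h^T *m g *m h) *m h^T = g.
Proof. by move=> hS; rewrite -!mulmxA !SO3_KV // (proj1 hS) mulmx1. Qed.

Lemma SO3_conjKV h g : SO3 h -> h^T *m (h *m g *m h^T) *m h = g.
Proof. by move=> hS; rewrite -!mulmxA !SO3_K // SO3_trK // mulmx1. Qed.

Lemma SO3_conj h g : SO3 h -> SO3 g -> SO3 (h^T *m g *m h).
Proof. by move=> hS gS; do 2!apply: SO3_mul => //; exact: SO3_tr. Qed.

Lemma SO3_inv g : SO3 g -> invmx g = g^T.
Proof.
move=> gS; have := SO3_trK gS; have u : g \in unitmx by case: gS => /mulmx1_unit[].
by move=> e; rewrite -[RHS]mulmx1 -(mulmxV u) mulmxA e mul1mx.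
Qed.

(** By [polarization] a symmetric tensor is determined by its form, and moving [g] across the
    pairing turns isotropy of the tensor into invariance of the form. Symmetric examples can then be
    built and studied as functions. *)
Lemma form_isotropy m (F : 'cV[R]_3 -> R) : form m F ->
  exists2 s : tensor R m, Sspace s &
    (forall g, isotropy s g <-> SO3 g /\ forall x, F (g *m x) = F x).
Proof.
move=> /formS[s sS sF]; exists s => // g.
split=> [[gS gs]|[gS gF]].
  split=> // x; rewrite -!sF -gact_pw -[g]trmxK -tdot_gact.
  by rewrite -[s in LHS]gs actE -gactM SO3_trK // gact1.
split=> //; apply/eqP; rewrite -subr_eq0; apply/eqP; apply: polarization.
  by apply: tspaceB => //; exact: tspace_gact.
move=> v; rewrite tdotBl actE tdot_gact gact_pw !sF.
by rewrite -{2}(mul1mx v) -(proj1 gS) -mulmxA gF subrr.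
Qed.

End SymmetricTensors.

(** * Explicit linear algebra in dimension three *)

Notation i0 := (@Ordinal 3 0 isT).
Notation i1 := (@Ordinal 3 1 isT).
Notation i2 := (@Ordinal 3 2 isT).

Section Space3.
Variable A : comNzRingType.
Implicit Types (g h : 'M[A]_3) (x y : 'cV[A]_3).

Definition mat3 (l : seq (seq A)) : 'M[A]_3 := \matrix_(i, j) (nth [::] l i)`_j.
Definition vec3 (a b c : A) : 'cV[A]_3 := \col_i [:: a; b; c]`_i.

Lemma sum3 (V : zmodType) (f : 'I_3 -> V) : \sum_i f i = f i0 + f i1 + f i2.
Proof.
rewrite !big_ord_recl big_ord0 addr0 addrA.
by congr (f _ + f _ + f _); apply: val_inj.
Qed.

Lemma forall3 (P : 'I_3 -> Prop) : P i0 -> P i1 -> P i2 -> forall i, P i.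
Proof.
move=> h0 h1 h2 [[|[|[|k]]] hk] //.
- by have -> : Ordinal hk = i0 by exact: val_inj.
- by have -> : Ordinal hk = i1 by exact: val_inj.
- by have -> : Ordinal hk = i2 by exact: val_inj.
Qed.

Lemma vec3P x y : x i0 0 = y i0 0 -> x i1 0 = y i1 0 -> x i2 0 = y i2 0 -> x = y.
Proof. by move=> *; apply/colP; apply: forall3. Qed.

Lemma mulmx3 g x i : (g *m x) i 0 = g i i0 * x i0 0 + g i i1 * x i1 0 + g i i2 * x i2 0.
Proof. by rewrite mxE sum3. Qed.

Lemma mulmx33 g h i j : (g *m h) i j = g i i0 * h i0 j + g i i1 * h i1 j + g i i2 * h i2 j.
Proof. by rewrite mxE sum3. Qed.

Lemma det3E g : \det g =
  g i0 i0 * (g i1 i1 * g i2 i2 - g i1 i2 * g i2 i1)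
  - g i0 i1 * (g i1 i0 * g i2 i2 - g i1 i2 * g i2 i0)
  + g i0 i2 * (g i1 i0 * g i2 i1 - g i1 i1 * g i2 i0).
Proof.
(* Reading the entries through natural numbers makes the lifted ordinals of the cofactor expansion
   compute. *)
pose f (a b : nat) := g (inord a) (inord b).
have -> : g = \matrix_(i, j) f i j.
  by apply/matrixP => i j; rewrite mxE /f !inord_val.
move: f => f.
rewrite (expand_det_row _ i0) sum3 /cofactor !(expand_det_row _ ord0).
rewrite !big_ord_recl !big_ord0 /cofactor !det_mx11 !mxE /= /bump /=.
by rewrite !(addr0, add0n, addn0, expr0, expr1, expr2, mul1r) ; ring.
Qed.

End Space3.

Ltac mat3_tac := apply/matrixP; apply: forall3; apply: forall3;
  rewrite ?mulmx33 !mxE -?val_eqE /=.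
Ltac vec3_tac := apply: vec3P; rewrite ?mulmx3 !mxE /=.

(** * Rotations, their axes, and the stabiliser of a line *)

Section Rotations.
Variable R : realType.
Implicit Types (g h : 'M[R]_3) (x y p : 'cV[R]_3) (u v : R[i]).

Definition dotv x y : R := (x^T *m y) 0 0.

Lemma dotvE x y : dotv x y = x i0 0 * y i0 0 + x i1 0 * y i1 0 + x i2 0 * y i2 0.
Proof. by rewrite /dotv mxE sum3 !mxE. Qed.

Lemma dotvC x y : dotv x y = dotv y x.
Proof. by rewrite !dotvE; ring. Qed.

Lemma dotv_mul g x y : dotv (g *m x) y = dotv x (g^T *m y).
Proof. by rewrite /dotv trmx_mul mulmxA. Qed.

Lemma dotv_SO3 g x y : SO3 g -> dotv (g *m x) (g *m y) = dotv x y.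
Proof. by move=> gS; rewrite dotv_mul mulmxA SO3_trK // mul1mx. Qed.

Lemma dotvDl x y p : dotv (x + y) p = dotv x p + dotv y p.
Proof. by rewrite !dotvE !mxE; ring. Qed.

Lemma dotvNl x p : dotv (- x) p = - dotv x p.
Proof. by rewrite !dotvE !mxE; ring. Qed.

Lemma dotvNr x p : dotv p (- x) = - dotv p x.
Proof. by rewrite !dotvE !mxE; ring. Qed.

Lemma dotvZl c x p : dotv (c *: x) p = c * dotv x p.
Proof. by rewrite !dotvE !mxE; ring. Qed.

Lemma dotvv_ge0 x : 0 <= dotv x x.
Proof. by rewrite dotvE; nra. Qed.

Lemma dotvv_eq0 x : dotv x x = 0 -> x = 0.
Proof.
rewrite dotvE => h; apply: vec3P; rewrite !mxE; apply/eqP; rewrite -sqrf_eq0; apply/eqP; nra.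
Qed.

Lemma unit_scale x : x != 0 -> exists c, c != 0 /\ dotv (c *: x) (c *: x) = 1.
Proof.
move=> x0; have h : 0 < dotv x x.
  by rewrite lt_neqAle dotvv_ge0 andbT eq_sym; apply: contra_neq x0; exact: dotvv_eq0.
exists (Num.sqrt (dotv x x))^-1; split; first by rewrite invr_eq0 gt_eqF ?sqrtr_gt0.
by rewrite dotvZl dotvC dotvZl mulrA -expr2 exprVn sqr_sqrtr ?ltW // mulVf ?gt_eqF.
Qed.

(** Unit complex numbers stand for angles: having order dividing d reads [u ^+ d = 1], and angles
    are divided by taking roots in [R[i]]. *)
Definition cunit u := (complex.Re u) ^+ 2 + (complex.Im u) ^+ 2 = 1.

Lemma cunitE u : cunit u <-> u * conjc u = 1.
Proof.
case: u => a b; rewrite /cunit /=; split=> [h|[h _]]; last by nra.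
by apply/eqP; rewrite eq_complex /=; apply/andP; split; apply/eqP; nra.
Qed.

Lemma cunit_neq0 u : cunit u -> u != 0.
Proof.
by move=> /cunitE h; apply: contra_eq_neq h => ->; rewrite mul0r eq_sym oner_eq0.
Qed.

Lemma cunitV u : cunit u -> u^-1 = conjc u.
Proof.
move=> h; have n0 := cunit_neq0 h; move/cunitE: h => h.
by apply: (mulfI n0); rewrite h divff.
Qed.

Lemma cunitM u v : cunit u -> cunit v -> cunit (u * v).
Proof.
move=> /cunitE hu /cunitE hv; apply/cunitE.
by rewrite rmorphM mulrACA hu hv mulr1.
Qed.

Lemma cunit1 : cunit 1. Proof. by apply/cunitE; rewrite rmorph1 mulr1. Qed.

Lemma cunitJ u : cunit u -> cunit (conjc u).
Proof. by move=> /cunitE h; apply/cunitE; rewrite conjcK mulrC. Qed.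

Definition rot u : 'M[R]_3 :=
  mat3 [:: [:: complex.Re u; - complex.Im u; 0];
           [:: complex.Im u; complex.Re u; 0]; [:: 0; 0; 1]].
Definition flip : 'M[R]_3 := mat3 [:: [:: 1; 0; 0]; [:: 0; -1; 0]; [:: 0; 0; -1]].
Definition e3 : 'cV[R]_3 := vec3 0 0 1.

Lemma rot_SO3 u : cunit u -> SO3 (rot u).
Proof.
rewrite /cunit => h; split; last by rewrite det3E !mxE /=; nra.
by mat3_tac; rewrite ?mulr1n ?mulr0n; nra.
Qed.

Lemma flip_SO3 : SO3 flip.
Proof. by split; [mat3_tac; rewrite ?mulr1n ?mulr0n; ring | rewrite det3E !mxE /=; ring]. Qed.

Lemma rotM u v : rot (u * v) = rot u *m rot v.
Proof. by case: u v => [a b] [c d]; mat3_tac; ring. Qed.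

Lemma rot1 : rot 1 = 1%:M.
Proof. by mat3_tac; rewrite ?oppr0. Qed.

Lemma rot_e3 u : rot u *m e3 = e3.
Proof. by vec3_tac; ring. Qed.

Lemma flip_e3 : flip *m e3 = - e3.
Proof. by vec3_tac; ring. Qed.

Lemma flipK : flip *m flip = 1%:M.
Proof. by mat3_tac; rewrite ?mulr1n ?mulr0n; ring. Qed.

Lemma flip_rot u : flip *m rot u = rot (conjc u) *m flip.
Proof. by case: u => a b; mat3_tac; ring. Qed.

Lemma rot_tr u : (rot u)^T = rot (conjc u).
Proof. by case: u => a b; mat3_tac; rewrite ?opprK. Qed.

Lemma rot_inj u v : rot u = rot v -> u = v.
Proof.
move=> /matrixP h; apply/eqP; rewrite eq_complex.
by have := h i0 i0; have := h i1 i0; rewrite !mxE /= => -> ->; rewrite !eqxx.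
Qed.

Lemma e3_unit : dotv e3 e3 = 1.
Proof. by rewrite dotvE !mxE /=; ring. Qed.

Lemma SO3_fix_e3 g : SO3 g -> g *m e3 = e3 -> exists2 u, cunit u & g = rot u.
Proof.
move=> gS ge; have [_ gd] := gS; have gt := SO3_trK gS.
have gte : g^T *m e3 = e3 by rewrite -{1}ge mulmxA gt mul1mx.
have E (h : 'M[R]_3) : h *m e3 = e3 -> [/\ h i0 i2 = 0, h i1 i2 = 0 & h i2 i2 = 1].
  move=> he; split; have /colP H := he.
  - by have := H i0; rewrite mulmx3 !mxE /= !mulr0 !add0r mulr1.
  - by have := H i1; rewrite mulmx3 !mxE /= !mulr0 !add0r mulr1.
  - by have := H i2; rewrite mulmx3 !mxE /= !mulr0 !add0r mulr1.
have [g02 g12 g22] := E _ ge; have [g20 g21 _] := E _ gte; rewrite !mxE in g20 g21.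
have /matrixP go := gt.
have := go i0 i0; have := go i0 i1; have := go i1 i1.
rewrite !mulmx33 !mxE -!val_eqE /= !(g20, g21, g02, g12, g22).
move: gd; rewrite det3E !(g20, g21, g02, g12, g22).
move a: (g i0 i0) => A; move b: (g i0 i1) => B; move c: (g i1 i0) => C; move d: (g i1 i1) => D.
move=> h1 h2 h3 h4.
(* The squares of the entries of the 2x2 block add up to 2 and its determinant is 1, so this sum of
   squares is 2 - 2. *)
have q : (A - D) ^+ 2 + (B + C) ^+ 2 = 0 by nra.
have AD : A = D by apply/eqP; rewrite -subr_eq0 -sqrf_eq0; apply/eqP; nra.
have BC : B = - C by apply/eqP; rewrite -subr_eq0 opprK -sqrf_eq0; apply/eqP; nra.
exists (A +i* C)%C; first by rewrite /cunit /=; nra.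
by mat3_tac; rewrite ?(g20, g21, g02, g12, g22, a, b, c, d) // -?BC -?AD.
Qed.

Lemma SO3_neg_e3 g : SO3 g -> g *m e3 = - e3 -> exists2 u, cunit u & g = rot u *m flip.
Proof.
move=> gS ge.
have [|u hu gE] := @SO3_fix_e3 (g *m flip) (SO3_mul gS flip_SO3).
  by rewrite -mulmxA flip_e3 mulmxN ge opprK.
by exists u => //; rewrite -gE -mulmxA flipK mulmx1.
Qed.

Lemma cunit_polar (a b : R) : exists r u,
  [/\ 0 <= r, cunit u, a = r * complex.Re u, b = r * complex.Im u & r ^+ 2 = a ^+ 2 + b ^+ 2].
Proof.
have [/eqP h|h] := eqVneq (a ^+ 2 + b ^+ 2) 0.
  have a0 : a = 0 by apply/eqP; rewrite -sqrf_eq0; apply/eqP; move/eqP: h; nra.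
  have b0 : b = 0 by apply/eqP; rewrite -sqrf_eq0; apply/eqP; move/eqP: h; nra.
  exists 0, 1; split; rewrite ?mul0r ?lexx //; first exact: cunit1.
  by rewrite a0 b0 !expr0n addr0.
set r := Num.sqrt (a ^+ 2 + b ^+ 2).
have r2 : r ^+ 2 = a ^+ 2 + b ^+ 2 by rewrite sqr_sqrtr //; nra.
have r0 : r != 0 by rewrite -sqrf_eq0 r2.
exists r, ((a / r) +i* (b / r))%C; split => //=; first exact: sqrtr_ge0.
- by rewrite /cunit /= !expr_div_n -mulrDl -r2 divff // sqrf_eq0.
- by rewrite mulrCA divff // mulr1.
- by rewrite mulrCA divff // mulr1.
Qed.

Lemma SO3_frame p : dotv p p = 1 -> exists2 g, SO3 g & g *m e3 = p.
Proof.
rewrite dotvE => hp.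
have [r [u [_ hu h0 h1 r2]]] := cunit_polar (p i0 0) (p i1 0).
set c := p i2 0 in hp *.
have rc : r ^+ 2 + c ^+ 2 = 1 by rewrite r2; nra.
(* Spherical coordinates: the right factor tilts e3 to (r, 0, c), and [rot u] then turns it to the
   longitude of [p]. *)
exists (rot u *m mat3 [:: [:: c; 0; r]; [:: 0; 1; 0]; [:: - r; 0; c]]).
  apply: SO3_mul; first exact: rot_SO3.
  split; last by rewrite det3E !mxE /=; nra.
  by mat3_tac; rewrite ?mulr1n ?mulr0n; nra.
rewrite -mulmxA; apply: vec3P; rewrite !mulmx3 !mxE /= ?h0 ?h1 ?/c; ring.
Qed.

Lemma SO3_axis g : SO3 g -> exists2 p, dotv p p = 1 & g *m p = p.
Proof.
move=> gS; have [go gd] := gS.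
have d0 : \det (g - 1%:M) = 0.
  (* As g - 1 = g (1 - g^T), its determinant is that of 1 - g, and the dimension 3 is odd. *)
  have e : \det (g - 1%:M) = - \det (g - 1%:M).
    rewrite -{1}go -{1}[g]mulmx1 -mulmxBr det_mulmx gd mul1r -det_tr.
    rewrite linearB /= trmx1 trmxK -opprB -scaleN1r detZ.
    by rewrite -signr_odd /= expr1 mulN1r.
  lra.
have /eqP/det0P[v v0 vg] := d0.
have gv : g *m v^T = v^T.
  have : v *m g = v by apply/eqP; rewrite -subr_eq0 -{2}[v]mulmx1 -mulmxBr vg.
  by move=> /(congr1 trmx); rewrite trmx_mul => e; rewrite -{1}e mulmxA go mul1mx.
have [|c [c0 hc]] := @unit_scale v^T; first by rewrite trmx_eq0.
by exists (c *: v^T) => //; rewrite -scalemxAr gv.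
Qed.

Lemma SO3_conj_rot g p : SO3 g -> dotv p p = 1 -> g *m p = p ->
  exists h u, [/\ SO3 h, cunit u, h *m e3 = p & g = h *m rot u *m h^T].
Proof.
move=> gS hp gp; have [h hS he] := SO3_frame hp.
have [||u hu E] := @SO3_fix_e3 (h^T *m g *m h).
- exact: SO3_conj.
- by rewrite -!mulmxA he gp -he SO3_K.
by exists h, u; split=> //; rewrite -E SO3_conjK.
Qed.

Lemma rot_fix u x : cunit u -> u != 1 -> rot u *m x = x -> x i0 0 = 0 /\ x i1 0 = 0.
Proof.
rewrite /cunit => hu u1 /colP h.
have := h i0; have := h i1; rewrite !mulmx3 !mxE /= => h1 h0.
have a1 : complex.Re u != 1.
  apply: contra_neq u1 => a1; apply/eqP; rewrite eq_complex a1 eqxx /= -sqrf_eq0.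
  by apply/eqP; rewrite a1 in hu; nra.
have : 2 * (1 - complex.Re u) * (x i0 0 ^+ 2 + x i1 0 ^+ 2) = 0 by nra.
move/eqP; rewrite !mulf_eq0 pnatr_eq0 subr_eq0 [1 == _]eq_sym (negbTE a1) /= => /eqP q.
by split; apply/eqP; rewrite -sqrf_eq0; apply/eqP; nra.
Qed.

Lemma SO3_fix_unit g p q : SO3 g -> g != 1%:M -> dotv p p = 1 -> dotv q q = 1 ->
  g *m p = p -> g *m q = q -> q = p \/ q = - p.
Proof.
move=> gS g1 hp hq gp gq; have [h [u [hS hu he gE]]] := SO3_conj_rot gS hp gp.
have u1 : u != 1.
  by apply: contra_neq g1 => u1; rewrite gE u1 rot1 mulmx1 (proj1 hS).
have fx : rot u *m (h^T *m q) = h^T *m q.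
  by rewrite -{2}gq gE !mulmxA SO3_trK // mul1mx.
have [x0 x1] := rot_fix hu u1 fx.
have qE : q = h *m (h^T *m q) by rewrite mulmxA (proj1 hS) mul1mx.
have : dotv (h^T *m q) (h^T *m q) = 1 by rewrite dotv_SO3 //; exact: SO3_tr.
rewrite dotvE x0 x1 mul0r !add0r -expr2 => /eqP; rewrite sqrf_eq1 => /orP[]/eqP x2.
  left; rewrite qE -he; congr (_ *m _); apply: vec3P; rewrite ?x0 ?x1 ?x2 !mxE //.
right; rewrite qE -he -mulmxN; congr (_ *m _).
by apply: vec3P; rewrite ?x0 ?x1 ?x2 !mxE /= ?oppr0.
Qed.

End Rotations.

(** * Weights of complex tensors under rotations about e3 *)

Section Weights.
Variable R : realType.
Local Notation C := R[i].
Implicit Types (m : nat) (g h : 'M[R]_3) (u v : C).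

Lemma gact_monomial (A : comNzRingType) m (d : 'I_3 -> A) (f : 'I_3 -> 'I_3)
    (t : {ffun m.-tuple 'I_3 -> A}) :
  gact (\matrix_(a, b) (d a *+ (f a == b))) t =
  [ffun i => (\prod_(k < m) d (tnth i k)) * t [tuple of map f i]].
Proof.
apply/ffunP => i; rewrite !ffunE.
pose fi : m.-tuple 'I_3 := [tuple of map f i].
transitivity (\sum_j (fi == j)%:R * (\prod_(k < m) d (tnth i k) * t j)).
  apply: eq_bigr => j _; rewrite [RHS]mulrA [X in _ = X * _]mulrC; congr (_ * _).
  rewrite -prod_eq_tuple -big_split /=.
  by apply: eq_bigr => k _; rewrite mxE tnth_map mulr_natr.
exact: (sum_delta_tuple fi (fun j => _ * t j)).
Qed.

Definition cmx (g : 'M[R]_3) : 'M[C]_3 := map_mx (real_complex R) g.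
Definition ctens m (t : tensor R m) : {ffun m.-tuple 'I_3 -> C} :=
  [ffun i => ((t i)%:C)%C].

Lemma ctens_inj m : injective (@ctens m).
Proof.
by move=> s t /ffunP h; apply/ffunP => i; have := h i; rewrite !ffunE => /complexI.
Qed.

Lemma ctens_gact m g (t : tensor R m) : ctens (gact g t) = gact (cmx g) (ctens t).
Proof.
apply/ffunP => i; rewrite !ffunE rmorph_sum; apply: eq_bigr => j _.
by rewrite rmorphM rmorph_prod ffunE; congr (_ * _); apply: eq_bigr => k _; rewrite mxE.
Qed.

Lemma cmxM g h : cmx (g *m h) = cmx g *m cmx h.
Proof. exact: map_mxM. Qed.

Lemma ii : 'i%C * 'i%C = -1 :> C.
Proof. by rewrite -expr2 sqr_i. Qed.

Lemma i_neq0 : 'i%C != 0 :> C.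
Proof. by apply: contra_eq_neq ii => ->; rewrite mul0r eq_sym oppr_eq0 oner_eq0. Qed.

Ltac ci_field :=
  let j := fresh "j" in let hi := fresh "hi" in let j0 := fresh "j0" in
  have hi := ii; have j0 := i_neq0; move: hi j0; move: ('i%C : C) => j hi j0;
  field: hi; rewrite ?j0 //.

(** The columns of [Eb] are e1 - i e2, e1 + i e2 and e3, eigenvectors of every [rot u] for u, u^-1
    and 1; [Ub] is the inverse of [Eb]. *)
Definition Ub : 'M[C]_3 := mat3
  [:: [:: 2^-1; 'i%C / 2; 0]; [:: 2^-1; - 'i%C / 2; 0]; [:: 0; 0; 1]].
Definition Eb : 'M[C]_3 := mat3
  [:: [:: 1; 1; 0]; [:: - 'i%C; 'i%C; 0]; [:: 0; 0; 1]].

Lemma UbEb : Ub *m Eb = 1%:M.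
Proof.
mat3_tac; rewrite ?mulr1n ?mulr0n //; ci_field.
Qed.

Lemma EbUb : Eb *m Ub = 1%:M.
Proof. exact/mulmx1C/UbEb. Qed.

Definition cf m (x : {ffun m.-tuple 'I_3 -> C}) := gact Ub x.

Lemma cf_inj m : injective (@cf m).
Proof. by move=> x y /(congr1 (gact Eb)); rewrite /cf -!gactM EbUb !gact1. Qed.

Lemma cf_gact m (M : 'M[C]_3) (x : {ffun m.-tuple 'I_3 -> C}) :
  cf (gact M x) = gact (Ub *m M *m Eb) (cf x).
Proof. by rewrite /cf -!gactM -!mulmxA EbUb mulmx1. Qed.

Definition wgt (a : 'I_3) : int := [:: 1; -1; 0]`_a.
Definition wt m (J : m.-tuple 'I_3) : int := \sum_(k < m) wgt (tnth J k).
(** The flip and complex conjugation both exchange the first two eigenvectors; the flip also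
    contributes a sign for each e3 slot. *)
Definition sw (a : 'I_3) : 'I_3 := nth i2 [:: i1; i0; i2] a.
Definition bar m (J : m.-tuple 'I_3) : m.-tuple 'I_3 := [tuple of map sw J].
Definition n3 m (J : m.-tuple 'I_3) : nat := \sum_(k < m) (tnth J k == i2).

Lemma wt_bar m (J : m.-tuple 'I_3) : wt (bar J) = - wt J.
Proof.
rewrite /wt -sumrN; apply: eq_bigr => k _; rewrite tnth_map.
by move: (tnth J k); apply: forall3.
Qed.

Lemma n3_bar m (J : m.-tuple 'I_3) : n3 (bar J) = n3 J.
Proof.
by apply: eq_bigr => k _; rewrite tnth_map; move: (tnth J k); apply: forall3.
Qed.

Lemma cunit_reim u : cunit u ->
  ((complex.Re u)%:C)%C = (u + u^-1) / 2 /\ ((complex.Im u)%:C)%C = (u - u^-1) / 2 / 'i%C.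
Proof.
move=> hu; rewrite cunitV //; split; first by rewrite ReJ_add.
by rewrite ImJ_sub; ci_field.
Qed.

Lemma cf_rot m u (x : {ffun m.-tuple 'I_3 -> C}) J : cunit u ->
  cf (gact (cmx (rot u)) x) J = u ^ (wt J) * cf x J.
Proof.
move=> hu; have u0 := cunit_neq0 hu.
rewrite cf_gact.
have -> : Ub *m cmx (rot u) *m Eb = \matrix_(a, b) (u ^ wgt a *+ (id a == b)).
  have [hr hm] := cunit_reim hu.
  mat3_tac; rewrite ?mulr1n ?mulr0n ?rmorphN ?rmorph0 ?rmorph1 /=
    ?hr ?hm ?expr1z ?exprN1 ?expr0z //; ci_field; rewrite ?u0 //.
rewrite (gact_monomial (fun a => u ^ wgt a) id) ffunE; congr (_ * _).
  rewrite /wt; elim/big_rec2: _ => [|k y z _ ->]; first by rewrite expr0z.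
  by rewrite expfzDr.
by congr (_ _); apply: eq_from_tnth => k; rewrite tnth_map.
Qed.

Lemma cf_flip m (x : {ffun m.-tuple 'I_3 -> C}) J :
  cf (gact (cmx (flip R)) x) J = (-1) ^+ n3 J * cf x (bar J).
Proof.
rewrite cf_gact.
have -> : Ub *m cmx (flip R) *m Eb =
    \matrix_(a, b) ((-1) ^+ (a == i2) *+ (sw a == b)).
  mat3_tac; rewrite ?mulr1n ?mulr0n ?rmorphN ?rmorph0 ?rmorph1 /=
    ?expr0 ?expr1 //; ci_field.
rewrite (gact_monomial (fun a => (-1) ^+ (a == i2)) sw) ffunE; congr (_ * _).
by rewrite -prodrXr.
Qed.

Lemma cf_conj m (t : tensor R m) J :
  cf (ctens t) (bar J) = conjc (cf (ctens t) J).
Proof.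
rewrite !ffunE rmorph_sum; apply: eq_bigr => i _.
rewrite rmorphM rmorph_prod /= ffunE conjc_real; congr (_ * _).
apply: eq_bigr => k _; rewrite tnth_map.
have conj_i : conjc 'i%C = - 'i%C :> C by apply/eqP; rewrite eq_complex /= oppr0 !eqxx.
have conj_2 : conjc (2^-1) = 2^-1 :> C by rewrite fmorphV rmorph_nat.
move: (tnth J k) (tnth i k); apply: forall3; apply: forall3; rewrite !mxE;
  cbn [nth nat_of_ord sw]; rewrite ?rmorphM ?rmorphN ?conj_i ?conj_2 ?rmorph0 ?rmorph1 ?opprK //.
  by congr (_ * _); [exact: esym conj_i | exact: esym conj_2].
congr (_ * _); last exact: esym conj_2.
by rewrite -[LHS]opprK; congr (- _); exact: esym conj_i.
Qed.

Lemma rot_fix_tens m (t : tensor R m) u : cunit u ->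
  gact (rot u) t = t <-> forall J, cf (ctens t) J != 0 -> u ^ (wt J) = 1.
Proof.
move=> hu; split=> [h J n0|h].
  have := cf_rot (ctens t) J hu; rewrite -ctens_gact h.
  by move=> /esym /(canRL (mulfK n0)); rewrite divff.
apply: ctens_inj; apply: cf_inj; apply/ffunP => J; rewrite ctens_gact cf_rot //.
by have [->|/h ->] := eqVneq (cf (ctens t) J) 0; rewrite ?mulr0 ?mul1r.
Qed.

Lemma expr_gcdn (F : fieldType) (u : F) a b : u ^+ a = 1 -> u ^+ b = 1 -> u ^+ gcdn a b = 1.
Proof.
case: a => [|a] ha hb; first by rewrite gcd0n.
have [c _ /dvdnP[q e]] := Bezoutl b (ltn0Sn a).
have : u ^+ (gcdn a.+1 b + c * b) = 1 by rewrite e mulnC exprM ha expr1n.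
by rewrite exprD mulnC exprM hb expr1n mulr1.
Qed.

Lemma exprz_absz (F : fieldType) (u : F) (k : int) : u ^ k = 1 <-> u ^+ `|k|%N = 1.
Proof.
case: k => k; first by [].
rewrite NegzE abszN /= -exprnN; split=> [h|->]; last by rewrite invr1.
by rewrite -[RHS]invr1 -h invrK.
Qed.

Lemma wt_le m (J : m.-tuple 'I_3) : (`|wt J| <= m)%N.
Proof.
rewrite /wt -[X in (_ <= X)%N]card_ord -sum1_card.
elim/big_rec2: _ => // k a z _ h.
have : (`|wgt (tnth J k)| <= 1)%N by move: (tnth J k); apply: forall3.
by move: h; lia.
Qed.

Definition wt_dvd d m (t : tensor R m) :=
  forall J, cf (ctens t) J != 0 -> (d %| `|wt J|)%N.

(** [rot u] fixes [t] when u^w = 1 for each weight w that occurs, and Bezout reduces these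
    conditions to the gcd. The empty gcd is 0, which correctly gives the whole circle when no
    nonzero weight occurs. *)
Lemma rot_fix_gcd m (t : tensor R m) : exists d, [/\ (d <= m)%N, wt_dvd d t &
  forall u, cunit u -> (gact (rot u) t = t <-> u ^+ d = 1)].
Proof.
pose P J := cf (ctens t) J != 0; pose F (J : m.-tuple 'I_3) := `|wt J|%N.
have dv : wt_dvd (\big[gcdn/0%N]_(J | P J) F J) t.
  by move=> J n0; exact: (biggcdn_inf (P := P) (F := F) J n0 (dvdnn _)).
exists (\big[gcdn/0%N]_(J | P J) F J); split=> // [|u hu].
  have [/existsP[J /andP[n0 w0]]|/existsPn h] :=
    boolP [exists J : m.-tuple 'I_3, (cf (ctens t) J != 0) && (`|wt J| != 0)%N].
    apply: leq_trans (wt_le J); apply: dvdn_leq; first by rewrite lt0n.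
    exact: dv.
  by rewrite big1 // => J n0; apply/eqP; have := h J; rewrite -/(P J) n0 /= negbK.
rewrite rot_fix_tens //; split=> [h|h J n0].
  elim/big_ind: _ => [|a b|J /h /exprz_absz //]; first exact: expr0.
  exact: expr_gcdn.
apply/exprz_absz; have /dvdnP[q ->] := dv J n0.
by rewrite mulnC exprM h expr1n.
Qed.

End Weights.

(** * Forms on the sphere with a distinguished axis *)

Section AxialForms.
Variable R : realType.
Local Notation C := R[i].
Local Notation Re := complex.Re.
Implicit Types (m a b : nat) (g h : 'M[R]_3) (x : 'cV[R]_3) (u v w : C).

Lemma normc2 u : normc u ^+ 2 = (Re u) ^+ 2 + (complex.Im u) ^+ 2.
Proof. by case: u => p q; rewrite /= sqr_sqrtr //; nra. Qed.

Lemma normc_ge0 u : 0 <= normc u.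
Proof. by case: u => p q; exact: sqrtr_ge0. Qed.

Lemma ler_Re_normc u : Re u <= normc u.
Proof.
have := normc2 u; have := normc_ge0 u; move: (normc u) (Re u) (complex.Im u) => N p q.
by move=> N0 h; rewrite leNgt; apply/negP => lt; nra.
Qed.

Lemma cunit_normc u : cunit u <-> normc u = 1.
Proof.
rewrite /cunit -normc2; split=> [/eqP|->]; last by rewrite expr1n.
by rewrite sqrp_eq1 ?normc_ge0 // => /eqP.
Qed.

Lemma normcX u k : normc (u ^+ k) = normc u ^+ k.
Proof. by elim: k => [|k IH]; rewrite ?expr0 ?normc1 // !exprS normcM IH. Qed.

Lemma cunit_root a v : (0 < a)%N -> cunit v -> exists2 u, cunit u & u ^+ a = v.
Proof.
move=> a0 /cunit_normc hv; exists (a.-root v); last exact: rootCK.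
apply/cunit_normc/eqP; rewrite -(pexpr_eq1 a0) ?normc_ge0 //.
by rewrite -normcX rootCK ?hv.
Qed.

Lemma form_homog m (F : 'cV[R]_3 -> R) c x : form m F -> F (c *: x) = c ^+ m * F x.
Proof.
case=> t ht; rewrite -!ht -tdotZr; congr tdot.
apply/ffunP => i; rewrite !ffunE; under eq_bigr => k _ do rewrite mxE.
by rewrite big_split /= prodr_const card_ord.
Qed.

(* [P] is on the unit sphere the restriction of a form of degree m. *)
Definition sform m (P : 'cV[R]_3 -> R) :=
  exists2 F, form m F & forall x, dotv x x = 1 -> F x = P x.

Lemma sform_ext m (P Q : 'cV[R]_3 -> R) :
  (forall x, dotv x x = 1 -> P x = Q x) -> sform m P -> sform m Q.
Proof. by move=> e [F hF E]; exists F => // x hx; rewrite E ?e. Qed.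

Lemma sformD m (P Q : 'cV[R]_3 -> R) :
  sform m P -> sform m Q -> sform m (fun x => P x + Q x).
Proof.
move=> [F hF E] [G hG E']; exists (fun x => F x + G x); first exact: formD.
by move=> x hx; rewrite E // E'.
Qed.

Lemma sformZ m c (P : 'cV[R]_3 -> R) : sform m P -> sform m (fun x => c * P x).
Proof.
move=> [F hF E]; exists (fun x => c * F x); first exact: formZ.
by move=> x hx; rewrite E.
Qed.

Lemma sform0 m : sform m (fun _ => 0).
Proof. by exists (fun _ => 0) => //; exists 0 => x; rewrite tdot0l. Qed.

Lemma sform_mulX m k (P : 'cV[R]_3 -> R) :
  sform m P -> sform m.+1 (fun x => x k 0 * P x).
Proof.
move=> [F hF E]; exists (fun x => x k 0 * F x); first exact: form_mulX.
by move=> x hx; rewrite E.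
Qed.

(** Multiplication by [dotv x x], which is 1 on the sphere, raises the degree by two. Hence only the
    parity of the degree and an upper bound matter. *)
Lemma sform_pad m (P : 'cV[R]_3 -> R) k : sform m P -> sform (m + k.*2) P.
Proof.
move=> [F hF E].
suff [G hG EG] : exists2 G, form (m + k.*2) G & forall x, dotv x x = 1 -> G x = F x.
  by exists G => // x hx; rewrite EG ?E.
elim: k => [|k [G hG EG]]; first by exists F; rewrite ?addn0.
exists (fun x => x i0 0 * (x i0 0 * G x) + x i1 0 * (x i1 0 * G x) + x i2 0 * (x i2 0 * G x)).
  rewrite doubleS !addnS; have h l := form_mulX l (form_mulX l hG).
  exact: (formD (formD (h i0) (h i1)) (h i2)).
by move=> x hx; rewrite -EG // -[RHS]mul1r -[X in _ = X * _]hx dotvE; ring.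
Qed.

Lemma sform_padE m m' (P : 'cV[R]_3 -> R) :
  sform m P -> (m <= m')%N -> odd m = odd m' -> sform m' P.
Proof.
move=> h le od; have -> : m' = (m + (m' - m)./2.*2)%N; last exact: sform_pad.
by rewrite even_halfK ?oddB ?od ?addbb // subnKC.
Qed.

Lemma sform_isotropy m (P : 'cV[R]_3 -> R) : sform m P ->
  exists2 s : tensor R m, Sspace s & forall g, isotropy s g <->
    SO3 g /\ forall x, dotv x x = 1 -> P (g *m x) = P x.
Proof.
move=> [F hF E]; have [s sS sI] := form_isotropy hF; exists s => // g.
rewrite sI; split=> -[gS h]; split=> // x.
  by move=> hx; rewrite -!E ?dotv_SO3.
have [->|x0] := eqVneq x 0; first by rewrite mulmx0.
have [c [c0 hc]] := unit_scale x0.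
have := h _ hc; rewrite -!E ?dotv_SO3 // -scalemxAr !(form_homog _ _ hF).
by apply: mulfI; rewrite expf_neq0.
Qed.

Definition cw x : C := (x i0 0 +i* x i1 0)%C.

Lemma cw_rot u x : cw (rot u *m x) = u * cw x.
Proof. by case: u => p q; apply/eqP; rewrite eq_complex /= !mulmx3 !mxE /=; apply/andP; split; apply/eqP; ring. Qed.

Lemma cw_flip x : cw (flip R *m x) = conjc (cw x).
Proof. by apply/eqP; rewrite eq_complex /= !mulmx3 !mxE /=; apply/andP; split; apply/eqP; ring. Qed.

Lemma form_cw a (c : C) : form a (fun x => Re (c * cw x ^+ a)).
Proof.
elim: a c => [|a IH] c.
  by apply: form_ext (form_const (Re c)) => x; rewrite expr0 mulr1.
have := formD (form_mulX i0 (IH c)) (form_mulX i1 (IH ('i%C * c))).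
apply: form_ext => x; rewrite exprS mulrCA -mulrA.
by case: (c * _) => p q /=; ring.
Qed.

(** One even weight a and one odd weight b, each with two coefficients separated by the factor z^2.
    The flip conjugates p and p', and conjugates and negates q and q'; choosing the phases decides
    whether flips survive. *)
Definition axial a b (p p' q q' : C) x : R :=
  Re ((p + p' * ((x i2 0 ^+ 2)%:C)%C) * cw x ^+ a) +
  x i2 0 * Re ((q + q' * ((x i2 0 ^+ 2)%:C)%C) * cw x ^+ b).

Lemma ReD u v : Re (u + v) = Re u + Re v. Proof. by case: u v => [? ?] [? ?]. Qed.
Lemma ReN u : Re (- u) = - Re u. Proof. by case: u. Qed.
Lemma ReZ (r : R) u : Re ((r%:C)%C * u) = r * Re u.
Proof. by case: u => s t /=; ring. Qed.
Lemma ReJ u : Re (conjc u) = Re u. Proof. by case: u. Qed.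

Lemma axialE a b (p p' q q' : C) x : axial a b p p' q q' x =
  Re (p * cw x ^+ a) + x i2 0 * (x i2 0 * Re (p' * cw x ^+ a)) +
  (x i2 0 * Re (q * cw x ^+ b) + x i2 0 * (x i2 0 * (x i2 0 * Re (q' * cw x ^+ b)))).
Proof.
rewrite /axial !mulrDl !ReD.
by rewrite ![_ * _%:C%C * _]mulrAC ![_ * _ * _%:C%C]mulrC !ReZ; ring.
Qed.

Lemma axialB a b p p' q q' r r' s s' x :
  axial a b p p' q q' x - axial a b r r' s s' x =
  axial a b (p - r) (p' - r') (q - s) (q' - s') x.
Proof. by rewrite !axialE !mulrBl !ReD !ReN; ring. Qed.

Lemma axial_rot a b p p' q q' u x :
  axial a b p p' q q' (rot u *m x) =
  axial a b (p * u ^+ a) (p' * u ^+ a) (q * u ^+ b) (q' * u ^+ b) x.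
Proof.
have z : (rot u *m x) i2 0 = x i2 0 by rewrite mulmx3 !mxE /=; ring.
by rewrite !axialE cw_rot z !exprMn !mulrA.
Qed.

Lemma axial_flip a b p p' q q' x :
  axial a b p p' q q' (flip R *m x) =
  axial a b (conjc p) (conjc p') (- conjc q) (- conjc q') x.
Proof.
have z : (flip R *m x) i2 0 = - x i2 0 by rewrite mulmx3 !mxE /=; ring.
have J (c : C) k : Re (c * conjc (cw x) ^+ k) = Re (conjc c * cw x ^+ k).
  by rewrite -[LHS]ReJ rmorphM rmorphXn; congr (Re (_ * _ ^+ _)); exact: conjcK.
by rewrite !axialE cw_flip z !J !mulNr !ReN; ring.
Qed.

Lemma axial_zero a b p p' q q' : (0 < a)%N -> (0 < b)%N ->
  (forall x, dotv x x = 1 -> axial a b p p' q q' x = 0) ->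
  [/\ p = 0, p' = 0, q = 0 & q' = 0].
Proof.
move=> a0 b0 h.
(* The points at heights z and -z share the same [cw], so adding and subtracting separates the parts
   even and odd in z. *)
have hw (z r : R) u : r ^+ 2 + z ^+ 2 = 1 -> cunit u ->
    Re ((p + p' * ((z ^+ 2)%:C)%C) * (((r%:C)%C) * u) ^+ a) = 0 /\
    z * Re ((q + q' * ((z ^+ 2)%:C)%C) * (((r%:C)%C) * u) ^+ b) = 0.
  move=> hz hu; pose X s := vec3 (r * Re u) (r * complex.Im u) s.
  have Xw s : cw (X s) = (r%:C)%C * u.
    by apply/eqP; rewrite /cw !mxE /= eq_complex; case: (u) => c d /=;
      apply/andP; split; apply/eqP; ring.
  have X1 s : s ^+ 2 = z ^+ 2 -> dotv (X s) (X s) = 1.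
    by move=> sz; rewrite dotvE !mxE /=; move: hu; rewrite /cunit; nra.
  have := h _ (X1 _ (erefl _)); have := h _ (X1 (- z) (sqrrN _)).
  by rewrite /axial !Xw !mxE /= sqrrN; split; lra.
have Z (c : C) (r : R) k : (0 < k)%N -> r != 0 ->
    (forall u, cunit u -> Re (c * ((r%:C)%C * u) ^+ k) = 0) -> c = 0.
  move=> k0 r0 H.
  have H' v : cunit v -> Re (c * v) = 0.
    move=> hv; have [u hu <-] := cunit_root k0 hv.
    have := H u hu; rewrite exprMn -rmorphXn mulrCA ReZ => /eqP.
    by rewrite mulf_eq0 expf_eq0 (negbTE r0) andbF => /eqP.
  have := H' 1 (cunit1 R); have : Re (c * 'i%C) = 0.
    by apply: H'; rewrite /cunit /=; ring.
  case: (c) => s t /= h1 h2; apply/eqP; rewrite eq_complex /=.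
  by apply/andP; split; apply/eqP; lra.
(* A Pythagorean triple gives two distinct nonzero heights whose radii are rational; together with
   height 0 they separate the four coefficients. *)
pose z1 : R := 3 / 5; pose z2 : R := 4 / 5.
have e0 : (1 : R) ^+ 2 + 0 ^+ 2 = 1 by ring.
have e1 : z2 ^+ 2 + z1 ^+ 2 = 1 by rewrite /z1 /z2; field.
have e2 : z1 ^+ 2 + z2 ^+ 2 = 1 by rewrite /z1 /z2; field.
have z10 : z1 != 0 by rewrite /z1; lra.
have z20 : z2 != 0 by rewrite /z2; lra.
have p0 : p = 0.
  have := @Z _ 1 a a0 (oner_neq0 _) (fun u hu => proj1 (hw _ _ u e0 hu)).
  by rewrite expr0n /= mulr0 addr0.
have p'0 : p' = 0.
  have := @Z _ z2 a a0 z20 (fun u hu => proj1 (hw _ _ u e1 hu)).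
  rewrite p0 add0r => /eqP; rewrite mulf_eq0 => /orP[/eqP //|/eqP /complexI /eqP].
  by rewrite sqrf_eq0 (negbTE z10).
have cancel (z y : R) : z != 0 -> z * y = 0 -> y = 0.
  by move=> n0 /eqP; rewrite mulf_eq0 (negbTE n0) => /eqP.
have q1 : q + q' * ((z1 ^+ 2)%:C)%C = 0.
  exact: (@Z _ z2 b b0 z20 (fun u hu => cancel _ _ z10 (proj2 (hw _ _ u e1 hu)))).
have q2 : q + q' * ((z2 ^+ 2)%:C)%C = 0.
  exact: (@Z _ z1 b b0 z10 (fun u hu => cancel _ _ z20 (proj2 (hw _ _ u e2 hu)))).
have q'0 : q' = 0.
  have : q' * ((z2 ^+ 2 - z1 ^+ 2)%:C)%C = 0.
    have := congr2 (fun s t : C => s - t) q2 q1.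
    by rewrite subr0 opprD addrACA subrr add0r -mulrBr -rmorphB.
  move=> /eqP; rewrite mulf_eq0 => /orP[/eqP //|/eqP /complexI].
  by rewrite /z1 /z2 => H; exfalso; lra.
by split => //; move: q1; rewrite q'0 mul0r addr0.
Qed.

Lemma axial_bound a b p p' q q' x : (2 <= a)%N -> (2 <= b)%N -> dotv x x = 1 ->
  axial a b p p' q q' x <=
  (normc p + normc p' + normc q + normc q') * (1 - x i2 0 ^+ 2).
Proof.
move=> a2 b2; rewrite dotvE => hx; set z := x i2 0 in hx *.
have W : normc (cw x) ^+ 2 = 1 - z ^+ 2 by rewrite normc2 /=; nra.
have W0 := normc_ge0 (cw x).
have bd (c : C) k : (2 <= k)%N -> `|Re (c * cw x ^+ k)| <= normc c * (1 - z ^+ 2).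
  move=> k2; have e : normc (c * cw x ^+ k) <= normc c * (1 - z ^+ 2).
    rewrite normcM ler_wpM2l ?normc_ge0 // -W normcX.
    by apply: ler_wiXn2l => //; nra.
  rewrite ler_norml; apply/andP; split; last exact: le_trans (ler_Re_normc _) e.
  by rewrite lerNl -ReN (le_trans (ler_Re_normc _)) // normcN.
have z1 : `|z| <= 1 by rewrite ler_norml; nra.
have zb (y B : R) : `|y| <= B -> `|z * y| <= B.
  by move=> yB; rewrite normrM; apply: le_trans yB; rewrite ler_piMl.
rewrite axialE !mulrDl -!addrA; apply: le_trans (ler_norm _) _.
do 2!(apply: le_trans (ler_normD _ _) _; rewrite lerD ?bd ?zb ?bd //).
by apply: le_trans (ler_normD _ _) _; rewrite lerD ?zb ?bd.
Qed.

(** On the sphere |cw x|^2 = 1 - z^2, so [axial] is at most Q (1 - z^2). With the added term (Q + 1)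
    z^(2n), the value Q + 1 is reached only at the poles: elsewhere P <= (Q + 1) z^2 + Q (1 - z^2) <
    Q + 1. Every symmetry thus preserves the axis, and comparing coefficients determines which ones
    occur. The bounds on a + 2 and b + 3 are the degrees of the terms with p' and q'. *)
Lemma axial_isotropy n a b p p' q q' : (0 < n)%N ->
  ~~ odd a -> (2 <= a <= 2 * n)%N -> odd b -> (3 <= b < 2 * n)%N ->
  (p' != 0 -> (a + 2 <= 2 * n)%N) -> (q' != 0 -> (b + 3 <= 2 * n)%N) ->
  exists2 s : tensor R (2 * n), Sspace s & forall g, isotropy s g <->
    (exists2 u, cunit u & g = rot u /\
      [/\ p * u ^+ a = p, p' * u ^+ a = p', q * u ^+ b = q & q' * u ^+ b = q']) \/
    (exists2 u, cunit u & g = rot u *m flip R /\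
      [/\ conjc (p * u ^+ a) = p, conjc (p' * u ^+ a) = p',
          - conjc (q * u ^+ b) = q & - conjc (q' * u ^+ b) = q']).
Proof.
move=> n0 ao /andP[a2 an] bo /andP[b3 bn] hp' hq'.
have o2n : odd (2 * n) = false by rewrite mul2n odd_double.
pose Q := normc p + normc p' + normc q + normc q'.
have Q0 : 0 <= Q by rewrite !addr_ge0 ?normc_ge0.
pose P x := (Q + 1) * x i2 0 ^+ (2 * n) + axial a b p p' q q' x.
have hP : sform (2 * n) P.
  apply: sformD.
    apply: sformZ; elim: (2 * n)%N => [|k IH].
      by exists (fun _ => 1); [exact: form_const | move=> x _; rewrite expr0].
    by apply: sform_ext (sform_mulX i2 IH) => x _; rewrite exprS.
  apply: sform_ext (fun x _ => esym (axialE a b p p' q q' x)) _.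
  have cwf k c : sform k (fun x => Re (c * cw x ^+ k)).
    by exists (fun x => Re (c * cw x ^+ k)) => //; exact: form_cw.
  apply: sformD; apply: sformD.
  - by apply: sform_padE (cwf a p) an _; rewrite o2n (negbTE ao).
  - have [->|nz] := eqVneq p' 0.
      by apply: sform_ext (sform0 _) => x _; rewrite mul0r /= !mulr0.
    apply: sform_padE (sform_mulX i2 (sform_mulX i2 (cwf a p'))) _ _.
      by have := hp' nz; lia.
    by rewrite /= negbK o2n (negbTE ao).
  - apply: sform_padE (sform_mulX i2 (cwf b q)) bn _.
    by rewrite /= bo o2n.
  - have [->|nz] := eqVneq q' 0.
      by apply: sform_ext (sform0 _) => x _; rewrite mul0r /= !mulr0.
    apply: sform_padE (sform_mulX i2 (sform_mulX i2 (sform_mulX i2 (cwf b q')))) _ _.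
      by have := hq' nz; lia.
    by rewrite /= bo o2n.
have [s sS sI] := sform_isotropy hP; exists s => // g; rewrite sI.
have a0 : (0 < a)%N by lia.
have b0 : (0 < b)%N by lia.
have rz u x : (rot u *m x) i2 0 = x i2 0 by rewrite mulmx3 !mxE /=; ring.
have fz x : (flip R *m x) i2 0 = - x i2 0 by rewrite mulmx3 !mxE /=; ring.
have Prot u : (forall x, dotv x x = 1 -> P (rot u *m x) = P x) <->
    [/\ p * u ^+ a = p, p' * u ^+ a = p', q * u ^+ b = q & q' * u ^+ b = q'].
  split=> [h|[hp hp1 hq hq1] x _]; last by rewrite /P axial_rot rz hp hp1 hq hq1.
  have [|/subr0_eq h1 /subr0_eq h2 /subr0_eq h3 /subr0_eq h4] := @axial_zero a b (p * u ^+ a - p) (p' * u ^+ a - p')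
    (q * u ^+ b - q) (q' * u ^+ b - q') a0 b0.
    move=> x hx; rewrite -axialB -axial_rot.
    by have := h x hx; rewrite /P rz => /addrI ->; rewrite subrr.
  by split.
have Pflip u : (forall x, dotv x x = 1 -> P (rot u *m flip R *m x) = P x) <->
    [/\ conjc (p * u ^+ a) = p, conjc (p' * u ^+ a) = p',
          - conjc (q * u ^+ b) = q & - conjc (q' * u ^+ b) = q'].
  split=> [h|[hp hp1 hq hq1] x _]; last first.
    by rewrite /P -mulmxA axial_rot axial_flip rz fz exprM sqrrN -exprM hp hp1 hq hq1.
  have [|/subr0_eq h1 /subr0_eq h2 /subr0_eq h3 /subr0_eq h4] := @axial_zero a b (conjc (p * u ^+ a) - p) (conjc (p' * u ^+ a) - p')
    (- conjc (q * u ^+ b) - q) (- conjc (q' * u ^+ b) - q') a0 b0.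
    move=> x hx; rewrite -axialB -axial_flip -axial_rot mulmxA.
    by have := h x hx; rewrite /P -mulmxA rz fz exprM sqrrN -exprM mulmxA => /addrI ->; rewrite subrr.
  by split.
split=> [[gS gP]|[[u hu [-> h]]|[u hu [-> h]]]]; last first.
- by split; [apply: SO3_mul; [exact: rot_SO3|exact: flip_SO3] | apply/Pflip].
- by split; [exact: rot_SO3 | apply/Prot].
set y := g *m e3 R.
have y1 : dotv y y = 1 by rewrite dotv_SO3 // e3_unit.
have Pe : P (e3 R) = Q + 1.
  have -> : P (e3 R) = (Q + 1) * 1 ^+ (2 * n) + axial a b p p' q q' (e3 R) by rewrite /P mxE.
  have w0 : cw (e3 R) = 0 by apply/eqP; rewrite eq_complex /= !mxE /= eqxx.
  have w0X k : (0 < k)%N -> cw (e3 R) ^+ k = 0 by move=> k0; rewrite w0 expr0n gtn_eqF.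
  by rewrite axialE !w0X // !mulr0 expr1n mulr1 !addr0.
have yz : y i2 0 ^+ 2 = 1.
  have := gP _ (e3_unit R); rewrite -/y Pe /P => E.
  have bd := axial_bound p p' q q' a2 (ltnW b3) y1.
  have le1 : y i2 0 ^+ 2 <= 1 by move: y1; rewrite dotvE; nra.
  have le2 : y i2 0 ^+ (2 * n) <= y i2 0 ^+ 2.
    rewrite exprM; apply: ler_iXnr => //; exact: sqr_ge0.
  rewrite -/Q in bd; apply/eqP; rewrite eq_le le1 leNgt; apply/negP => lt1; nra.
have [y0 y1'] : y i0 0 = 0 /\ y i1 0 = 0.
  by move: y1; rewrite dotvE => y1; split; apply/eqP; rewrite -sqrf_eq0; apply/eqP; nra.
move/eqP: yz; rewrite sqrf_eq1 => /orP[]/eqP yz.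
  have ye : g *m e3 R = e3 R by apply: vec3P; rewrite -/y ?y0 ?y1' ?yz !mxE.
  have [u hu gE] := SO3_fix_e3 gS ye; left; exists u => //; split=> //.
  by apply/Prot => x hx; rewrite -gE; exact: gP.
have ye : g *m e3 R = - e3 R by apply: vec3P; rewrite -/y ?y0 ?y1' ?yz !mxE /= ?oppr0.
have [u hu gE] := SO3_neg_e3 gS ye; right; exists u => //; split=> //.
by apply/Pflip => x hx; rewrite -gE; exact: gP.
Qed.

Definition Zd d g := exists2 u : C, cunit u & u ^+ d = 1 /\ g = rot u.
Definition Dd d g := Zd d g \/ exists2 u : C, cunit u & u ^+ d = 1 /\ g = rot u *m flip R.

End AxialForms.

(** * Realising cyclic and dihedral classes by symmetric tensors *)

Section AxialClasses.
Variable R : realType.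
Local Notation C := R[i].
Implicit Types (m n d : nat) (g h : 'M[R]_3) (x : 'cV[R]_3) (u v w : C).

Lemma conjc_eq u v : conjc u = v -> u = conjc v.
Proof. by move=> <-; rewrite conjcK. Qed.

Lemma conjci : conjc 'i%C = - 'i%C :> C.
Proof. by apply/eqP; rewrite eq_complex /= oppr0 !eqxx. Qed.

Lemma conjMi u : conjc ('i%C * u) = - ('i%C * conjc u).
Proof. by case: u => a b; apply/eqP; rewrite eq_complex /=; apply/andP; split; apply/eqP; ring. Qed.

Lemma i_neq_Ni : 'i%C <> - 'i%C :> C.
Proof. by move/eqP; rewrite eq_complex /= oppr0 eqxx /= => /eqP h; lra. Qed.

Lemma mulIi u v : 'i%C * u = 'i%C * v -> u = v.
Proof. by apply: mulfI; exact: i_neq0. Qed.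

Lemma cunit_conj1 u : conjc u = 1 -> u = 1.
Proof. by move/conjc_eq ->; rewrite rmorph1. Qed.

(** The coefficient 1 in even weight and ['i] in odd weight are both kept by the flip. One weight d
    is enough for d >= 2, the coprime weights 2 and 3 serve d = 1, and for d = 0 only the term
    z^(2n) remains. *)
Lemma exists_Dd n d : (3 <= n)%N -> (d <= 2 * n)%N ->
  exists2 s : tensor R (2 * n), Sspace s & forall g, isotropy s g <-> Dd d g.
Proof.
move=> n3 dn; have n0 : (0 < n)%N by lia.
have nn (P : Prop) : (0 : C) != 0 -> P by rewrite eqxx.
have [-> |d0] := eqVneq d 0%N.
  have [||||||s sS sI] := @axial_isotropy R n 2 3 0 0 0 0 n0; do ?[by []|lia|exact: nn].
  exists s => // g; rewrite sI; split=> -[[u hu [e h]]|[u hu [e h]]].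
  - by left; exists u.
  - by right; exists u.
  - by left; exists u => //; split=> //; split; rewrite mul0r.
  - by right; exists u => //; split=> //; split; rewrite mul0r ?rmorph0 ?oppr0.
have [->|d1] := eqVneq d 1%N.
  have [||||||s sS sI] := @axial_isotropy R n 2 3 1 0 'i%C 0 n0; do ?[by []|lia|exact: nn].
  have u1 u : u ^+ 2 = 1 -> u ^+ 3 = 1 -> u ^+ 1 = 1.
    by move=> h; rewrite exprS h mulr1.
  exists s => // g; rewrite sI; split=> -[[u hu [e h]]|[u hu [e h]]].
  - left; exists u => //; case: h; rewrite !mul1r => h2 _ h3 _; split=> //.
    by apply: u1 => //; apply: mulIi; rewrite h3 mulr1.
  - right; exists u => //; case: h; rewrite !mul1r => /cunit_conj1 h2 _ h3 _; split=> //.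
    apply: u1 => //; apply: cunit_conj1; apply: mulIi; rewrite mulr1 -[RHS]h3.
    by rewrite conjMi opprK.
  - by left; exists u => //; split=> //; move: e; rewrite expr1 => ->; rewrite !expr1n !mulr1.
  - by right; exists u => //; split=> //; move: e; rewrite expr1 => ->; rewrite !expr1n !mulr1 rmorph1 rmorph0 oppr0 conjci opprK.
have [od|ev] := boolP (odd d).
  have [||||||s sS sI] := @axial_isotropy R n 2 d 0 0 'i%C 0 n0; do ?[by []|lia|exact: nn].
  exists s => // g; rewrite sI; split=> -[[u hu [e h]]|[u hu [e h]]].
  - left; exists u => //; case: h => _ _ h3 _; split=> //.
    by apply: mulIi; rewrite h3 mulr1.
  - right; exists u => //; case: h => _ _ h3 _; split=> //.
    apply: cunit_conj1; apply: mulIi; rewrite mulr1 -[RHS]h3.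
    by rewrite conjMi opprK.
  - by left; exists u => //; split=> //; rewrite e !mulr1 !mul0r.
  - by right; exists u => //; split=> //; rewrite e !mulr1 !mul0r rmorph0 oppr0 conjci opprK.
have [||||||s sS sI] := @axial_isotropy R n d 3 1 0 0 0 n0; do ?[by []|lia|exact: nn].
exists s => // g; rewrite sI; split=> -[[u hu [e h]]|[u hu [e h]]].
- by left; exists u => //; case: h; rewrite !mul1r.
- by right; exists u => //; case: h; rewrite !mul1r => /cunit_conj1.
- by left; exists u => //; split=> //; rewrite e !mulr1 !mul0r.
- by right; exists u => //; split=> //; rewrite e !mulr1 !mul0r rmorph0 oppr0 rmorph1.
Qed.

(** Two coefficients of the same weight with phases 1 and ['i] are preserved by no common flip. The
    second one has degree d + 2 for even d and d + 3 for odd d; the latter also fits, since 2n is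
    even. *)
Lemma exists_Zd n d : (3 <= n)%N -> (0 < d)%N -> (d + 2 <= 2 * n)%N ->
  exists2 s : tensor R (2 * n), Sspace s & forall g, isotropy s g <-> Zd d g.
Proof.
move=> n3 d0 dn; have n0 : (0 < n)%N by lia.
have nn (P : Prop) : (0 : C) != 0 -> P by rewrite eqxx.
have [->|d1] := eqVneq d 1%N.
  have [||||||s sS sI] := @axial_isotropy R n 2 3 1 'i%C 1 0 n0; do ?[by []|lia|exact: nn].
  exists s => // g; rewrite sI; split=> [[[u hu [e h]]|[u hu [e h]]]|[u hu [e h]]].
  - exists u => //; case: h; rewrite !mul1r => h2 _ h3 _; split=> //.
    by move: h3; rewrite exprS h2 mulr1.
  - case: h; rewrite mul1r => /cunit_conj1 -> /esym; rewrite mulr1 conjci => /i_neq_Ni [].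
  - by left; exists u => //; split=> //; move: e; rewrite expr1 => ->; rewrite !expr1n !mulr1.
have [od|ev] := boolP (odd d).
  have [||||||s sS sI] := @axial_isotropy R n 2 d 0 0 1 'i%C n0; do ?[by []|lia|exact: nn].
  exists s => // g; rewrite sI; split=> [[[u hu [e h]]|[u hu [e h]]]|[u hu [e h]]].
  - by exists u => //; case: h; rewrite !mul1r.
  - case: h; rewrite mul1r => _ _ h3; rewrite conjMi opprK => h4.
    exfalso; have h5 : conjc (u ^+ d) = 1 by apply: mulIi; rewrite h4 mulr1.
    by move: h3; rewrite h5 => /eqP; rewrite eq_complex /= oppr0 eqxx andbT => /eqP; lra.
  - by left; exists u => //; split=> //; rewrite e !mulr1 !mul0r.
have [||||||s sS sI] := @axial_isotropy R n d 3 1 'i%C 0 0 n0; do ?[by []|lia|exact: nn].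
exists s => // g; rewrite sI; split=> [[[u hu [e h]]|[u hu [e h]]]|[u hu [e h]]].
- by exists u => //; case: h; rewrite !mul1r.
- case: h; rewrite mul1r => /cunit_conj1 -> /esym; rewrite mulr1 conjci => /i_neq_Ni [].
- by left; exists u => //; split=> //; rewrite e !mulr1 !mul0r.
Qed.

Lemma isotropy_conj m (t : tensor R m) h g : SO3 h ->
  isotropy (gact h t) g <-> isotropy t (h^T *m g *m h).
Proof.
move=> hS; have hT := SO3_tr hS; split=> -[gS gt]; rewrite actE in gt.
  split; first exact: SO3_conj.
  by rewrite actE !gactM gt -gactM SO3_trK // gact1.
set M := _ *m _ in gS gt.
have e : g = h *m M *m h^T by rewrite SO3_conjK.
move: M gS gt e => M gS gt e; split; first by rewrite e; do 2!apply: SO3_mul => //.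
by rewrite actE e !gactM -(gactM h^T) SO3_trK // gact1 gt.
Qed.

Lemma isotropyM m (t : tensor R m) g h :
  isotropy t g -> isotropy t h -> isotropy t (g *m h).
Proof.
move=> [gS gt] [hS ht]; split; first exact: SO3_mul.
by move: gt ht; rewrite !actE => gt ht; rewrite gactM ht.
Qed.

Lemma isotropyV m (t : tensor R m) g : isotropy t g -> isotropy t g^T.
Proof.
move=> [gS gt]; split; first exact: SO3_tr.
by move: gt; rewrite !actE => gt; rewrite -[t in LHS]gt -gactM SO3_trK // gact1.
Qed.

Lemma isotropy1 m (t : tensor R m) : isotropy t 1%:M.
Proof. by split; [exact: SO3_1 | rewrite actE gact1]. Qed.

Lemma isotropy_axial m (t : tensor R m) :
  (forall g, isotropy t g -> g *m e3 R = e3 R \/ g *m e3 R = - e3 R) ->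
  exists2 d, (d <= m)%N & (wt_dvd d t /\ forall g, isotropy t g <-> Zd d g) \/
    exists2 h, SO3 h & forall g, isotropy (gact h t) g <-> Dd d g.
Proof.
move=> H; have [d [dm dv hd]] := rot_fix_gcd t; exists d => //.
have [[f [ft fe]]|nf] := pselect (exists f, isotropy t f /\ f *m e3 R = - e3 R); last first.
  left; split=> // g; split=> [[gS gt]|[u hu [ud ->]]]; last first.
    by split; [exact: rot_SO3 | rewrite actE hd].
  have [ge|ge] := H g (conj gS gt); last by case: nf; exists g.
  have [u hu gE] := SO3_fix_e3 gS ge; exists u => //; split=> //.
  by apply/(hd u hu); rewrite -gE.
right; have [fS _] := ft; have [u hu fE] := SO3_neg_e3 fS fe.
(* Conjugating rot u flip by rot v gives rot (v^2 u) flip, because the flip inverts rotations about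
   e3; v^2 is therefore the inverse of u. *)
have [v hv v2] := @cunit_root R 2 (conjc u) isT (cunitJ hu).
have vS := rot_SO3 hv; exists (rot v) => //.
set t' := gact (rot v) t.
have ft' : gact (flip R) t' = t'.
  have e : rot v *m f *m (rot v)^T = flip R.
    rewrite fE rot_tr mulmxA -mulmxA flip_rot conjcK mulmxA -!rotM.
    by rewrite mulrAC -expr2 v2 mulrC (proj1 (cunitE u) hu) rot1 mul1mx.
  rewrite -e /t' -gactM -!mulmxA SO3_trK // mulmx1 gactM.
  by case: ft => _; rewrite actE => ->.
have rt' w : cunit w -> gact (rot w) t' = t' <-> w ^+ d = 1.
  move=> hw; rewrite -hd // /t' -gactM -rotM mulrC rotM gactM; split=> [e|-> //].
  by move: (congr1 (gact (rot v)^T) e); rewrite -!(gactM (rot v)^T (rot v)) SO3_trK // !gact1.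
move=> g; split=> [[gS gt]|[[w hw [wd ->]]|[w hw [wd ->]]]]; last 2 first.
- by split; [exact: rot_SO3 | rewrite actE rt'].
- split; first by apply: SO3_mul; [exact: rot_SO3|exact: flip_SO3].
  by rewrite actE gactM ft' rt'.
have [ge|ge] : g *m e3 R = e3 R \/ g *m e3 R = - e3 R.
  have /H : isotropy t ((rot v)^T *m g *m rot v) by apply/isotropy_conj.
  rewrite -!mulmxA rot_e3 => -[] /(congr1 (mulmx (rot v))); rewrite mulmxA (proj1 vS) mul1mx => ->.
    by left; rewrite rot_e3.
  by right; rewrite mulmxN rot_e3.
- have [w hw gE] := SO3_fix_e3 gS ge; left; exists w => //; split=> //.
  by apply/rt' => //; rewrite -gE.
- have [w hw gE] := SO3_neg_e3 gS ge; right; exists w => //; split=> //.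
  by apply/rt' => //; rewrite -{2}gt actE gE gactM ft'.
Qed.

End AxialClasses.

(** * Isotropy groups without invariant line: all of SO(3), or finite *)

Section ClosedSubgroups.
Variable R : realType.
Local Notation C := R[i].
Local Notation Re := complex.Re.
Implicit Types (m n d : nat) (g h : 'M[R]_3) (x y p q : 'cV[R]_3) (u v w : C).

Record subgrp (K : 'M[R]_3 -> Prop) : Prop := Subgrp {
  subgrp_SO3 : forall g, K g -> SO3 g;
  subgrp1 : K 1%:M;
  subgrpM : forall g h, K g -> K h -> K (g *m h);
  subgrpV : forall g, K g -> K g^T }.

Definition invline (K : 'M[R]_3 -> Prop) :=
  exists2 p, dotv p p = 1 & forall g, K g -> g *m p = p \/ g *m p = - p.

Definition circle (K : 'M[R]_3 -> Prop) p := forall g, SO3 g -> g *m p = p -> K g.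

Lemma isotropy_subgrp m (t : tensor R m) : subgrp (isotropy t).
Proof.
split; [by move=> g [] | exact: isotropy1 | exact: isotropyM | exact: isotropyV].
Qed.

Lemma dotv_unit_eq x y : dotv x x = 1 -> dotv y y = 1 -> dotv x y = 1 -> x = y.
Proof.
move=> hx hy hxy; apply/eqP; rewrite -subr_eq0; apply/eqP/dotvv_eq0.
by rewrite dotvDl dotvNl ![dotv _ (x - y)]dotvC !dotvDl !dotvNl hx hy hxy dotvC hxy; ring.
Qed.

Lemma dotv_sqr_le1 x y : dotv x x = 1 -> dotv y y = 1 -> dotv x y ^+ 2 <= 1.
Proof.
move=> hx hy; have := dotvv_ge0 (x - dotv x y *: y).
rewrite dotvDl dotvNl ![dotv _ (x - _)]dotvC !dotvDl !dotvNl !dotvZl.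
by rewrite ![dotv _ (_ *: _)]dotvC !dotvZl hx hy [dotv y x]dotvC; nra.
Qed.

Section Circles.
Variable K : 'M[R]_3 -> Prop.
Hypothesis KG : subgrp K.

Lemma circle_mul g p : K g -> circle K p -> circle K (g *m p).
Proof.
move=> Kg Kp h hS hgp; have gS := subgrp_SO3 KG Kg.
rewrite -(SO3_conjK h gS); apply: subgrpM => //; last exact: subgrpV.
apply: subgrpM => //; apply: Kp; first exact: SO3_conj.
by rewrite -!mulmxA hgp SO3_K.
Qed.

Lemma circleN p : circle K p -> circle K (- p).
Proof. by move=> Kp h hS e; apply: Kp => //; apply: oppr_inj; rewrite -mulmxN. Qed.

Lemma circle_orbit p x y : dotv p p = 1 -> dotv x x = 1 -> dotv y y = 1 ->
  dotv x p = dotv y p -> circle K p -> exists2 g, K g & g *m x = y.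
Proof.
move=> hp hx hy xy Kp; have [h hS he] := SO3_frame hp.
have z (a : 'cV[R]_3) : (h^T *m a) i2 0 = dotv a p.
  by rewrite -he dotvC dotv_mul dotvE !mxE /=; ring.
have n (a : 'cV[R]_3) : dotv (h^T *m a) (h^T *m a) = dotv a a.
  by rewrite dotv_SO3 //; exact: SO3_tr.
have hx' := n x; have hy' := n y; rewrite hx hy !dotvE !z in hx' hy'.
have [r [u [r0 hu x0 x1 r2]]] := cunit_polar ((h^T *m x) i0 0) ((h^T *m x) i1 0).
have [s [v [s0 hv y0 y1 s2]]] := cunit_polar ((h^T *m y) i0 0) ((h^T *m y) i1 0).
have rs : r = s.
  by apply/eqP; rewrite -(eqrXn2 (isT : (0 < 2)%N) r0 s0) r2 s2; apply/eqP; rewrite xy in hx'; lra.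
exists (h *m rot (v * conjc u) *m h^T).
  apply: Kp.
    by do 2?apply: SO3_mul => //; [exact/rot_SO3/cunitM/cunitJ | exact: SO3_tr].
  by rewrite -he -!mulmxA SO3_K // rot_e3.
have yE : y = h *m (h^T *m y) by rewrite mulmxA (proj1 hS) mul1mx.
rewrite yE -!mulmxA; congr (_ *m _).
have hu' := hu; rewrite /cunit in hu'.
apply: vec3P; rewrite mulmx3 !z ?x0 ?x1 ?y0 ?y1 ?z -?rs !mxE ?xy /=; last by ring.
  by case: (u) (v) hu' => [a b] [c e] /= hu'; transitivity (r * c * (a ^+ 2 + b ^+ 2)); [ring | rewrite hu' mulr1].
by case: (u) (v) hu' => [a b] [c e] /= hu'; transitivity (r * e * (a ^+ 2 + b ^+ 2)); [ring | rewrite hu' mulr1].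
Qed.

(** Turning [p] about [q] by an angle of cosine a gives the scalar product c^2 + (1 - c^2) a with
    [p], where c = p.q. It sweeps the interval from 2 c^2 - 1 to 1, and a is obtained by solving for
    s. *)
Lemma circle_step p q s : dotv p p = 1 -> dotv q q = 1 -> circle K q ->
  dotv p q ^+ 2 < 1 -> 2 * dotv p q ^+ 2 - 1 <= s -> s <= 1 ->
  exists2 g, K g & dotv p (g *m p) = s.
Proof.
move=> hp hq Kq c1 s1 s2; have [h hS he] := SO3_frame hq.
have z : (h^T *m p) i2 0 = dotv p q.
  by rewrite -he dotvC dotv_mul dotvE !mxE /=; ring.
have hp' : dotv (h^T *m p) (h^T *m p) = 1 by rewrite dotv_SO3 //; exact: SO3_tr.
set c := dotv p q in c1 s1 z *.
pose a := (s - c ^+ 2) / (1 - c ^+ 2).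
have c0 : 1 - c ^+ 2 != 0 by lra.
have aE : (1 - c ^+ 2) * a = s - c ^+ 2 by rewrite /a mulrCA divff ?mulr1.
have a2 : a ^+ 2 <= 1.
  have : (s - c ^+ 2) ^+ 2 <= (1 - c ^+ 2) ^+ 2 by nra.
  rewrite -aE exprMn -{2}[(1 - _) ^+ 2]mulr1 ler_pM2l // exprn_gt0 //; lra.
pose v : C := (a +i* Num.sqrt (1 - a ^+ 2))%C.
have hv : cunit v by rewrite /cunit /= sqr_sqrtr; lra.
exists (h *m rot v *m h^T).
  apply: Kq.
    by do 2?apply: SO3_mul => //; [exact: rot_SO3 | exact: SO3_tr].
  by rewrite -he -!mulmxA SO3_K // rot_e3.
rewrite -!mulmxA dotvC dotv_mul dotvC.
move: hp' z; move: (h^T *m p) => y hp' z.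
move: hp'; rewrite !dotvE !mulmx3 !mxE /= z.
move: (y i0 0) (y i1 0) => X Y hX.
have XY : X ^+ 2 + Y ^+ 2 = 1 - c ^+ 2 by rewrite -hX; ring.
transitivity ((X ^+ 2 + Y ^+ 2) * a + c ^+ 2); first by ring.
by rewrite XY aE; ring.
Qed.

(** The angle between two axes carrying circles is doubled until a right angle comes within reach.
    With c its cosine, doubling replaces 1 - c by 2 (1 - c) (1 + c), at least twice as much while c
    >= 0; N bounds the number of doublings. *)
Lemma circle_orth N p q : dotv p p = 1 -> dotv q q = 1 -> circle K p -> circle K q ->
  0 <= dotv p q -> dotv p q < 1 -> 1 <= (1 - dotv p q) * 2 ^+ N ->
  exists2 q', circle K q' & dotv q' q' = 1 /\ dotv p q' = 0.
Proof.
elim: N q => [|N IH] q hp hq Kp Kq c0 c1 cN.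
  by exists q => //; split=> //; move: cN; rewrite expr0; lra.
have c2 : dotv p q ^+ 2 < 1 by nra.
have [le|lt] := lerP (2 * dotv p q ^+ 2 - 1) 0.
  have [g Kg e] := circle_step hp hq Kq c2 le ler01.
  exists (g *m p); first exact: circle_mul.
  by rewrite e dotv_SO3 //; exact: subgrp_SO3 Kg.
have [||g Kg e] := @circle_step p q (2 * dotv p q ^+ 2 - 1) hp hq Kq c2; [lra|nra|].
apply: (IH (g *m p)) => //.
- by rewrite dotv_SO3 //; exact: subgrp_SO3 Kg.
- exact: circle_mul.
- by rewrite e ltW.
- by rewrite e; nra.
apply: le_trans cN _; rewrite e exprS mulrA ler_wpM2r ?exprn_ge0 //; nra.
Qed.

(** Some element moves the line of [p], which gives a second axis and by [circle_orth] one
    orthogonal to [p]. Turning about that axis reaches every parallel around [p], and turning about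
    [p] every point of it; so K is transitive on the sphere and contains the stabiliser of [p]. *)
Lemma circle_full p : dotv p p = 1 -> circle K p -> ~ invline K ->
  forall g, SO3 g -> K g.
Proof.
move=> hp Kp nl.
have [g Kg [n1 n2]] : exists2 g, K g & g *m p <> p /\ g *m p <> - p.
  apply: contrapT => H; apply: nl; exists p => // g Kg.
  have [->|/eqP e1] := eqVneq (g *m p) p; first by left.
  have [->|/eqP e2] := eqVneq (g *m p) (- p); first by right.
  by case: H; exists g.
have gS := subgrp_SO3 KG Kg.
have [q [hq Kq c0 c1]] : exists q, [/\ dotv q q = 1, circle K q, 0 <= dotv p q & dotv p q < 1].
  have hq : dotv (g *m p) (g *m p) = 1 by rewrite dotv_SO3.
  have := dotv_sqr_le1 hp hq; set c := dotv p (g *m p) => c2.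
  have cn1 : c != 1 by apply/eqP => e; apply: n1; rewrite -(dotv_unit_eq hp hq e).
  have cn2 : c != -1.
    apply/eqP => e; apply: n2; apply: oppr_inj; rewrite opprK; apply/esym/dotv_unit_eq => //.
      by rewrite dotvNl dotvNr opprK.
    by rewrite dotvNr -/c e opprK.
  have [le|lt] := lerP 0 c.
    exists (g *m p); split=> //; first exact: circle_mul.
    by rewrite -/c lt_neqAle cn1 /=; nra.
  exists (- (g *m p)); rewrite dotvNl !dotvNr opprK -/c; split=> //.
  - exact/circleN/circle_mul.
  - lra.
  by rewrite ltrNl lt_neqAle eq_sym cn2 /=; nra.
have [N hN] : exists N, 1 <= (1 - dotv p q) * 2 ^+ N.
  have d0 : 0 < 1 - dotv p q by lra.
  exists (Num.truncn (1 - dotv p q)^-1).+1.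
  rewrite mulrC -ler_pdivrMr // div1r; apply: le_trans (ltW (truncnS_gt _)) _.
  by rewrite -natrX ler_nat; apply: ltnW; exact: ltn_expl.
have [q' Kq' [hq' pq']] := circle_orth hp hq Kp Kq c0 c1 hN.
have orb y : dotv y y = 1 -> exists2 k, K k & k *m p = y.
  move=> hy; have c2 := dotv_sqr_le1 hp hy.
  have [|||k Kk ek] := @circle_step p q' (dotv p y) hp hq' Kq'; rewrite ?pq' ?expr0n /=; [exact: ltr01|nra|nra|].
  have kS := subgrp_SO3 KG Kk.
  have [||k' Kk' ek'] := @circle_orbit p (k *m p) y hp _ hy _ Kp.
  - by rewrite dotv_SO3.
  - by rewrite dotvC ek dotvC.
  by exists (k' *m k); [exact: subgrpM | rewrite -mulmxA].
move=> h hS; have [|k Kk kp] := orb (h *m p); first by rewrite dotv_SO3.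
have kS := subgrp_SO3 KG Kk.
rewrite -(SO3_KV h kS); apply: subgrpM => //; apply: Kp.
  by apply: SO3_mul => //; exact: SO3_tr.
by rewrite -mulmxA -kp SO3_K.
Qed.

End Circles.

(** The powers of u over one period sum to 0, so k is the sum of the 1 - u^j, each of modulus at
    most j |1 - u| <= m |1 - u|. Hence |1 - u| >= 1/m, and 2 - 2 Re u is its square. *)
Lemma root1_dist u k m : cunit u -> u != 1 -> (0 < k <= m)%N -> u ^+ k = 1 ->
  1 <= m%:R ^+ 2 * (2 - 2 * Re u).
Proof.
move=> hu u1 /andP[k0 km] uk.
have N2 : normc (1 - u) ^+ 2 = 2 - 2 * Re u.
  by rewrite normc2; case: (u) hu => a b; rewrite /cunit /=; nra.
have N0 := normc_ge0 (1 - u).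
have nD (z z' : C) : normc (z + z') <= normc z + normc z' by exact: le_normcD.
have nX j : normc (1 - u ^+ j) <= j%:R * normc (1 - u).
  elim: j => [|j IH]; first by rewrite expr0 subrr mul0r normc0.
  have -> : 1 - u ^+ j.+1 = (1 - u) + u * (1 - u ^+ j) by rewrite exprS; ring.
  apply: le_trans (nD _ _) _.
  by rewrite normcM (proj1 (cunit_normc u) hu) mul1r -natr1; lra.
have s0 : \sum_(j < k) u ^+ j = 0.
  have := subrX1 u k; rewrite uk subrr => /esym /eqP.
  by rewrite mulf_eq0 subr_eq0 (negbTE u1) => /eqP.
have kE : \sum_(j < k) (1 - u ^+ j) = k%:R.
  by rewrite sumrB s0 subr0 sumr_const card_ord.
have kn : normc (k%:R : C) = k%:R.
  elim: (k) => [|l IH]; first by rewrite normc0.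
  have -> : (l.+1%:R : C) = ((l.+1%:R)%:C)%C by rewrite rmorph_nat.
  by rewrite /= expr0n addr0 sqrtr_sqr ger0_norm.
have le1 : (k%:R : R) <= k%:R * (m%:R * normc (1 - u)).
  rewrite -{1}kn -kE mulr_natl -[X in _ *+ X]card_ord -sumr_const.
  elim/big_rec2: _ => [|i y1 y2 _ h]; first by rewrite normc0.
  apply: le_trans (nD _ _) _; apply: lerD => //.
  apply: le_trans (nX _) _; rewrite ler_wpM2r // ler_nat.
  exact: leq_trans (ltnW (ltn_ord i)) km.
have k0' : 0 < (k%:R : R) by rewrite ltr0n.
rewrite -N2 -exprMn; rewrite -{1}(mulr1 k%:R) ler_pM2l // in le1.
by rewrite -[X in X <= _](expr1n _ 2) lerXn2r // nnegrE ?mulr_ge0.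
Qed.

(** A rotation in the group fixes the weights about its own axis. A nonzero weight makes its order
    at most m, so [root1_dist] applies; if all weights vanish, the whole circle about this axis is
    in the group. The trace measures the angle. *)
Lemma isotropy_dist m (t : tensor R m) : ~ (exists2 p, dotv p p = 1 & circle (isotropy t) p) ->
  forall g, isotropy t g -> g != 1%:M -> 1 <= m%:R ^+ 2 * (3 - \tr g).
Proof.
move=> nc g [gS gt] g1; have [p hp gp] := SO3_axis gS.
have [h [u [hS hu he gE]]] := SO3_conj_rot gS hp gp.
have u1 : u != 1 by apply: contra_neq g1 => u1; rewrite gE u1 rot1 mulmx1 (proj1 hS).
have tr : 3 - \tr g = 2 - 2 * Re u.
  rewrite gE mxtrace_mulC mulmxA SO3_trK // mul1mx /mxtrace sum3 !mxE /=; ring.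
pose t' := gact h^T t.
have ft : gact (rot u) t' = t'.
  have -> : rot u = h^T *m g *m h by rewrite gE SO3_conjKV.
  by rewrite /t' -gactM -!mulmxA (proj1 hS) mulmx1 gactM -{2}gt.
have [k km uk] : exists2 k, (0 < k <= m)%N & u ^+ k = 1.
  apply: contrapT => H; apply: nc; exists p => // k kS kp.
  have [||w hw kE] := @SO3_fix_e3 _ (h^T *m k *m h).
  - exact: SO3_conj.
  - by rewrite -!mulmxA he kp -he SO3_K.
  have kE' : k = h *m rot w *m h^T by rewrite -kE SO3_conjK.
  split=> //; rewrite actE kE' -mulmxA gactM gactM -/t'.
  have -> : gact (rot w) t' = t'.
    apply/rot_fix_tens => // J n0.
    have := proj1 (rot_fix_tens t' hu) ft J n0 => /exprz_absz uw.
    have [e|e] := eqVneq (wt J) 0; first by rewrite e.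
    by case: H; exists `|wt J|%N => //; rewrite absz_gt0 e wt_le.
  by rewrite /t' -gactM (proj1 hS) gact1.
by rewrite tr; exact: root1_dist km uk.
Qed.

(** Pigeonhole on a grid of mesh 1/N: two matrices with the same code differ by at most 1/N in each
    of nine entries, and 9/N^2 <= 9/N < d. *)
Lemma finite_separated (K : 'M[R]_3 -> Prop) (d : R) : 0 < d ->
  (forall g, K g -> forall i j, `|g i j| <= 1) ->
  (forall g h, K g -> K h -> g != h -> d <= \sum_i \sum_j (g i j - h i j) ^+ 2) ->
  exists s : seq 'M[R]_3, forall g, K g <-> g \in s.
Proof.
move=> d0 K1 Kd.
pose N := (Num.truncn (9 / d)).+1.
have Nd : 9 / d < N%:R by exact: truncnS_gt.
have N0 : 0 < (N%:R : R) by rewrite ltr0n.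
pose code g : {ffun 'I_3 * 'I_3 -> 'I_(2 * N).+1} :=
  [ffun ij => inord (Num.truncn ((g ij.1 ij.2 + 1) * N%:R))].
have codeP g h : K g -> K h -> code g = code h -> g = h.
  move=> Kg Kh /ffunP e; apply/eqP; apply: contraT => ne.
  have := Kd g h Kg Kh ne; rewrite leNgt => /negP[].
  have close i j : (g i j - h i j) ^+ 2 <= (N%:R^-1) ^+ 2.
    have bd k : K k -> [/\ 0 <= (k i j + 1) * N%:R & (Num.truncn ((k i j + 1) * N%:R) <= 2 * N)%N].
      move=> Kk; have := K1 k Kk i j; rewrite ler_norml => /andP[k1 k2].
      have a0 : 0 <= (k i j + 1) * N%:R by rewrite mulr_ge0 ?ler0n //; lra.
      have /andP[t1 _] := truncn_itv a0.
      split=> //; rewrite -(ler_nat R); apply: le_trans t1 _.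
      by rewrite natrM ler_wpM2r //; lra.
    have [g0 gN] := bd _ Kg; have [h0 hN] := bd _ Kh.
    have := congr1 val (e (i, j)); rewrite !ffunE /= !inordK ?ltnS // => E.
    have := truncn_itv g0; have := truncn_itv h0; rewrite E.
    move=> /andP[a1 a2] /andP[b1 b2].
    have ab : `|(g i j - h i j) * N%:R| <= 1.
      by rewrite ler_norml; move: a1 a2 b1 b2; rewrite -natr1; nra.
    have -> : g i j - h i j = ((g i j - h i j) * N%:R) / N%:R by rewrite mulfK ?gt_eqF.
    rewrite exprMn ler_piMl ?sqr_ge0 // -real_normK ?num_real //.
    by rewrite expr_le1 ?normr_ge0.
  have le9 : \sum_i \sum_j (g i j - h i j) ^+ 2 <= 9 * (N%:R^-1) ^+ 2.
    have c i j := close i j; rewrite !sum3.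
    have := c i0 i0; have := c i0 i1; have := c i0 i2.
    have := c i1 i0; have := c i1 i1; have := c i1 i2.
    have := c i2 i0; have := c i2 i1; have := c i2 i2; lra.
  apply: le_lt_trans le9 _.
  have N1 : 1 <= (N%:R : R) by rewrite ler1n.
  have : 9 < d * N%:R by rewrite mulrC -ltr_pdivrMr.
  move=> h9; rewrite exprVn ltr_pdivrMr ?exprn_gt0 //; nra.
pose pick c := if pselect (exists2 g, K g & code g = c) is left e then Some (projT1 (cid2 e)) else None.
exists (pmap pick (enum {: {ffun 'I_3 * 'I_3 -> 'I_(2 * N).+1}})) => g.
rewrite mem_pmap; split=> [Kg|/mapP[c _]].
  apply/mapP; exists (code g); first by rewrite mem_enum.
  rewrite /pick; case: pselect => [e|[]]; last by exists g.
  by case: (cid2 e) => k Kk /= kc; congr Some; exact: codeP.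
by rewrite /pick; case: pselect => // e [->]; case: (cid2 e).
Qed.

Lemma isotropy_finite m (t : tensor R m) :
  ~ (exists2 p, dotv p p = 1 & circle (isotropy t) p) ->
  exists s : seq 'M[R]_3, forall g, isotropy t g <-> g \in s.
Proof.
move=> nc; have dist := isotropy_dist nc.
(* The squared distance of g and h is 2 (3 - tr (g^T h)), at least 2/m^2 by [isotropy_dist]; m^2 + 1
   keeps the denominator positive. *)
apply: (@finite_separated _ (2 / (m%:R ^+ 2 + 1))).
- by rewrite divr_gt0 ?ltr0n //; have := sqr_ge0 (m%:R : R); lra.
- move=> g [[go _] _] i j; have := congr1 (fun M : 'M[R]_3 => M i i) go.
  rewrite mxE sum3 !mxE eqxx => e.
  have : g i j ^+ 2 <= 1.
    by rewrite -[X in _ <= X]/(true%:R) -e; move: j; apply: forall3; nra.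
  by rewrite -real_normK ?num_real // expr_le1 ?normr_ge0.
move=> g h gK hK ne; have [gS _] := gK; have [hS _] := hK.
have ghK : isotropy t (g^T *m h) by apply: isotropyM => //; exact: isotropyV.
have n1 : g^T *m h != 1%:M.
  by apply: contra_neq ne => e; rewrite -[g]mulmx1 -e mulmxA (proj1 gS) mul1mx.
have := dist _ ghK n1.
have -> : \sum_i \sum_j (g i j - h i j) ^+ 2 = 2 * (3 - \tr (g^T *m h)).
  have tg (k : 'M[R]_3) : SO3 k -> \tr (k^T *m k) = 3.
    by move=> kS; rewrite SO3_trK // mxtrace1.
  have := tg _ gS; have := tg _ hS.
  rewrite /mxtrace !sum3 !mulmx33 !mxE => e1 e2.
  by lra.
move: (3 - _) => X h1; have := sqr_ge0 (m%:R : R) => h2.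
rewrite ler_pdivrMr; last by lra.
by nra.
Qed.

End ClosedSubgroups.

(** * Counting orbits of poles *)

Section Burnside.

(** With N the group order, a, b, c the orbit sizes and r, s, t the stabiliser orders, this is 1/r +
    1/s + 1/t = 1 + 2/N. Orbit sizes at least 3 discard the dihedral solutions. *)
Lemma arith3_sorted (a b c r s t N : nat) : (3 <= a)%N -> (3 <= b)%N -> (3 <= c)%N ->
  (2 <= r)%N -> (r <= s)%N -> (s <= t)%N -> (a * r = N)%N -> (b * s = N)%N -> (c * t = N)%N ->
  (a + b + c = N + 2)%N ->
  [\/ [/\ N = 12, r = 2, s = 3 & t = 3], [/\ N = 24, r = 2, s = 3 & t = 4] |
      [/\ N = 60, r = 2, s = 3 & t = 5]]%N.
Proof.
move=> a3 b3 c3 r2 rs st ar bs ct e.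
have r2' : r = 2%N.
  apply/eqP; rewrite eqn_leq r2 andbT -ltnS ltnNge; apply/negP => r3.
  have : (a * 3 <= N)%N by rewrite -ar leq_mul2l r3 orbT.
  have : (b * 3 <= N)%N by rewrite -bs leq_mul2l (leq_trans r3 rs) orbT.
  have : (c * 3 <= N)%N by rewrite -ct leq_mul2l (leq_trans r3 (leq_trans rs st)) orbT.
  by lia.
subst r.
have s3 : s = 3%N.
  have [s4|s4] := leqP 4 s.
    have : (b * 4 <= N)%N by rewrite -bs leq_mul2l s4 orbT.
    have : (c * 4 <= N)%N by rewrite -ct leq_mul2l (leq_trans s4 st) orbT.
    by lia.
  have s2 : s <> 2%N by move=> E; rewrite E in bs; lia.
  by lia.
subst s.
have t6 : (t < 6)%N.
  rewrite ltnNge; apply/negP => t6.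
  have : (c * 6 <= N)%N by rewrite -ct leq_mul2l t6 orbT.
  by lia.
have [E|[E|E]] : t = 3%N \/ t = 4%N \/ t = 5%N by lia.
- by rewrite E in ct *; constructor 1; split=> //; lia.
- by rewrite E in ct *; constructor 2; split=> //; lia.
- by rewrite E in ct *; constructor 3; split=> //; lia.
Qed.

(** Singles out an orbit of poles whose stabiliser order r is shared by no other orbit; for N = 12
    this leaves r = 2, as 3 occurs twice. The orbit has 6, 6 or 12 points: the vertices of an
    octahedron or of an icosahedron. *)
Definition polar_type (N r : nat) : Prop :=
  [\/ N = 12 /\ r = 2, N = 24 /\ r = 4 | N = 60 /\ r = 5]%N.

Lemma arith3 (a b c r s t N : nat) : (3 <= a)%N -> (3 <= b)%N -> (3 <= c)%N ->
  (2 <= r)%N -> (2 <= s)%N -> (2 <= t)%N -> (a * r = N)%N -> (b * s = N)%N -> (c * t = N)%N ->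
  (a + b + c = N + 2)%N ->
  [\/ [/\ polar_type N r, s <> r & t <> r], [/\ polar_type N s, r <> s & t <> s] |
      [/\ polar_type N t, r <> t & s <> t]].
Proof.
move=> a3 b3 c3 r2 s2 t2 ar bs ct e.
have p1 : polar_type 12 2 by constructor 1.
have p2 : polar_type 24 4 by constructor 2.
have p3 : polar_type 60 5 by constructor 3.
have [rs|/ltnW rs] := leqP r s; have [st|/ltnW st] := leqP s t; have [rt|/ltnW rt] := leqP r t.
- by case: (arith3_sorted a3 b3 c3 r2 rs st ar bs ct e) => -[-> -> -> ->];
    [constructor 1|constructor 3|constructor 3]; split.
- by case: (arith3_sorted a3 b3 c3 r2 rs st ar bs ct e) => -[-> -> -> ->];
    [constructor 1|constructor 3|constructor 3]; split.
- rewrite addnAC in e.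
  by case: (arith3_sorted a3 c3 b3 r2 rt st ar ct bs e) => -[-> -> -> ->];
    [constructor 1|constructor 2|constructor 2]; split.
- rewrite addnAC addnC addnA addnAC in e.
  have e' : (c + a + b = N + 2)%N by lia.
  by case: (arith3_sorted c3 a3 b3 t2 rt rs ct ar bs e') => -[-> -> -> ->];
    [constructor 3|constructor 2|constructor 2]; split.
- have e' : (b + a + c = N + 2)%N by lia.
  by case: (arith3_sorted b3 a3 c3 s2 rs rt bs ar ct e') => -[-> -> -> ->];
    [constructor 2|constructor 3|constructor 3]; split.
- have e' : (b + c + a = N + 2)%N by lia.
  by case: (arith3_sorted b3 c3 a3 s2 st rt bs ct ar e') => -[-> -> -> ->];
    [constructor 2|constructor 1|constructor 1]; split.
- have e' : (c + b + a = N + 2)%N by lia.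
  by case: (arith3_sorted c3 b3 a3 t2 st rs ct bs ar e') => -[-> -> -> ->];
    [constructor 3|constructor 1|constructor 1]; split.
- have e' : (c + b + a = N + 2)%N by lia.
  by case: (arith3_sorted c3 b3 a3 t2 st rs ct bs ar e') => -[-> -> -> ->];
    [constructor 3|constructor 1|constructor 1]; split.
Qed.

(** Orbit counting gives |rT| + 2 (N - 1) = |O| N. Stabilisers of order at least 2 bound |O| by 3,
    and orbits of size at least 3 exclude |O| < 3. The uniqueness clause is what later identifies
    the orbit of the opposite pole. *)
Lemma burnside_count (gT : finGroupType) (rT : finType) (to : {action gT &-> rT}) :
  (1 < #|gT|)%N ->
  (forall a : gT, a != 1%g -> #|'Fix_to[a]%g| = 2%N) ->
  (forall x, (3 <= #|orbit to setT x|)%N) -> (forall x, (2 <= #|'C[x | to]%g|)%N) ->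
  exists x, polar_type #|gT| #|'C[x | to]%g| /\
    forall y, #|'C[y | to]%g| = #|'C[x | to]%g| -> y \in orbit to setT x.
Proof.
move=> N1 fix2 orb3 stab2; set N := #|gT| in N1 *.
have os x : (#|orbit to setT x| * #|'C[x | to]%g| = N)%N.
  by rewrite -[N](cardsT gT) -(card_orbit_stab to setT x) setTI.
have aT : [acts [set: gT], on [set: rT] | to]%g by apply/actsP => a _ x; rewrite !inE.
have F := Frobenius_Cauchy aT; have S := acts_sum_card_orbit aT.
set O := orbit to _ @: _ in F S.
have F' : (#|rT| + 2 * (N - 1) = #|O| * N)%N.
  rewrite cardsT in F; rewrite -F (bigD1 1%g) ?inE //=; congr (_ + _)%N.
    by rewrite -cardsT; apply: eq_card => x; rewrite !inE sub1set inE act1 eqxx.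
  rewrite (eq_bigr (fun _ => 2%N)) => [|a]; last by rewrite inE setTI; exact: fix2.
  rewrite sum_nat_const mulnC subn1 -(cardC1 (1%g : gT)); congr (_ * _)%N.
  by apply: eq_card => a; rewrite !inE [RHS]unfold_in inE.
rewrite cardsT in S.
have OP T : T \in O -> exists x, T = orbit to setT x by case/imsetP => x _ ->; exists x.
have O2 T : T \in O -> (2 * #|T| <= N)%N /\ (3 <= #|T|)%N.
  case/OP=> x ->; split=> //; rewrite -(os x) mulnC leq_mul2l stab2 orbT //.
have le : (2 * #|rT| <= #|O| * N)%N.
  by rewrite -S big_distrr /= -sum_nat_const leq_sum // => T /O2[].
have O3 : (#|O| <= 3)%N.
  rewrite leqNgt; apply/negP => h.
  have : (4 * N <= #|O| * N)%N by rewrite leq_mul2r h orbT.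
  by lia.
have sE : (\sum_(T <- enum O) #|T| = #|rT|)%N by rewrite big_enum.
have eO T : T \in enum O -> T \in O by rewrite mem_enum.
have zO : size (enum O) = #|O| by rewrite -cardE.
have uO := enum_uniq (mem O).
have mO T : T \in O -> T \in enum O by rewrite mem_enum.
move: zO O3 F' sE eO uO mO; case: (enum O) => [|T1 [|T2 [|T3 [|T4 l]]]] /= <- O3 F'; rewrite ?big_cons ?big_nil => sE eO uO mO; try by lia.
- by have := O2 _ (eO T1 _); rewrite inE eqxx => /(_ isT); lia.
- have := O2 _ (eO T1 _); rewrite inE eqxx => /(_ isT).
  by have := O2 _ (eO T2 _); rewrite !inE eqxx orbT => /(_ isT); lia.
have [x1 E1] := OP T1 (eO T1 ltac:(by rewrite inE eqxx)).
have [x2 E2] := OP T2 (eO T2 ltac:(by rewrite !inE eqxx orbT)).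
have [x3 E3] := OP T3 (eO T3 ltac:(by rewrite !inE eqxx !orbT)).
have stE y z : y \in orbit to setT z -> #|'C[y | to]%g| = #|'C[z | to]%g|.
  move=> yz; have := os y; rewrite -(os z) (orbit_eqP yz) => /eqP.
  by rewrite eqn_pmul2l => [/eqP //|]; exact: leq_trans (orb3 z).
have fin y : [\/ y \in orbit to setT x1, y \in orbit to setT x2 | y \in orbit to setT x3].
  have : orbit to setT y \in O by apply/imsetP; exists y.
  move/mO; rewrite !inE E1 E2 E3 => /or3P[]/eqP <-; rewrite orbit_refl.
  - by constructor 1.
  - by constructor 2.
  - by constructor 3.
have e : (#|T1| + #|T2| + #|T3| = N + 2)%N by lia.
rewrite E1 E2 E3 in e.
case: (arith3 (orb3 x1) (orb3 x2) (orb3 x3) (stab2 x1) (stab2 x2) (stab2 x3) (os x1) (os x2) (os x3) e).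
- move=> [pt n2 n3]; exists x1; split=> // y ey; case: (fin y) => // /stE; rewrite ey => /esym.
    by move/n2.
  by move/n3.
- move=> [pt n2 n3]; exists x2; split=> // y ey; case: (fin y) => // /stE; rewrite ey => /esym.
    by move/n2.
  by move/n3.
- move=> [pt n2 n3]; exists x3; split=> // y ey; case: (fin y) => // /stE; rewrite ey => /esym.
    by move/n2.
  by move/n3.
Qed.

End Burnside.

(** * Finite rotation groups acting on their poles *)

Record finsub (R : realType) := Finsub {
  fs_seq : seq 'M[R]_3;
  fs_subgrp : subgrp (fun g => g \in fs_seq) }.

Definition fsT (R : realType) (H : finsub R) : predArgType := seq_sub (fs_seq H).
HB.instance Definition _ (R : realType) (H : finsub R) := SubFinite.on (fsT H).

Section FinsubGroup.
Variables (R : realType) (H : finsub R).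
Implicit Types a b : fsT H.

Definition fs_one : fsT H := SeqSub (subgrp1 (fs_subgrp H)).
Definition fs_mul a b : fsT H :=
  SeqSub (subgrpM (fs_subgrp H) (ssvalP a) (ssvalP b)).
Definition fs_inv a : fsT H := SeqSub (subgrpV (fs_subgrp H) (ssvalP a)).

Lemma fs_mulA : associative fs_mul.
Proof. by move=> a b c; apply: val_inj; exact: mulmxA. Qed.
Lemma fs_mul1 : left_id fs_one fs_mul.
Proof. by move=> a; apply: val_inj; exact: mul1mx. Qed.
Lemma fs_mulV : left_inverse fs_one fs_inv fs_mul.
Proof. by move=> a; apply: val_inj; apply: SO3_trK; apply: subgrp_SO3 (ssvalP a); exact: fs_subgrp. Qed.
End FinsubGroup.

HB.instance Definition _ (R : realType) (H : finsub R) :=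
  Finite_isGroup.Build (fsT H) (@fs_mulA R H) (@fs_mul1 R H) (@fs_mulV R H).

Section Poles.
Variables (R : realType) (H : finsub R).
Implicit Types (a b : fsT H) (p q x y : 'cV[R]_3) (g h : 'M[R]_3).

Definition fsv (a : fsT H) : 'M[R]_3 := ssval a.

Lemma fsv_inj : injective fsv.
Proof. exact: val_inj. Qed.

Lemma fs_SO3 a : SO3 (fsv a).
Proof. by apply: subgrp_SO3 (ssvalP a); exact: fs_subgrp. Qed.

Definition axis (g : 'M[R]_3) : 'cV[R]_3 :=
  if pselect (exists2 p, dotv p p = 1 & g *m p = p) is left e then projT1 (cid2 e) else 0.

Lemma axisP g : SO3 g -> dotv (axis g) (axis g) = 1 /\ g *m axis g = axis g.
Proof.
move=> gS; rewrite /axis; case: pselect => [e|[]]; last exact: SO3_axis.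
by case: (cid2 e).
Qed.

Definition pole p := dotv p p = 1 /\ exists2 a : fsT H, a != 1%g & fsv a *m p = p.

Definition poles : seq 'cV[R]_3 :=
  flatten [seq [:: axis (fsv a); - axis (fsv a)] | a <- enum (fsT H) & a != 1%g].

Lemma fsv1 : fsv 1%g = 1%:M. Proof. by []. Qed.

Lemma val_neq1 a : a != 1%g -> fsv a != 1%:M.
Proof. by apply: contra_neq => e; apply: fsv_inj. Qed.

Lemma mem_poles p : (p \in poles) <-> pole p.
Proof.
split=> [/flatten_mapP[a]|[hp [a a1 ap]]].
  rewrite mem_filter => /andP[a1 _]; have [h1 h2] := axisP (fs_SO3 a).
  rewrite !inE => /orP[]/eqP ->; split; rewrite ?dotvNl ?dotvNr ?opprK //; exists a => //.
  by rewrite mulmxN h2.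
have [h1 h2] := axisP (fs_SO3 a).
apply/flatten_mapP; exists a; first by rewrite mem_filter a1 mem_enum.
by have [->|->] := SO3_fix_unit (fs_SO3 a) (val_neq1 a1) h1 hp h2 ap; rewrite !inE eqxx ?orbT.
Qed.

Lemma pole_act p a : pole p -> pole ((fsv a)^T *m p).
Proof.
have aS := fs_SO3 a.
case=> hp [b b1 bp]; split; first by rewrite dotv_SO3 //; exact: SO3_tr.
exists (a^-1 * b * a)%g.
  apply: contra_neq b1 => e; apply: (@mulIg _ a); rewrite mul1g.
  by apply: (@mulgI _ a^-1%g); rewrite mulgA e mulVg.
rewrite [fsv _]/(((fsv a)^T *m fsv b) *m fsv a) -!mulmxA (mulmxA (fsv a)).
by rewrite (proj1 aS) mul1mx bp.
Qed.

Lemma poleN p : pole p -> pole (- p).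
Proof.
case=> hp [b b1 bp]; split; first by rewrite dotvNl dotvNr opprK.
by exists b => //; rewrite mulmxN bp.
Qed.

Local Notation polT := (seq_sub poles).

(** Transposes, that is inverses, appear because [{action ...}] is a right action while matrices act
    on the left. *)
Definition pol_act (p : polT) (a : fsT H) : polT :=
  SeqSub (proj2 (mem_poles _) (pole_act a (proj1 (mem_poles _) (ssvalP p)))).

Lemma pol_act1 : pol_act^~ 1%g =1 id.
Proof. by move=> p; apply: val_inj; change ((fsv 1%g)^T *m val p = val p); rewrite fsv1 trmx1 mul1mx. Qed.

Lemma pol_actM (p : polT) : act_morph pol_act p.
Proof.
move=> a b; apply: val_inj.
change ((fsv a *m fsv b)^T *m val p = (fsv b)^T *m ((fsv a)^T *m val p)).
by rewrite trmx_mul mulmxA.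
Qed.

Definition pol_action := TotalAction pol_act1 pol_actM.

Lemma pol_stab (p : polT) a : pol_action p a = p <-> fsv a *m val p = val p.
Proof.
have aS := fs_SO3 a; split=> [/(congr1 val) /= e|e].
  by rewrite -{1}[val p]e /= mulmxA (proj1 aS) mul1mx.
by apply: val_inj; rewrite /= -{1}e mulmxA SO3_trK // mul1mx.
Qed.

Hypothesis noline : ~ invline (fun g => g \in fs_seq H).

(** If all images of p were among p and q, the group would fix p + q; when this vector is 0, it
    preserves the line of p instead. *)
Lemma orbit_ge3 p : dotv p p = 1 -> forall q,
  ~ (forall g, g \in fs_seq H -> g *m p = p \/ g *m p = q).
Proof.
move=> hp q hq.
have [al|] := pselect (forall g, g \in fs_seq H -> g *m p = p).
  by apply: noline; exists p => // g /al; left.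
move=> /existsNP[g0 /not_implyP[g0H g0p]].
have g0q : g0 *m p = q by case: (hq g0 g0H).
have qp : q <> p by rewrite -g0q.
have KG := fs_subgrp H.
have inj g x y : g \in fs_seq H -> g *m x = g *m y -> x = y.
  by move=> gH; apply: SO3_mulI; exact: subgrp_SO3 KG _ gH.
have sum g : g \in fs_seq H -> g *m (p + q) = p + q.
  move=> gH; have gq : g *m q = p \/ g *m q = q.
    by rewrite -g0q mulmxA g0q; apply: hq; exact: (subgrpM KG gH g0H).
  rewrite mulmxDr; case: (hq g gH) => gp; case: gq => gq; rewrite gp gq // 1?addrC //.
    by case: qp; apply: (inj g _ _ gH); rewrite gp gq.
  by case: qp; apply: (inj g _ _ gH); rewrite gp gq.
have [e|n0] := eqVneq (p + q) 0.
  apply: noline; exists p => // g gH; case: (hq g gH) => ->; [by left | right].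
  by apply/eqP; rewrite -addr_eq0 addrC e.
have [c [c0 hc]] := unit_scale n0.
by apply: noline; exists (c *: (p + q)) => // g gH; left; rewrite -scalemxAr sum.
Qed.

(** Each nontrivial rotation fixes exactly two poles, so [burnside_count] applies. The pole -p has
    the same stabiliser as p, hence lies in the orbit of p by uniqueness of its stabiliser order. *)
Lemma finsub_pole : uniq (fs_seq H) -> exists p r, [/\ dotv p p = 1,
  count (fun g => g *m p == p) (fs_seq H) = r,
  polar_type (size (fs_seq H)) r & exists2 g, g \in fs_seq H & g *m p = - p].
Proof.
move=> us; have KG := fs_subgrp H.
have cT : #|fsT H| = size (fs_seq H) by rewrite card_seq_sub.
have cst (p : polT) : #|'C[p | pol_action]%g| = count (fun g => g *m val p == val p) (fs_seq H).
  have -> : #|'C[p | pol_action]%g| = #|[pred a : fsT H | fsv a *m val p == val p]|.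
    by apply: eq_card => a; apply/astab1P/eqP => /pol_stab.
  suff /seq.permP <- : perm_eq [seq fsv i | i <- enum (fsT H)] (fs_seq H).
    by rewrite count_map cardE enumT /enum_mem size_filter; apply: eq_count.
  apply: uniq_perm => //; first by rewrite map_inj_uniq ?enum_uniq //; exact: fsv_inj.
  move=> g; apply/mapP/idP => [[a _ ->]|gH]; first exact: ssvalP.
  by exists (SeqSub gH); rewrite ?mem_enum.
have [|a a1|p|p|p [pt un]] := @burnside_count (fsT H) polT pol_action.
- rewrite cT ltnNge; apply/negP => le1; apply: noline; exists (e3 R); first exact: e3_unit.
  move=> g gH; left; have h1 := subgrp1 KG.
  suff -> : g = 1%:M by rewrite mul1mx.
  move: le1 gH h1; case: (fs_seq H) => [|k [|]] //= _.
  by rewrite !inE => /eqP -> /eqP ->.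
- have [h1 h2] := axisP (fs_SO3 a).
  have pp : pole (axis (fsv a)) by split=> //; exists a.
  pose p1 : polT := SeqSub (proj2 (mem_poles _) pp).
  pose p2 : polT := SeqSub (proj2 (mem_poles _) (poleN pp)).
  have n12 : p1 != p2.
    apply/eqP => /(congr1 val) /= e; have : dotv (axis (fsv a)) (axis (fsv a)) = -1.
      by rewrite {1}e dotvNl h1.
    by rewrite h1 => E; clear -E; lra.
  have -> : 'Fix_pol_action[a]%g = [set p1; p2].
    apply/setP => q; apply/afix1P/idP; last first.
      by rewrite !inE => /orP[]/eqP ->; apply/pol_stab => //=; rewrite mulmxN h2.
    move=> /pol_stab e; rewrite !inE; apply/orP.
    have [hq _] := proj1 (mem_poles _) (ssvalP q).
    have [e'|e'] := SO3_fix_unit (fs_SO3 a) (val_neq1 a1) h1 hq h2 e.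
      by left; apply/eqP/val_inj.
    by right; apply/eqP/val_inj.
  by rewrite cards2 n12.
- have [hp _] := proj1 (mem_poles _) (ssvalP p).
  rewrite leqNgt; apply/negP => lt3.
  have [al|] := pselect (forall a : fsT H, pol_action p a = p).
    apply: (orbit_ge3 hp (q := val p)) => g gH; left.
    exact/(pol_stab p (SeqSub gH)).
  move=> /existsNP[a0 na0].
  apply: (orbit_ge3 hp (q := val (pol_action p a0))) => g gH.
  apply: contrapT => /not_orP[n1 n2]; move: lt3; rewrite ltnNge => /negP[].
  pose b : fsT H := ((SeqSub gH : fsT H)^-1)%g.
  have vb : val (pol_action p b) = g *m val p by rewrite /= trmxK.
  have c3 : #|p |: [set pol_action p a0; pol_action p b]| = 3%N.
    rewrite cardsU1 cards2 !inE negb_or.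
    have -> : p != pol_action p a0 by rewrite eq_sym; apply/eqP.
    have -> : p != pol_action p b by apply/eqP => /(congr1 val); rewrite vb => e; apply: n1.
    have -> // : pol_action p a0 != pol_action p b.
    by apply/eqP => /(congr1 val); rewrite vb => e; apply: n2.
  rewrite -[X in (X <= _)%N]c3.
  apply: subset_leq_card; apply/subsetP => y; rewrite !inE => /or3P[]/eqP ->.
  - exact: orbit_refl.
  - exact: mem_orbit.
  - exact: mem_orbit.
- have [_ [b b1 bp]] := proj1 (mem_poles _) (ssvalP p).
  have c2 : #|[set (1%g : fsT H); b]| = 2%N by rewrite cards2 eq_sym b1.
  rewrite -[X in (X <= _)%N]c2.
  apply: subset_leq_card; apply/subsetP => y /set2P[]->; apply/astab1P.
    exact: act1.
  exact/pol_stab.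
have pp := proj1 (mem_poles _) (ssvalP p).
exists (val p), #|'C[p | pol_action]%g|; split=> //; rewrite -?cT //.
  by case: pp.
pose p' : polT := SeqSub (proj2 (mem_poles _) (poleN pp)).
have /orbitP[a _ /(congr1 val) /= e] : p' \in orbit pol_action setT p.
  apply: un; rewrite !cst; apply: eq_count => g /=.
  by rewrite mulmxN eqr_opp.
by exists (ssval a)^T => //; apply: (subgrpV KG); exact: ssvalP.
Qed.

End Poles.

(** * Size of a spherical design *)

Section ExceptionalClasses.
Variable R : realType.
Implicit Types (m n : nat) (g h k : 'M[R]_3) (p q x y : 'cV[R]_3).

(** Taylor coefficients up to order two; in [design_size] they replace second derivatives along the
    lines x + t e_i. *)
Lemma coef_exp (P : {poly R}) m :
  [/\ (P ^+ m)`_0 = P`_0 ^+ m, (P ^+ m.+1)`_1 = m.+1%:R * P`_0 ^+ m * P`_1 &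
   (P ^+ m.+1)`_2 = m.+1%:R * P`_0 ^+ m * P`_2 + 'C(m.+1, 2)%:R * P`_0 ^+ m.-1 * P`_1 ^+ 2].
Proof.
have E0 (k : nat) : (P ^+ k)`_0 = P`_0 ^+ k.
  by elim: k => [|k IH]; [rewrite !expr0 coef1 | rewrite !exprS coefM big_ord1 IH].
have E1 (k : nat) : (P ^+ k.+1)`_1 = k.+1%:R * P`_0 ^+ k * P`_1.
  elim: k => [|k IH]; first by rewrite expr1 expr0 !mul1r.
  rewrite exprS coefM big_ord_recl big_ord1 /= IH E0 exprS -[in RHS]natr1.
  by ring.
split=> //; elim: m => [|m IH]; first by rewrite expr1 expr0 !mul1r bin_small // !mul0r addr0.
rewrite exprS coefM !big_ord_recl big_ord0 /= IH E1 E0.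
have -> : 'C(m.+2, 2) = ('C(m.+1, 2) + m.+1)%N by rewrite binS bin1.
case: m {IH} => [|m] /=; first by rewrite bin_small // !expr0 !expr1; ring.
by rewrite natrD -[m.+3%:R]natr1 -[m.+2%:R]natr1 !exprS; ring.
Qed.

Definition bvec (i : 'I_3) : 'cV[R]_3 := \col_j (j == i)%:R.

Lemma dotv_bvec x i : dotv x (bvec i) = x i 0.
Proof.
by rewrite dotvE !mxE -!val_eqE; move: i; apply: forall3; rewrite /= ?mulr1 ?mulr0 ?addr0 ?add0r.
Qed.

Lemma dotvDr x y p : dotv p (x + y) = dotv p x + dotv p y.
Proof. by rewrite dotvC dotvDl !(dotvC p). Qed.
Lemma dotvZr c x p : dotv p (c *: x) = c * dotv p x.
Proof. by rewrite dotvC dotvZl dotvC. Qed.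

(* Taking Laplacians of the identity: the number of points of a spherical
   design is determined by the constant. *)
Lemma design_size (l : seq 'cV[R]_3) n (c : R) : (forall a, a \in l -> dotv a a = 1) ->
  (forall x, \sum_(a <- l) dotv a x ^+ (2 * n) = c * dotv x x ^+ n) ->
  (size l)%:R = c * (2 * n + 1)%N%:R.
Proof.
move=> l1; elim: n c => [|n IH] c h.
  have := h 0; rewrite !muln0 expr0 mulr1 => <-.
  rewrite (eq_bigr (fun _ => 1)) => [|a _]; last by rewrite expr0.
  by rewrite big_const_seq count_predT iter_addr_0 ?mulr1.
have c1 : (2 * n + 1)%N%:R != 0 :> R by rewrite pnatr_eq0 addn1.
have key x : (2 * n + 1)%N%:R * \sum_(a <- l) dotv a x ^+ (2 * n) =
    c * (2 * n + 3)%N%:R * dotv x x ^+ n.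
  have per (i : 'I_3) : \sum_(a <- l) 'C((2 * n).+2, 2)%:R * dotv a x ^+ (2 * n) * a i 0 ^+ 2 =
      c * (n.+1%:R * dotv x x ^+ n + 'C(n.+1, 2)%:R * dotv x x ^+ n.-1 * (2 * x i 0) ^+ 2).
    pose A a : {poly R} := (dotv a x)%:P + (a i 0) *: 'X.
    pose B : {poly R} := (dotv x x)%:P + (2 * x i 0) *: 'X + 'X^2.
    have P0 : \sum_(a <- l) A a ^+ (2 * n).+2 - c *: B ^+ n.+1 = 0.
      apply: poly_fun0 => t.
      have := h (x + t *: bvec i); rewrite mulnS add2n => e.
      rewrite hornerD hornerN hornerZ !horner_exp horner_sum.
      have -> : B.[t] = dotv (x + t *: bvec i) (x + t *: bvec i).
        rewrite !hornerE dotvDl !dotvDr dotvZl !dotvZr dotvZl dotv_bvec.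
        by rewrite [dotv (bvec i) x]dotvC !dotv_bvec mxE eqxx mulr1n; ring.
      rewrite -e; apply/eqP; rewrite subr_eq0; apply/eqP; apply: eq_bigr => a _.
      rewrite horner_exp !hornerE dotvDr dotvZr dotv_bvec.
      by rewrite [t * _]mulrC.
    move: (congr1 (fun P : {poly R} => P`_2) P0).
    rewrite coef0 coefD coefN coefZ coef_sum => /subr0_eq.
    have [_ _ ->] := coef_exp B n.
    have -> : B`_0 = dotv x x by rewrite !(coefD, coefC, coefZ, coefX, coefXn) /=; ring.
    have -> : B`_1 = 2 * x i 0 by rewrite !(coefD, coefC, coefZ, coefX, coefXn) /=; ring.
    have -> : B`_2 = 1 by rewrite !(coefD, coefC, coefZ, coefX, coefXn) /=; ring.
    rewrite mulr1 => <-; apply: eq_bigr => a _.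
    have [_ _ ->] := coef_exp (A a) (2 * n).+1.
    have -> : (A a)`_0 = dotv a x by rewrite !(coefD, coefC, coefZ, coefX) /=; ring.
    have -> : (A a)`_1 = a i 0 by rewrite !(coefD, coefC, coefZ, coefX) /=; ring.
    have -> : (A a)`_2 = 0 by rewrite !(coefD, coefC, coefZ, coefX) /=; ring.
    by rewrite mulr0 add0r.
  have s := congr2 +%R (congr2 +%R (per i0) (per i1)) (per i2).
  rewrite -!big_split /= in s.
  have C1 : ('C((2 * n).+2, 2)%:R : R) = n.+1%:R * (2 * n + 1)%N%:R.
    rewrite -natrM bin2; congr (_%:R); rewrite -[RHS]doubleK; congr (_./2).
    by rewrite -mul2n /=; lia.
  have C2 : ('C(n.+1, 2)%:R * 2 : R) = n.+1%:R * n%:R.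
    have : ('C(n.+1, 2) * 2 = n.+1 * n)%N by rewrite bin2 /= muln2 halfK; have := odd_double_half (n.+1 * n); rewrite oddM /= andNb; lia.
    by move=> /(congr1 (fun z : nat => z%:R : R)); rewrite !natrM.
  have n1 : (n.+1%:R : R) != 0 by rewrite pnatr_eq0.
  apply: (mulfI n1); rewrite mulrA -C1 mulr_sumr.
  transitivity (\sum_(a <- l) ('C((2 * n).+2, 2)%:R * dotv a x ^+ (2 * n) * a i0 0 ^+ 2 +
     'C((2 * n).+2, 2)%:R * dotv a x ^+ (2 * n) * a i1 0 ^+ 2 +
     'C((2 * n).+2, 2)%:R * dotv a x ^+ (2 * n) * a i2 0 ^+ 2)).
    rewrite big_seq [RHS]big_seq; apply: eq_bigr => a al.
    rewrite -!mulrDr; move: (l1 a al); rewrite dotvE -!expr2 => ->.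
    by rewrite mulr1.
  rewrite s; have X : dotv x x ^+ n.-1 * dotv x x * n%:R = dotv x x ^+ n * n%:R.
    by case: (n) => [|j]; [rewrite !mulr0 | rewrite /= exprSr].
  transitivity (c * (3 * (n.+1%:R * dotv x x ^+ n) + 'C(n.+1, 2)%:R * 2 * 2 * (dotv x x ^+ n.-1 * dotv x x))).
    by move: (dotv x x ^+ n) (dotv x x ^+ n.-1) => D1 D2; rewrite dotvE; ring.
  rewrite C2 -(mulrA n.+1%:R) [n%:R * 2]mulrC.
  transitivity (c * (3 * (n.+1%:R * dotv x x ^+ n) + n.+1%:R * 2 * (dotv x x ^+ n.-1 * dotv x x * n%:R))); first by ring.
  by rewrite X natrD natrM; ring.
rewrite (IH (c * (2 * n + 3)%N%:R / (2 * n + 1)%N%:R)) => [|x].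
  by rewrite divfK // mulnS; congr (_ * _%:R); lia.
by apply: (mulfI c1); rewrite key [RHS]mulrA; congr (_ * _); rewrite [RHS]mulrC divfK.
Qed.

End ExceptionalClasses.

(** * Octahedral and icosahedral classes *)

Section OctaIcosa.
Variable R : realType.
Implicit Types (m n : nat) (g h k : 'M[R]_3) (p q x y : 'cV[R]_3).

Lemma subgrp_ext (K L : 'M[R]_3 -> Prop) : (forall g, K g <-> L g) -> subgrp K -> subgrp L.
Proof.
move=> e [h1 h2 h3 h4]; split=> [g /e|| g h /e gK /e hK|g /e gK]; first exact: h1.
- exact/e.
- by apply/e/h3.
- exact/e/h4.
Qed.

Lemma invline_sub (K L : 'M[R]_3 -> Prop) : (forall g, K g -> L g) -> invline L -> invline K.
Proof. by move=> KL [p hp h]; exists p => // g /KL; exact: h. Qed.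

Lemma isotropy_list m (t : tensor R m) : ~ invline (isotropy t) ->
  ~ (forall g, SO3 g -> isotropy t g) ->
  exists l : seq 'M[R]_3, [/\ uniq l, forall g, isotropy t g <-> g \in l &
    subgrp (fun g => g \in l)].
Proof.
move=> nl ns; have KG := isotropy_subgrp t.
have [|l hl] := @isotropy_finite R m t.
  by move=> [p hp cp]; apply: ns; exact: circle_full cp nl.
have hu g : isotropy t g <-> g \in undup l by rewrite mem_undup.
by exists (undup l); split => //; [exact: undup_uniq | exact: subgrp_ext KG].
Qed.

Lemma list_lagrange (H L : finsub R) : uniq (fs_seq H) -> uniq (fs_seq L) ->
  {subset fs_seq H <= fs_seq L} -> (size (fs_seq H) %| size (fs_seq L))%N.
Proof.
move=> uH uL sHL.
pose A := [set a : fsT L | fsv a \in fs_seq H].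
have gA : group_set A.
  apply/group_setP; split=> [|a b]; first by rewrite inE; exact: subgrp1 (fs_subgrp H).
  rewrite !inE => ha hb; change (fsv a *m fsv b \in fs_seq H).
  exact: (subgrpM (fs_subgrp H) ha hb).
have := cardSg (subsetT (Group gA)); rewrite cardsT card_seq_sub //=.
suff -> : #|A| = size (fs_seq H) by [].
rewrite -(card_seq_sub uH) -(card_in_imset (f := fun a : seq_sub (fs_seq H) => SeqSub (sHL _ (ssvalP a)) : fsT L)) => [|a b _ _ /(congr1 (@fsv _ _)) /= e]; last exact: val_inj.
apply: eq_card => a; rewrite inE; apply/idP/imsetP => [ha|[b _ ->]]; last exact: ssvalP.
by exists (SeqSub ha) => //; apply: val_inj.
Qed.

Lemma perm_mul (l : seq 'M[R]_3) k : uniq l -> subgrp (fun g => g \in l) -> k \in l ->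
  perm_eq [seq k *m g | g <- l] l.
Proof.
move=> ul KG kl; have kS := subgrp_SO3 KG kl.
apply: uniq_perm => //; first by rewrite map_inj_uniq //; exact: SO3_mulI.
move=> g; apply/mapP/idP => [[h hl ->]|gl]; first exact: (subgrpM KG kl hl).
exists (k^T *m g); last by rewrite SO3_KV.
exact: (subgrpM KG (subgrpV KG kl) gl).
Qed.

Lemma count_orbit (l : seq 'M[R]_3) k p : uniq l -> subgrp (fun g => g \in l) -> k \in l ->
  count (fun g => g *m p == k *m p) l = count (fun g => g *m p == p) l.
Proof.
move=> ul KG kl; rewrite -[LHS](seq.permP (perm_mul ul KG kl)) count_map.
apply: eq_count => g /=; rewrite -mulmxA; apply: inj_eq; apply: SO3_mulI.
exact: subgrp_SO3 KG _ kl.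
Qed.

Lemma unit_neqN p : dotv p p = 1 -> p <> - p.
Proof. by move=> hp e; have := hp; rewrite {1}e dotvNl hp => E; clear -E; lra. Qed.

Lemma sum_pw_fix m (l : seq 'M[R]_3) k p : uniq l -> subgrp (fun g => g \in l) -> k \in l ->
  gact k (\sum_(g <- l) pw m (g *m p)) = \sum_(g <- l) pw m (g *m p).
Proof.
move=> ul KG kl; rewrite gact_sum.
rewrite -[RHS](perm_big _ (perm_mul ul KG kl)) big_map /=.
by apply: eq_bigr => g _; rewrite gact_pw mulmxA.
Qed.

Lemma tspace_sum m (G : {set 'S_m}) (I : Type) (r : seq I) (F : I -> tensor R m) :
  (forall i, tspace G (F i)) -> tspace G (\sum_(i <- r) F i).
Proof.
move=> h; elim: r => [|i r IH]; last by rewrite big_cons; exact: tspaceD.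
by rewrite big_nil => s _ i; rewrite !ffunE.
Qed.

(** Full invariance would make the form equal to c (x.x)^n, so that size l = c (2n + 1) >= 7 c by
    [design_size]. At p the r elements fixing p and the r elements sending it to -p already give c
    >= 2r, whence size l >= 14 r. *)
Lemma polar_sum_not_SO3 n (l : seq 'M[R]_3) p r : (3 <= n)%N -> uniq l ->
  subgrp (fun g => g \in l) -> dotv p p = 1 ->
  count (fun g => g *m p == p) l = r -> (exists2 g, g \in l & g *m p = - p) ->
  (size l < 14 * r)%N ->
  ~ (forall g, SO3 g -> isotropy (\sum_(g <- l) pw (2 * n) (g *m p)) g).
Proof.
move=> n3 ul KG hp hr [g0 g0l g0p] sz H.
set s0 := \sum_(g <- l) _ in H.
have F x : tdot s0 (pw (2 * n) x) = \sum_(a <- [seq g *m p | g <- l]) dotv a x ^+ (2 * n).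
  by rewrite tdot_suml big_map; apply: eq_bigr => g _; rewrite tdot_pw.
pose c := tdot s0 (pw (2 * n) p).
have hc y : dotv y y = 1 -> tdot s0 (pw (2 * n) y) = c.
  move=> hy; have [h hS hh] := SO3_frame hy; have [k kS kk] := SO3_frame hp.
  have [MS e] := H _ (SO3_mul hS (SO3_tr kS)).
  have -> : y = (h *m k^T) *m p by rewrite -hh -[in RHS]kk -mulmxA (mulmxA k^T) SO3_trK // mul1mx.
  by rewrite -gact_pw -[s0 in LHS]e actE tdot_gact -gactM SO3_trK // gact1.
have hx x : \sum_(a <- [seq g *m p | g <- l]) dotv a x ^+ (2 * n) = c * dotv x x ^+ n.
  rewrite -F; have [->|x0] := eqVneq x 0.
    have fm : form (2 * n) (fun x => tdot s0 (pw (2 * n) x)) by exists s0.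
    have := form_homog 0 (0 : 'cV[R]_3) fm; rewrite scale0r => ->.
    rewrite expr0n muln_eq0 /= (gtn_eqF (leq_trans _ n3)) //= mul0r.
    have -> : dotv (0 : 'cV[R]_3) 0 = 0 by rewrite dotvE !mxE; ring.
    by rewrite expr0n (gtn_eqF (leq_trans _ n3)) //= mulr0.
  have [d [d0 hd]] := unit_scale x0.
  have fm : form (2 * n) (fun x => tdot s0 (pw (2 * n) x)) by exists s0.
  have := form_homog d x fm; rewrite hc // => e.
  move: hd; rewrite dotvZl dotvZr mulrA -expr2 => hd.
  apply: (mulfI (expf_neq0 (2 * n) d0)); rewrite -e mulrCA exprM -exprMn hd expr1n mulr1 //.
have := design_size _ hx; rewrite size_map => /(_ _) sE.
have sE' : (size l)%:R = c * (2 * n + 1)%N%:R.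
  by apply: sE => a /mapP[g gl ->]; rewrite dotv_SO3 //; exact: subgrp_SO3 KG _ gl.
have cr : (2 * r)%N%:R <= c.
  rewrite /c F big_map.
  have r1 : \sum_(g <- l | g *m p == p) 1 = r%:R :> R by rewrite big_const_seq iter_addr_0 hr.
  have r2 : \sum_(g <- l | g *m p == - p) 1 = r%:R :> R.
    by rewrite big_const_seq iter_addr_0 -g0p count_orbit ?hr.
  rewrite natrM mulr_natl mulr2n -{1}r1 -r2 [X in X + _]big_mkcond [X in _ + X]big_mkcond -big_split.
  apply: ler_sum => g _ /=.
  have ev : 0 <= dotv (g *m p) p ^+ (2 * n) by rewrite exprM exprn_ge0 // sqr_ge0.
  have pp := unit_neqN hp; have [e|_] := eqVneq (g *m p) p.
    rewrite e; have [//|_] := eqVneq p (- p).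
    by rewrite hp expr1n addr0.
  have [->|_] := eqVneq (g *m p) (- p); last by rewrite addr0.
  by rewrite dotvNl hp exprM sqrrN !expr1n add0r.
have : (2 * r)%N%:R * (7%N)%:R <= (size l)%:R :> R.
  rewrite sE'; apply: ler_pM => //; rewrite ?ler0n // ler_nat; lia.
by rewrite -natrM ler_nat => h; move: sz h; lia.
Qed.

(** The isotropy group of the sum of powers over the orbit of p contains the given group, hence has
    no invariant line either and has order 12, 24 or 60. By Lagrange this order is a multiple of 24
    or of 60, so the groups coincide. *)
Lemma octa_icosa_class n (t : tensor R (2 * n)) (l : seq 'M[R]_3) p r : (3 <= n)%N ->
  uniq l -> (forall g, isotropy t g <-> g \in l) -> ~ invline (isotropy t) ->
  dotv p p = 1 -> count (fun g => g *m p == p) l = r ->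
  (exists2 g, g \in l & g *m p = - p) -> (size l = 24 /\ r = 4 \/ size l = 60 /\ r = 5)%N ->
  exists2 s : tensor R (2 * n), Sspace s & forall g, isotropy s g <-> isotropy t g.
Proof.
move=> n3 ul hl nl hp hr hn ty.
have KG : subgrp (fun g => g \in l) by exact: subgrp_ext (isotropy_subgrp t).
pose s := \sum_(g <- l) pw (2 * n) (g *m p).
have sS : Sspace s by apply: tspace_sum => g; exact: Sspace_pw.
exists s => //.
have KL g : isotropy t g -> isotropy s g.
  move=> gt; have gl := proj1 (hl g) gt; split; first by case: gt.
  by rewrite actE sum_pw_fix.
have nls : ~ invline (isotropy s) by move/(invline_sub KL).
have ns : ~ (forall g, SO3 g -> isotropy s g).
  by apply: (polar_sum_not_SO3 n3 ul KG hp hr hn); case: ty => -[-> ->].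
have [L [uL hL LG]] := isotropy_list nls ns.
have nlL : ~ invline (fun g => g \in L) by apply: contra_not nls => /invline_sub; apply => g /hL.
have [p' [r' [_ _ ty' _]]] := @finsub_pole R (Finsub LG) nlL uL.
have sub : {subset l <= L} by move=> g gl; apply/hL/KL/hl.
have dv := @list_lagrange (Finsub KG) (Finsub LG) ul uL sub.
rewrite /= in ty' dv.
have sz : size l = size L.
  by move: dv; case: ty => -[-> _]; case: ty' => -[-> _].
have [_ eq] := uniq_min_size ul sub (eq_leq (esym sz)).
by move=> g; rewrite hL hl eq.
Qed.

End OctaIcosa.

(** * A degree-six invariant for the tetrahedral group *)

Section Tetrahedral.
Variable R : realType.
Implicit Types (m n : nat) (g h k : 'M[R]_3) (p q x y : 'cV[R]_3).

Lemma rank1_invline (K : 'M[R]_3 -> Prop) (B : 'M[R]_3) : subgrp K -> \rank B = 1%N ->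
  (forall g, K g -> (B *m g <= B)%MS) -> invline K.
Proof.
move=> KG rB st; pose v := nz_row B.
have v0 : v != 0 by rewrite nz_row_eq0 -mxrank_eq0 rB.
have vB : (v <= B)%MS by exact: nz_row_sub.
have Bv : (B <= v)%MS.
  by have := mxrank_leqif_sup vB; rewrite rB rank_rV v0 => -[_ <-].
have [|c [c0 hc]] := @unit_scale R v^T; first by rewrite trmx_eq0.
exists (c *: v^T) => // g Kg; have gS := subgrp_SO3 KG Kg.
have := st _ (subgrpV KG Kg) => /(submx_trans (submxMr _ vB)) /submx_trans /(_ Bv).
case/sub_rVP => d vg.
have gv : g *m (c *: v^T) = d *: (c *: v^T).
  by rewrite -scalemxAr -{1}[g]trmxK -trmx_mul vg linearZ /= !scalerA mulrC.
have : dotv (g *m (c *: v^T)) (g *m (c *: v^T)) = 1 by rewrite dotv_SO3.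
rewrite gv dotvZl dotvZr hc mulr1 -expr2 => /eqP; rewrite sqrf_eq1.
by case/orP => /eqP ->; rewrite ?scaleN1r ?scale1r; [left|right].
Qed.

(** In odd dimension M has a real eigenvalue a. If M - a were nonzero, its rank would be 1 or 2, and
    its image or its kernel would be an invariant line. *)
Lemma schur3 (K : 'M[R]_3 -> Prop) (M : 'M[R]_3) : subgrp K -> ~ invline K ->
  (forall g, K g -> g *m M = M *m g) -> exists a, M = a%:M.
Proof.
move=> KG nl cM.
have [|a] := @odd_poly_root R (char_poly M); first by rewrite size_char_poly.
rewrite -eigenvalue_root_char => /eigenvalueP[v vM v0].
exists a; pose W := M - a%:M; apply/eqP; rewrite -subr_eq0 -/W -mxrank_eq0.
have cW g : K g -> g *m W = W *m g by move=> Kg; rewrite mulmxBr mulmxBl cM // scalar_mxC.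
have vW : v *m W = 0 by rewrite mulmxBr vM mul_mx_scalar subrr.
have r3 : (\rank W < 3)%N.
  rewrite ltn_neqAle rank_leq_row andbT; apply: contraNneq v0 => e.
  have fW : row_free W by rewrite /row_free e.
  by apply/eqP/(row_free_inj fW); rewrite vW mul0mx.
have st1 g : K g -> (W *m g <= W)%MS by move=> Kg; rewrite -cW // submxMl.
have st2 g : K g -> (kermx W *m g <= kermx W)%MS.
  by move=> Kg; apply/sub_kermxP; rewrite -mulmxA cW // mulmxA mulmx_ker mul0mx.
move: r3; case e: (\rank W) => [|[|[|]]] // _.
- by case: nl; exact: (rank1_invline KG e st1).
- by case: nl; apply: (rank1_invline KG _ st2); rewrite mxrank_ker e.
Qed.

Definition sgn (s : R) := s = 1 \/ s = -1.

(** By [schur3] the sum of the projections on the images of p is scalar, and its trace 12 makes the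
    scalar 4. Pairing with p gives a sum of squares equal to 4, already supplied by the four
    elements sending p to p or -p; all other terms vanish. *)
Lemma tetra_scalar (l : seq 'M[R]_3) p : uniq l -> subgrp (fun g => g \in l) ->
  ~ invline (fun g => g \in l) -> dotv p p = 1 -> size l = 12%N ->
  count (fun g => g *m p == p) l = 2%N -> (exists2 g, g \in l & g *m p = - p) ->
  forall g, g \in l -> [\/ g *m p = p, g *m p = - p | dotv (g *m p) p = 0].
Proof.
move=> ul KG nl hp s12 c2 [g0 g0l g0p].
pose M := \sum_(g <- l) (g *m p) *m (g *m p)^T.
have [|a Ma] := @schur3 _ M KG nl.
  move=> k kl; have kS := subgrp_SO3 KG kl.
  rewrite /M -[in RHS](perm_big _ (perm_mul ul KG kl)) big_map /= mulmx_sumr mulmx_suml.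
  apply: eq_bigr => g _; rewrite !trmx_mul !mulmxA.
  by rewrite -!(mulmxA _ k^T) SO3_trK // mulmx1.
have tr : \tr M = 12%:R.
  rewrite raddf_sum /= (eq_big_seq (fun _ => 1)) => [|g gl].
    by rewrite big_const_seq count_predT iter_addr_0 s12.
  rewrite mxtrace_mulC /mxtrace big_ord1 -/(dotv _ _) dotv_SO3 //.
  exact: subgrp_SO3 KG _ gl.
have a4 : a = 4.
  by move: tr; rewrite Ma mxtrace_scalar -mulr_natr => e; lra.
have sum4 : \sum_(g <- l) dotv (g *m p) p ^+ 2 = 4.
  have : dotv p (M *m p) = 4 by rewrite Ma a4 mul_scalar_mx dotvZr hp mulr1.
  rewrite /M mulmx_suml /dotv mulmx_sumr summxE => <-; apply: eq_bigr => g _.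
  move: (g *m p) => y.
  have -> : p^T *m (y *m y^T *m p) = (p^T *m y) *m (y^T *m p) by rewrite !mulmxA.
  rewrite [RHS]mxE big_ord1.
  by rewrite -/(dotv p y) -/(dotv y p) dotvC expr2.
have cN : count (fun g => g *m p == - p) l = 2%N.
  by apply: etrans c2; rewrite -g0p; exact: count_orbit.
have pp := unit_neqN hp.
pose A g := (g *m p == p) || (g *m p == - p).
have cA : count A l = 4%N.
  have := count_predUI (fun g => g *m p == p) (fun g => g *m p == - p) l.
  rewrite c2 cN (_ : count (predI _ _) l = 0)%N ?addn0 //.
  apply/eqP; rewrite -leqn0 leqNgt -has_count; apply/hasPn => g _ /=.
  by apply/negP => /andP[/eqP -> /eqP].
have sA : \sum_(g <- l | A g) dotv (g *m p) p ^+ 2 = 4.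
  rewrite (eq_bigr (fun _ => 1)) => [|g /orP[]/eqP ->]; last 2 first.
  - by rewrite hp expr1n.
  - by rewrite dotvNl hp sqrrN expr1n.
  by rewrite big_const_seq iter_addr_0 cA.
move=> g gl; have [/orP[]/eqP|nA] := boolP (A g); [by constructor 1|by constructor 2|].
constructor 3; move: sum4; rewrite (bigID A) /= sA -[RHS]addr0 => /addrI /eqP.
rewrite psumr_eq0 => [/allP/(_ _ gl)|h _]; last exact: sqr_ge0.
by rewrite nA /= sqrf_eq0 => /eqP.
Qed.

(** The Vandermonde product of the squared coordinates. Odd permutations of the axes reverse it,
    which separates the tetrahedral group from the octahedral one. *)
Definition sqdisc x : R := (x i0 0 ^+ 2 - x i1 0 ^+ 2) * (x i1 0 ^+ 2 - x i2 0 ^+ 2) *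
  (x i2 0 ^+ 2 - x i0 0 ^+ 2).
Definition powsum n x : R := x i0 0 ^+ (2 * n) + x i1 0 ^+ (2 * n) + x i2 0 ^+ (2 * n).

Definition sgnperm g := forall i, exists j s, sgn s /\ g *m bvec R i = s *: bvec R j.

Lemma mul_bvec g a b : g a b = (g *m bvec R b) a 0.
Proof. by rewrite mulmx3 !mxE -!val_eqE; move: b; apply: forall3 => /=; ring. Qed.

Lemma sgn_sqr s : sgn s -> s ^+ 2 = 1.
Proof. by case=> ->; rewrite ?sqrrN expr1n. Qed.

(** Both functions see only the squared coordinates, hence only the permutation of the axes. An odd
    permutation of three axes is a transposition and preserves one of them: this is the last
    clause. *)
Lemma sgnperm_sqdisc n g : SO3 g -> sgnperm g ->
  (forall x, powsum n (g *m x) = powsum n x) /\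
  ((forall x, sqdisc (g *m x) = sqdisc x) \/
   (forall x, sqdisc (g *m x) = - sqdisc x) /\
     exists i s, sgn s /\ g *m bvec R i = s *: bvec R i).
Proof.
move=> gS sg.
have [j0 [s0 [/sgn_sqr hs0 e0]]] := sg i0.
have [j1 [s1 [/sgn_sqr hs1 e1]]] := sg i1.
have [j2 [s2 [/sgn_sqr hs2 e2]]] := sg i2.
have orth a b : a != b -> dotv (g *m bvec R a) (g *m bvec R b) = 0.
  by move=> ab; rewrite dotv_SO3 // dotv_bvec mxE eq_sym (negbTE ab).
have ne (s s' : R) (j : 'I_3) : s ^+ 2 = 1 -> s' ^+ 2 = 1 -> dotv (s *: bvec R j) (s' *: bvec R j) <> 0.
  move=> hs hs'; rewrite dotvZl dotvZr dotv_bvec mxE eqxx mulr1 => /eqP; rewrite mulf_eq0.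
  by rewrite -sqrf_eq0 hs -[s' == 0]sqrf_eq0 hs' oner_eq0.
have n01 : j0 <> j1.
  by move=> e; apply: (ne s0 s1 j1 hs0 hs1); rewrite -{1}e -e0 -e1; exact: orth.
have n02 : j0 <> j2.
  by move=> e; apply: (ne s0 s2 j2 hs0 hs2); rewrite -{1}e -e0 -e2; exact: orth.
have n12 : j1 <> j2.
  by move=> e; apply: (ne s1 s2 j2 hs1 hs2); rewrite -{1}e -e1 -e2; exact: orth.
have [sg0 sg1 sg2] : [/\ sgn s0, sgn s1 & sgn s2].
  by split; [move/eqP: hs0 | move/eqP: hs1 | move/eqP: hs2];
    rewrite sqrf_eq1 => /orP[]/eqP ->; [left|right|left|right|left|right].
have gx x a : (g *m x) a 0 = s0 * (a == j0)%:R * x i0 0 + s1 * (a == j1)%:R * x i1 0 +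
    s2 * (a == j2)%:R * x i2 0.
  by rewrite mulmx3 !mul_bvec e0 e1 e2 !mxE.
have sq (s z : R) : s ^+ 2 = 1 -> (s * z) ^+ 2 = z ^+ 2 by move=> h; rewrite exprMn h mul1r.
have gq x : exists X : 'I_3 -> R, (forall a, ((g *m x) a 0) ^+ 2 = X a) /\
   X j0 = x i0 0 ^+ 2 /\ X j1 = x i1 0 ^+ 2 /\ X j2 = x i2 0 ^+ 2.
  exists (fun a => ((g *m x) a 0) ^+ 2); split=> //; rewrite !gx.
  have b (u v : 'I_3) : u <> v -> (u == v) = false by move/eqP/negbTE.
  rewrite !eqxx (b _ _ n01) (b _ _ n02) (b _ _ n12) ![j1 == j0]eq_sym ![j2 == _]eq_sym.
  rewrite (b _ _ n01) (b _ _ n02) (b _ _ n12) !mulr0 !mul0r !mulr1 !addr0 !add0r.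
  by rewrite !sq.
clear gx orth ne.
move: j0 j1 j2 e0 e1 e2 n01 n02 n12 gq; apply: forall3; apply: forall3; apply: forall3 => // e0 e1 e2 _ _ _ gq.
all: split=> [x|].
all: try by rewrite /powsum !exprM; have [X [XE [E0 [E1 E2]]]] := gq x;
  rewrite !XE E0 E1 E2; ring.
all: try by left=> x; rewrite /sqdisc; have [X [XE [E0 [E1 E2]]]] := gq x; rewrite !XE E0 E1 E2; ring.
all: right; split; first by move=> x; rewrite /sqdisc; have [X [XE [E0 [E1 E2]]]] := gq x; rewrite !XE E0 E1 E2; ring.
all: try by exists i0, s0.
all: try by exists i1, s1.
all: try by exists i2, s2.
Qed.

Lemma sform_sqdisc n : (3 <= n)%N -> sform (2 * n) (fun x => powsum n x + sqdisc x).
Proof.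
move=> n3; apply: sformD.
  have pX i : sform (2 * n) (fun x : 'cV[R]_3 => x i 0 ^+ (2 * n)).
    elim: (2 * n)%N => [|k IH].
      by exists (fun _ => 1); [exact: form_const | move=> x _; rewrite expr0].
    by apply: sform_ext (sform_mulX i IH) => x _; rewrite exprS.
  exact: sformD (sformD (pX i0) (pX i1)) (pX i2).
have sqB m i j (P : 'cV[R]_3 -> R) : sform m P ->
    sform m.+2 (fun x => (x i 0 ^+ 2 - x j 0 ^+ 2) * P x).
  move=> hP; have h a := sform_mulX a (sform_mulX a hP).
  by apply: sform_ext (sformD (h i) (sformZ (-1) (h j))) => x _; ring.
have c1 : sform 0 (fun _ : 'cV[R]_3 => 1) by exists (fun _ => 1) => //; exact: form_const.
have d6 : sform 6 sqdisc.
  by apply: sform_ext (sqB _ i0 i1 _ (sqB _ i1 i2 _ (sqB _ i2 i0 _ c1))) => x _;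
    rewrite /sqdisc; ring.
by apply: sform_padE d6 _ _; [lia | rewrite mul2n odd_double].
Qed.

Lemma powsum_bvec n i : (0 < n)%N -> powsum n (bvec R i) + sqdisc (bvec R i) = 1.
Proof.
move=> n0; rewrite /powsum /sqdisc !mxE -!val_eqE; move: i; apply: forall3 => /=;
  rewrite !expr1n !(expr0n _ (2 * n)) muln_eq0 (gtn_eqF n0) /=; ring.
Qed.

(** With A, B, C the squared coordinates and S = (A + B) (B + C) (C + A), the relation A + B + C = 1
    gives A^3 + B^3 + C^3 = 1 - 3 S, while [sqdisc] is at most S. For n >= 3 the sum is at most 1 -
    2 S, so the value 1 forces S = 0 and two of the squares vanish. *)
Lemma powsum_max n x : (3 <= n)%N -> dotv x x = 1 -> powsum n x + sqdisc x = 1 ->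
  exists j s, sgn s /\ x = s *: bvec R j.
Proof.
rewrite /powsum /sqdisc dotvE -!expr2 !exprM => n3.
set a := x i0 0; set b := x i1 0; set c := x i2 0.
have pw3 (z : R) : 0 <= z -> z <= 1 -> z ^+ n <= z ^+ 3.
  by move=> z0 z1; apply: ler_wiXn2l.
have := sqr_ge0 a; have := sqr_ge0 b; have := sqr_ge0 c.
have ax z : z ^+ 2 = 1 -> sgn z.
  by move/eqP; rewrite sqrf_eq1 => /orP[]/eqP ->; [left|right].
have z0 (z : R) : z ^+ 2 = 0 -> z = 0 by move/eqP; rewrite sqrf_eq0 => /eqP.
move eA : (a ^+ 2) => A; move eB : (b ^+ 2) => B; move eC : (c ^+ 2) => C' C0 B0 A0 s1 E.
have pA : A ^+ n <= A ^+ 3 by apply: pw3 => //; lra.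
have pB : B ^+ n <= B ^+ 3 by apply: pw3 => //; lra.
have pC : C' ^+ n <= C' ^+ 3 by apply: pw3 => //; lra.
have S0 : (A + B) * (B + C') * (C' + A) = 0.
  have CE : C' = 1 - A - B by lra.
  have p0 : 0 <= (A + B) * (B + C') * (C' + A) by rewrite !mulr_ge0 // addr_ge0.
  have cub : A ^+ 3 + B ^+ 3 + C' ^+ 3 = 1 - 3 * ((A + B) * (B + C') * (C' + A)).
    by rewrite CE; ring.
  have dle : (A - B) * (B - C') * (C' - A) <= (A + B) * (B + C') * (C' + A).
    have e : (A + B) * (B + C') * (C' + A) - (A - B) * (B - C') * (C' - A) =
        2 * (A * A * B + B * B * C' + C' * C' * A) + 2 * A * B * C' by ring.
    have q : 0 <= 2 * (A * A * B + B * B * C' + C' * C' * A) + 2 * A * B * C'.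
      by rewrite !(addr_ge0, mulr_ge0).
    by rewrite -subr_ge0 e.
  by apply/eqP; rewrite eq_le p0 andbT; lra.
move/eqP: S0; rewrite !mulf_eq0 -orbA => /or3P[]/eqP h.
- exists i2, c; split; first by apply: ax; rewrite eC; lra.
  have a0 : a = 0 by apply: z0; rewrite eA; lra.
  have b0 : b = 0 by apply: z0; rewrite eB; lra.
  by apply: vec3P; rewrite !mxE -!val_eqE /= -/a -/b -/c ?a0 ?b0 ?mulr0 ?mulr1.
- exists i0, a; split; first by apply: ax; rewrite eA; lra.
  have b0 : b = 0 by apply: z0; rewrite eB; lra.
  have c0 : c = 0 by apply: z0; rewrite eC; lra.
  by apply: vec3P; rewrite !mxE -!val_eqE /= -/a -/b -/c ?b0 ?c0 ?mulr0 ?mulr1.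
exists i1, b; split; first by apply: ax; rewrite eB; lra.
have c0 : c = 0 by apply: z0; rewrite eC; lra.
have a0 : a = 0 by apply: z0; rewrite eA; lra.
by apply: vec3P; rewrite !mxE -!val_eqE /= -/a -/b -/c ?c0 ?a0 ?mulr0 ?mulr1.
Qed.

End Tetrahedral.

(** * Realising the tetrahedral class *)

Section TetrahedralClass.
Variable R : realType.
Implicit Types (m n : nat) (g h k : 'M[R]_3) (p q x y : 'cV[R]_3).

Lemma e3_bvec : e3 R = bvec R i2.
Proof. by apply: vec3P; rewrite !mxE. Qed.

Lemma sgn_mul (s s' : R) : sgn s -> sgn s' -> sgn (s * s').
Proof. by move=> [->|->] [->|->]; rewrite ?mulr1 ?mul1r ?mulrNN ?mulr1; [left|right|right|left]. Qed.

(** A rotation about e3 that permutes the axes is a multiple of the quarter turn; an odd multiple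
    exchanges the first two squares and so reverses [sqdisc]. *)
Lemma sqdisc_rot (u : R[i]) x : cunit u -> sgnperm (rot u) ->
  [\/ u = 1, u = -1 | sqdisc (rot u *m x) = - sqdisc x /\ u * u = -1].
Proof.
move=> hu /(_ i0) [j [s [hs]]].
have -> : rot u *m bvec R i0 = vec3 (complex.Re u) (complex.Im u) 0.
  by apply: vec3P; rewrite !mulmx3 !mxE -!val_eqE /=; ring.
have s0 : s != 0 by rewrite -sqrf_eq0 (sgn_sqr hs) oner_eq0.
case: u hu => a b; rewrite /cunit /= => hu /colP e.
have := e i0; have := e i1; have := e i2; rewrite !mxE -!val_eqE /=; clear e.
move: j; apply: forall3 => /=; rewrite ?mulr0 ?mulr1 => e2 e1 e0.
- rewrite e0 e1; case: hs => ->; [constructor 1|constructor 2]; apply/eqP; rewrite eq_complex /= ?oppr0 !eqxx //.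
- constructor 3; split; last by apply/eqP; rewrite eq_complex /=; apply/andP; split; apply/eqP; rewrite e0 e1; have := sgn_sqr hs; rewrite expr2; nra.
  rewrite /sqdisc !mulmx3 !mxE /= e0 e1; have := sgn_sqr hs => h2.
  have q (z : R) : (s * z) ^+ 2 = z ^+ 2 by rewrite exprMn h2 mul1r.
  by rewrite !(mul0r, add0r, addr0, mul1r, mulNr, sqrrN, q); ring.
- by move/eqP: e2; rewrite eq_sym (negbTE s0).
Qed.

Lemma sqdiscN (x : 'cV[R]_3) : sqdisc (rot (-1) *m x) = sqdisc x.
Proof. by rewrite /sqdisc !mulmx3 !mxE /=; ring. Qed.

Lemma sqdisc_flip (x : 'cV[R]_3) : sqdisc (flip R *m x) = sqdisc x.
Proof. by rewrite /sqdisc !mulmx3 !mxE /=; ring. Qed.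

(** A rational unit vector with distinct squared coordinates, so that [sqdisc] does not vanish
    there. *)
Definition wit : 'cV[R]_3 := vec3 0 (3 / 5) (4 / 5).

Lemma wit_unit : dotv wit wit = 1.
Proof. by rewrite dotvE !mxE /=; field. Qed.

Lemma sqdisc_wit : sqdisc wit <> - sqdisc wit.
Proof. by rewrite /sqdisc !mxE /= => e; lra. Qed.

(** The form [powsum] + [sqdisc] is 1 exactly at the six signed basis vectors of the unit sphere, so
    its symmetries are signed permutations. As K is transitive on these six, a symmetry may be
    corrected by K to fix e3; it is then the identity or [rot (-1)], because a quarter turn reverses
    [sqdisc]. *)
Lemma tetra_class n (K : 'M[R]_3 -> Prop) : (3 <= n)%N -> subgrp K ->
  (forall j s, sgn s -> exists2 k, K k & k *m bvec R i2 = s *: bvec R j) ->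
  (forall g, K g -> sgnperm g) ->
  (exists r, [/\ K r, r != 1%:M, r *m bvec R i2 = bvec R i2 &
     forall g, K g -> g *m bvec R i2 = bvec R i2 -> g = 1%:M \/ g = r]) ->
  exists2 s : tensor R (2 * n), Sspace s & forall g, isotropy s g <-> K g.
Proof.
move=> n3 KG orb sp [r [Kr r1 r3 stab]].
have n0 : (0 < n)%N by lia.
have KS := subgrp_SO3 KG.
have rE : r = rot (-1).
  have [|u hu rE] := SO3_fix_e3 (KS _ Kr); first by rewrite e3_bvec.
  have := sp _ Kr; rewrite rE => /(sqdisc_rot 0 hu) [u1|->//|[_ uu]].
    by move: r1; rewrite rE u1 rot1 eqxx.
  have rr : r *m r = rot (-1) by rewrite rE -rotM uu.
  have [|e|e] := stab (r *m r) (subgrpM KG Kr Kr); first by rewrite -mulmxA !r3.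
    move: e; rewrite rr -(rot1 R) => /rot_inj /eqP; rewrite eq_complex /= oppr0 eqxx andbT => /eqP E.
    by exfalso; clear -E; lra.
  by rewrite -rE -rr e.
have fixK g : K g -> g *m bvec R i2 = bvec R i2 -> forall x, sqdisc (g *m x) = sqdisc x.
  move=> Kg ge x; have [->|->] := stab g Kg ge; first by rewrite mul1mx.
  by rewrite rE sqdiscN.
have Kflip : K (flip R).
  have [k Kk ke] := orb i0 1 (or_introl erefl); rewrite scale1r in ke.
  have kS := KS _ Kk.
  (* The half-turn about a unit vector v is 2 v v^T - 1; conjugating the one about e3 by k gives the
     one about e1, which is [flip]. *)
  have rE2 : r = 2 *: (bvec R i2 *m (bvec R i2)^T) - 1%:M.
    rewrite rE; apply/matrixP; apply: forall3; apply: forall3;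
      rewrite !mxE big_ord1 !mxE -!val_eqE /= ?mulr1n ?mulr0n; ring.
  have -> : flip R = k *m r *m k^T.
    rewrite rE2 mulmxBr mulmxBl mulmx1 (proj1 kS) -scalemxAr -scalemxAl mulmxA ke.
    rewrite -mulmxA -trmx_mul ke.
    apply/matrixP; apply: forall3; apply: forall3;
      rewrite !mxE big_ord1 !mxE -!val_eqE /= ?mulr1n ?mulr0n; ring.
  by apply: subgrpM => //; [exact: subgrpM | exact: subgrpV].
(* An element reversing [sqdisc] would preserve a coordinate axis. Moved to e3 by conjugation, and
   composed with the flip if it reverses e3, it would lie in the stabiliser of e3 in K, whose
   elements preserve [sqdisc]. *)
have even g : K g -> forall x, sqdisc (g *m x) = sqdisc x.
  move=> Kg; have [_ [//|[od [i [s [hs gi]]]]]] := sgnperm_sqdisc n (KS _ Kg) (sp _ Kg).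
  have [k Kk ke] := orb i 1 (or_introl erefl); rewrite scale1r in ke.
  have kS := KS _ Kk; have KkT := subgrpV KG Kk.
  have kK x : k *m (k^T *m x) = x by rewrite mulmxA (proj1 kS) mul1mx.
  pose g' := k^T *m g *m k.
  have Kg' : K g' by do 2?apply: (subgrpM KG).
  have od' x : sqdisc (g' *m x) = - sqdisc x.
    have [_ [ev|[ov _]]] := sgnperm_sqdisc n kS (sp _ Kk).
      by rewrite /g' -!mulmxA -(ev (k^T *m _)) kK od ev.
    by rewrite /g' -!mulmxA -[LHS]opprK -(ov (k^T *m _)) kK od ov opprK.
  have g'e : g' *m bvec R i2 = s *: bvec R i2.
    by rewrite /g' -!mulmxA ke gi -scalemxAr -ke SO3_K //.
  case: sqdisc_wit; rewrite -od'; case: hs => sE.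
    by rewrite fixK // g'e sE scale1r.
  have e x : g' *m x = (g' *m flip R) *m (flip R *m x).
    by rewrite -!mulmxA (mulmxA (flip R)) flipK mul1mx.
  rewrite e fixK ?sqdisc_flip //; first exact: subgrpM.
  by rewrite -mulmxA -{1}e3_bvec flip_e3 mulmxN e3_bvec g'e sE scaleN1r opprK.
have [s sS sI] := sform_isotropy (sform_sqdisc R n3); exists s => // g; rewrite sI.
split=> [[gS gP]|Kg]; last first.
  split; first exact: KS.
  by move=> x _; have [-> _] := sgnperm_sqdisc n (KS _ Kg) (sp _ Kg); rewrite even.
have bu i : dotv (bvec R i) (bvec R i) = 1 by rewrite dotv_bvec mxE eqxx.
have sgP h : SO3 h -> (forall x, dotv x x = 1 ->
    powsum n (h *m x) + sqdisc (h *m x) = powsum n x + sqdisc x) -> sgnperm h.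
  move=> hS hP i; apply: (@powsum_max R n) => //; first by rewrite dotv_SO3.
  by rewrite hP // powsum_bvec.
have [j [c [hc gE]]] := sgP g gS gP i2.
have [k Kk ke] := orb j c hc; have kS := KS _ Kk.
pose h := k^T *m g.
have hS : SO3 h by apply: SO3_mul => //; exact: SO3_tr.
have KkT := subgrpV KG Kk.
have hP x : dotv x x = 1 -> powsum n (h *m x) + sqdisc (h *m x) = powsum n x + sqdisc x.
  move=> hx; rewrite /h -mulmxA.
  have [-> _] := sgnperm_sqdisc n (KS _ KkT) (sp _ KkT); rewrite even //; exact: gP.
have gkh : g = k *m h by rewrite mulmxA (proj1 kS) mul1mx.
have hsg := sgP h hS hP.
have [|u hu hE] := SO3_fix_e3 hS.
  by rewrite e3_bvec /h -mulmxA gE -ke SO3_K //.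
rewrite gkh; apply: subgrpM => //.
have hsg' := hsg; rewrite hE in hsg'.
have [u1|u1|[od _]] := sqdisc_rot wit hu hsg'.
- by rewrite hE u1 rot1; exact: subgrp1.
- by rewrite hE u1 -rE.
case: sqdisc_wit; rewrite -od -hE; apply: (@addrI _ (powsum n wit)).
have [pE _] := sgnperm_sqdisc n hS hsg.
by rewrite -[X in _ = X + _]pE hP //; exact: wit_unit.
Qed.

(** By [tetra_scalar] any two images of p are equal, opposite or orthogonal, and each image is
    reached by two of the twelve elements. The six images are then the directions of an orthogonal
    frame, which h brings to the coordinate axes. *)
Lemma tetra_frame (l : seq 'M[R]_3) p : uniq l -> subgrp (fun g => g \in l) ->
  ~ invline (fun g => g \in l) -> dotv p p = 1 -> size l = 12%N ->
  count (fun g => g *m p == p) l = 2%N -> (exists2 g, g \in l & g *m p = - p) ->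
  exists2 h, SO3 h & let K g := h *m g *m h^T \in l in
  [/\ forall j s, sgn s -> exists2 k, K k & k *m bvec R i2 = s *: bvec R j,
    forall g, K g -> sgnperm g &
    exists r, [/\ K r, r != 1%:M, r *m bvec R i2 = bvec R i2 &
     forall g, K g -> g *m bvec R i2 = bvec R i2 -> g = 1%:M \/ g = r]].
Proof.
move=> ul KG nl hp s12 c2 h0.
have sc := tetra_scalar ul KG nl hp s12 c2 h0.
have [g0 g0l g0p] := h0.
have KS := subgrp_SO3 KG.
have cnt k : k \in l -> count (fun g => g *m p == k *m p) l = 2%N.
  by move=> kl; apply: etrans c2; exact: count_orbit.
have rel g k : g \in l -> k \in l ->
    [\/ g *m p = k *m p, g *m p = - (k *m p) | dotv (g *m p) (k *m p) = 0].
  move=> gl kl; have kS := KS _ kl.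
  have := sc _ (subgrpM KG (subgrpV KG kl) gl); rewrite -mulmxA => -[e|e|e].
  - by constructor 1; rewrite -[LHS]mul1mx -(proj1 kS) -mulmxA e.
  - by constructor 2; rewrite -[LHS]mul1mx -(proj1 kS) -mulmxA e mulmxN.
  - by constructor 3; rewrite dotvC dotv_mul dotvC.
(* Each listed k accounts for only two elements, those with the same image of p; a list with fewer
   than six entries leaves another image. *)
have esc (s : seq 'M[R]_3) : {subset s <= l} -> (2 * size s < 12)%N ->
    exists2 g, g \in l & forall k, k \in s -> g *m p != k *m p.
  move=> sl sz; apply: contrapT => H.
  have al g : g \in l -> has (fun k => g *m p == k *m p) s.
    move=> gl; apply: contrapT => /negP/hasPn nh; apply: H; exists g => // k /nh.
  have : (count (fun g => has (fun k => g *m p == k *m p) s) l <= 2 * size s)%N.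
    clear al H sz; elim: s sl => [|k s IH] sl; first by rewrite (eq_count (a2 := pred0)) // count_pred0.
    have kl : k \in l by apply: sl; rewrite inE eqxx.
    have sl' : {subset s <= l} by move=> z zs; apply: sl; rewrite inE zs orbT.
    have := count_predUI (fun g => g *m p == k *m p) (fun g => has (fun k => g *m p == k *m p) s) l.
    have := IH sl'; rewrite (cnt k kl) /= => h1 h2.
    have -> : count (fun g => (g *m p == k *m p) || has (fun k0 => g *m p == k0 *m p) s) l =
      count (predU (fun g => g *m p == k *m p) (fun g => has (fun k => g *m p == k *m p) s)) l by [].
    by move: h1 h2; lia.
  by rewrite (eq_in_count (a2 := predT)) ?count_predT ?s12 // leqNgt sz.
have l1 := subgrp1 KG.
have [g1 g1l g1n] : exists2 g, g \in l & dotv (g *m p) p = 0.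
  have [||g gl gn] := esc [:: 1%:M; g0] => //.
    by move=> z; rewrite !inE => /orP[]/eqP ->.
  exists g => //; have [e|e|//] := sc g gl.
    by have := gn 1%:M; rewrite inE eqxx mul1mx e eqxx => /(_ isT).
  by have := gn g0; rewrite !inE eqxx orbT g0p e eqxx => /(_ isT).
have g10l := subgrpM KG g1l g0l.
have [g2 g2l [g2n g2n1]] : exists2 g, g \in l & dotv (g *m p) p = 0 /\ dotv (g *m p) (g1 *m p) = 0.
  have [||g gl gn] := esc [:: 1%:M; g0; g1; g1 *m g0] => //.
    by move=> z; rewrite !inE => /or4P[]/eqP ->.
  exists g => //; split.
    have [e|e|//] := sc g gl.
      by have := gn 1%:M; rewrite inE eqxx mul1mx e eqxx => /(_ isT).
    by have := gn g0; rewrite !inE eqxx !orbT g0p e eqxx => /(_ isT).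
  have [e|e|//] := rel g g1 gl g1l.
    by have := gn g1; rewrite !inE eqxx !orbT e eqxx => /(_ isT).
  by have := gn (g1 *m g0); rewrite !inE eqxx !orbT -mulmxA g0p mulmxN e eqxx => /(_ isT).
have up g : g \in l -> dotv (g *m p) (g *m p) = 1 by move=> gl; rewrite dotv_SO3 //; exact: KS.
have [h' h'S h'e] := SO3_frame hp.
pose y := h'^T *m (g1 *m p).
have y2 : y i2 0 = 0.
  by rewrite -dotv_bvec -e3_bvec /y dotv_mul trmxK h'e.
have hy : dotv y y = 1 by rewrite dotv_SO3 ?up //; exact: SO3_tr.
pose u : R[i] := (y i0 0 +i* y i1 0)%C.
have hu : cunit u by move: hy; rewrite /cunit /= dotvE y2 => <-; ring.
pose h := h' *m rot u.
have hS : SO3 h by apply: SO3_mul => //; exact: rot_SO3.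
have he2 : h *m bvec R i2 = p by rewrite -e3_bvec /h -mulmxA rot_e3.
have he0 : h *m bvec R i0 = g1 *m p.
  have ry (v : 'cV[R]_3) : v i2 0 = 0 -> rot (v i0 0 +i* v i1 0)%C *m bvec R i0 = v.
    by move=> v2; apply: vec3P; rewrite mulmx3 ?v2 !mxE -!val_eqE /=; ring.
  by rewrite /h -mulmxA ry // /y mulmxA (proj1 h'S) mul1mx.
clearbody h.
have hK (x : 'cV[R]_3) := SO3_KV x hS.
have hTK (x : 'cV[R]_3) := SO3_K x hS.
pose z := h^T *m (g2 *m p).
have zi i : z i 0 = dotv (g2 *m p) (h *m bvec R i).
  by rewrite -dotv_bvec /z dotv_mul trmxK.
have z2 : z i2 0 = 0 by rewrite zi he2.
have z0 : z i0 0 = 0 by rewrite zi he0.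
have hz : dotv z z = 1 by rewrite dotv_SO3 ?up //; exact: SO3_tr.
have z1 : sgn (z i1 0).
  move: hz; rewrite dotvE z0 z2 => e; have /eqP : z i1 0 ^+ 2 = 1 by rewrite -e; ring.
  by rewrite sqrf_eq1 => /orP[]/eqP ->; [left|right].
have he1 : g2 *m p = z i1 0 *: (h *m bvec R i1).
  rewrite scalemxAr -[LHS]hK -/z; congr (_ *m _).
  by apply: vec3P; rewrite ?z0 ?z2 !mxE -!val_eqE /= ?mulr0 ?mulr1.
have axes j : exists2 k, k \in l & exists2 s, sgn s & k *m p = s *: (h *m bvec R j).
  move: j; apply: forall3.
  - by exists g1 => //; exists 1; [left | rewrite scale1r he0].
  - by exists g2 => //; exists (z i1 0).
  - by exists 1%:M => //; exists 1; [left | rewrite scale1r he2 mul1mx].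
have hc2 (x : 'M[R]_3) := SO3_conjK x hS.
exists h => //; split.
- move=> j s hs; have [k kl [s' hs' ke]] := axes j.
  have [k' k'l k'e] : exists2 k', k' \in l & k' *m p = s *: (h *m bvec R j).
    have [e|e] : s' = s \/ s' = - s.
      by case: hs hs' => -> [->|->]; rewrite ?opprK; [left|right|right|left].
      by exists k => //; rewrite ke e.
    exists (k *m g0); first exact: (subgrpM KG kl g0l).
    by rewrite -mulmxA g0p mulmxN ke e scaleNr opprK.
  exists (h^T *m k' *m h).
    by rewrite hc2.
  by rewrite -!mulmxA he2 k'e -scalemxAr hTK.
- move=> g gl i; have [k kl [s hs ke]] := axes i.
  pose w := g *m bvec R i.
  have wE : h *m w = s *: ((h *m g *m h^T *m k) *m p).
    rewrite -!mulmxA ke -scalemxAr hTK -!scalemxAr scalerA -expr2 (sgn_sqr hs) scale1r //.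
  have gk := subgrpM KG gl kl.
  have hw : dotv w w = 1.
    by rewrite -(dotv_SO3 w w hS) wE dotvZl dotvZr up // mulr1 -expr2 sgn_sqr.
  have wj j : w j 0 = 0 \/ exists2 c, sgn c & w = c *: bvec R j.
    have [k' k'l [s' hs' ke']] := axes j.
    have ej : h *m bvec R j = s' *: (k' *m p) by rewrite ke' scalerA -expr2 (sgn_sqr hs') scale1r.
    have back c : sgn c -> (h *m g *m h^T *m k) *m p = c *: (k' *m p) -> exists2 c, sgn c & w = c *: bvec R j.
      move=> hc e; exists (s * c * s'); first by do 2!apply: sgn_mul => //.
      by rewrite -[w]hTK wE e ke' !scalerA -scalemxAr hTK.
    have [e|e|e] := rel _ k' gk k'l.
    + by right; apply: (back 1); [left | rewrite scale1r].
    + by right; apply: (back (-1)); [right | rewrite scaleN1r].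
    + by left; rewrite -dotv_bvec -(dotv_SO3 _ _ hS) wE ej dotvZl dotvZr e !mulr0.
  have [e0|[c hc e]] := wj i0; last by exists i0, c.
  have [e1|[c hc e]] := wj i1; last by exists i1, c.
  have [e2|[c hc e]] := wj i2; last by exists i2, c.
  by move: hw; rewrite dotvE e0 e1 e2 => hw; exfalso; clear -hw; lra.
pose P g := g *m p == p.
have [r fl] : exists r, perm_eq [seq g <- l | P g] [:: 1%:M; r].
  have uf : uniq [seq g <- l | P g] by rewrite filter_uniq.
  have : size [seq g <- l | P g] = 2%N by rewrite size_filter.
  have : 1%:M \in [seq g <- l | P g] by rewrite mem_filter /P mul1mx eqxx.
  case: [seq g <- l | P g] => [|a [|b [|]]] //; rewrite !inE => /orP[]/eqP -> _.
    by exists b.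
  by exists a; apply/seq.permP => f /=; rewrite !addn0 addnC.
have ur : uniq [:: 1%:M; r] by rewrite -(perm_uniq fl) filter_uniq.
have memf g : (g \in l) && P g = ((g == 1%:M) || (g == r)).
  by have := perm_mem fl g; rewrite mem_filter andbC !inE.
have : (r \in l) && P r by rewrite memf eqxx orbT.
case/andP => rl /eqP rp.
exists (h^T *m r *m h); split.
- by rewrite hc2.
- move: ur; rewrite /= inE andbT; apply: contra_neq => e.
  by rewrite -[r]hc2 e mulmx1 (proj1 hS).
- by rewrite -!mulmxA he2 rp -he2 hTK.
move=> g gl ge; have : (h *m g *m h^T \in l) && P (h *m g *m h^T).
  by rewrite gl /P -he2 -!mulmxA hTK ge eqxx.
by rewrite memf => /orP[]/eqP e; [left|right];
  rewrite -(SO3_conjKV g hS) e // mulmx1 SO3_trK.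
Qed.

End TetrahedralClass.

(** * Classification of isotropy groups in order 2n *)

Section Classification.
Variable R : realType.
Implicit Types (m n d : nat) (g h k : 'M[R]_3) (p : 'cV[R]_3).

Lemma subgrp_conj (K : 'M[R]_3 -> Prop) h : SO3 h -> subgrp K ->
  subgrp (fun g => K (h *m g *m h^T) /\ SO3 g).
Proof.
move=> hS KG; split=> [g [] //|| g k [Kg gS] [Kk kS]|g [Kg gS]].
- by split; [rewrite mulmx1 (proj1 hS); exact: subgrp1 | exact: SO3_1].
- split; last exact: SO3_mul.
  have -> : h *m (g *m k) *m h^T = (h *m g *m h^T) *m (h *m k *m h^T).
    by rewrite -!mulmxA SO3_K.
  exact: subgrpM.
- split; last exact: SO3_tr.
  have -> : h *m g^T *m h^T = (h *m g *m h^T)^T by rewrite !trmx_mul trmxK mulmxA.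
  exact: subgrpV.
Qed.

(** Groups other than [Zd d] are matched with a symmetric tensor at once. For [Zd d] the
    divisibility of the weights is kept along with the group, since the even-harmonic argument works
    on the coefficients. *)
Lemma isotropy_class n (t : tensor R (2 * n)) : (3 <= n)%N ->
  (exists2 h, SO3 h & exists2 s : tensor R (2 * n), Sspace s &
     forall g, isotropy s g <-> isotropy (gact h t) g) \/
  (exists2 h, SO3 h & exists2 d, (d <= 2 * n)%N &
     wt_dvd d (gact h t) /\ forall g, isotropy (gact h t) g <-> Zd d g).
Proof.
move=> n3; have [[p hp lp]|nl] := pselect (invline (isotropy t)).
  have [h hS he] := SO3_frame hp; have hT := SO3_tr hS.
  have [g|d dn [hZ|[k kS hD]]] := @isotropy_axial R _ (gact h^T t).
  - move/isotropy_conj => /(_ hT); rewrite trmxK => /lp.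
    rewrite -!mulmxA -he !(mulmxA h^T) SO3_trK // mul1mx.
    case=> /(congr1 (mulmx h^T)); rewrite mulmxA SO3_trK // mul1mx => ->; [left|right].
      by rewrite mulmxA SO3_trK // mul1mx.
    by rewrite mulmxN mulmxA SO3_trK // mul1mx.
  - by right; exists h^T => //; exists d.
  left; exists (k *m h^T); first exact: SO3_mul.
  have [s sS sD] := exists_Dd R n3 dn; exists s => // g.
  by rewrite gactM sD hD.
left; have [al|ns] := pselect (forall g, SO3 g -> isotropy t g).
  exists 1%:M; first exact: SO3_1.
  exists 0; first by move=> s _ i; rewrite !ffunE.
  move=> g; rewrite gact1; split=> [[gS _]|[gS _]]; first exact: al.
  by split=> //; rewrite actE gact0.
have [l [ul hl LG]] := isotropy_list nl ns.
have nll : ~ invline (fun g => g \in l) by apply: contra_not nl => /invline_sub; apply => g /hl.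
have [p [r [hp hr ty hn]]] := @finsub_pole R (Finsub LG) nll ul.
rewrite /= in hr ty hn.
have H1 : (size l = 24 /\ r = 4 \/ size l = 60 /\ r = 5)%N ->
    exists2 h, SO3 h & exists2 s : tensor R (2 * n), Sspace s &
     forall g, isotropy s g <-> isotropy (gact h t) g.
  move=> ty'; exists 1%:M; first exact: SO3_1.
  by rewrite gact1; exact: (octa_icosa_class n3 ul hl nl hp hr hn ty').
case: ty => ty; [|by apply: H1; left|by apply: H1; right].
case: ty => s12 r2; rewrite r2 in hr.
have [h hS [f1 f2 f3]] := tetra_frame ul LG nll hp s12 hr hn.
have hT := SO3_tr hS.
have KG := subgrp_conj hS LG.
have KE g : h *m g *m h^T \in l -> SO3 g.
  move=> gl; rewrite -(SO3_conjKV g hS); apply: SO3_conj => //.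
  exact: (subgrp_SO3 LG gl).
have [|||s sS sK] := @tetra_class R n _ n3 KG.
- by move=> j s hs; have [k Kk ke] := f1 j s hs; exists k => //; split=> //; exact: KE.
- by move=> g [Kg _]; exact: f2.
- have [r' [Kr r1 re st]] := f3; exists r'; split=> //; first by split=> //; exact: KE.
  by move=> g [Kg _]; exact: st.
exists h^T => //; exists s => // g; rewrite sK isotropy_conj // trmxK hl.
by split=> [[]//|gl]; split=> //; exact: KE.
Qed.

Lemma sym_classesP m (G : {set 'S_m}) (K : 'M[R]_3 -> Prop) :
  sym_classes (@tspace R m G) K <->
  exists2 t, tspace G t & forall g, K g <-> isotropy t g.
Proof.
split=> [[t [tV [h [hS hK]]]]|[t tV tK]].
  exists (gact h t); first exact: tspace_gact.
  by move=> g; rewrite hK SO3_inv // isotropy_conj.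
exists t; split=> //; exists 1%:M; split; first exact: SO3_1.
by move=> h; rewrite invmx1 mul1mx mulmx1.
Qed.

Lemma isotropy_gact_tr m (t s : tensor R m) h : SO3 h ->
  (forall g, isotropy s g <-> isotropy (gact h t) g) ->
  forall g, isotropy t g <-> isotropy (gact h^T s) g.
Proof.
move=> hS e g; rewrite isotropy_conj; last exact: SO3_tr.
rewrite e -isotropy_conj; last exact: SO3_tr.
by rewrite -gactM SO3_trK // gact1.
Qed.

End Classification.

(** * Orthogonal projection and the harmonic decomposition of symmetric tensors *)

Section HarmonicDecomposition.
Variable R : realType.
Implicit Types (m n k : nat) (g h : 'M[R]_3) (p : 'cV[R]_3).

Lemma tdotvv_eq0 m (t : tensor R m) : tdot t t = 0 -> t = 0.
Proof.
move/eqP; rewrite psumr_eq0 => [/allP h|i _]; last by rewrite -expr2 sqr_ge0.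
apply/ffunP => i; have := h i (mem_index_enum i); rewrite mulf_eq0 orbb ffunE.
by move/eqP.
Qed.

Definition subspace m (W : tensor R m -> Prop) := [/\ W 0,
  forall x y, W x -> W y -> W (x + y) & forall c x, W x -> W (tscale c x)].

Lemma subspace_sum m (W : tensor R m -> Prop) (I : Type) (r : seq I) (c : I -> R) (F : I -> tensor R m) :
  subspace W -> (forall i, W (F i)) -> W (\sum_(i <- r) tscale (c i) (F i)).
Proof.
case=> W0 WD WZ h; elim: r => [|i r IH]; first by rewrite big_nil.
by rewrite big_cons; apply: WD => //; exact: WZ.
Qed.

Lemma orth_family_le m k (e : 'I_k -> tensor R m) :
  (forall i, e i <> 0) -> (forall i j, i != j -> tdot (e i) (e j) = 0) ->
  (k <= #|{: m.-tuple 'I_3}|)%N.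
Proof.
move=> e0 eo; pose A := \matrix_(i < k, j < #|{: m.-tuple 'I_3}|) e i (enum_val j).
have AA : A *m A^T = \matrix_(i, j) (tdot (e i) (e i) *+ (i == j)).
  apply/matrixP => i j; rewrite !mxE.
  transitivity (tdot (e i) (e j)).
    rewrite /tdot (reindex (@enum_val _ {: m.-tuple 'I_3})) /=.
      by apply: eq_bigr => l _; rewrite !mxE.
    exact/onW_bij/enum_val_bij.
  by have [->|/eo ->] := eqVneq i j; rewrite ?mulr1n ?mulr0n.
have : \rank (A *m A^T) = k.
  apply/eqP; rewrite -/(row_free _) -kermx_eq0; apply/eqP/row_matrixP => r.
  rewrite row0; have : row r (kermx (A *m A^T)) *m (A *m A^T) = 0.
    by rewrite -row_mul mulmx_ker row0.
  move: (row r _) => v vA; apply/rowP => j; rewrite mxE.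
  have /rowP/(_ j) := vA; rewrite AA !mxE (bigD1 j) //= big1 => [|l /negbTE nl].
    rewrite mxE eqxx mulr1n addr0 => /eqP; rewrite mulf_eq0 => /orP[/eqP //|/eqP h].
    by case: (e0 j); exact: tdotvv_eq0.
  by rewrite mxE nl mulr0n mulr0.
by move <-; apply: leq_trans (mxrankM_maxl _ _) (rank_leq_col _).
Qed.

(** Gram-Schmidt for a subspace known only as a predicate: as long as projecting on an orthogonal
    family of W fails, some v in W gives a new member v - P v. [orth_family_le] bounds the size of
    the family, and N counts what is left. *)
Lemma orth_decomp m (W : tensor R m -> Prop) (t : tensor R m) : subspace W ->
  exists2 w, W w & forall v, W v -> tdot (t - w) v = 0.
Proof.
move=> sW; have [W0 WD WZ] := sW.
suff H N k (e : 'I_k -> tensor R m) : (k + N = #|{: m.-tuple 'I_3}|.+1)%N ->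
    (forall i, W (e i)) -> (forall i, e i <> 0) -> (forall i j, i != j -> tdot (e i) (e j) = 0) ->
    exists2 w, W w & forall v, W v -> tdot (t - w) v = 0.
  by apply: (H _ 0%N (fun=> 0)); [rewrite add0n | case | case | case].
elim: N k e => [|N IH] k e kN We e0 eo.
  by have := orth_family_le e0 eo; rewrite -ltnS -kN addn0 ltnn.
pose P (x : tensor R m) := \sum_(i < k) tscale (tdot x (e i) / tdot (e i) (e i)) (e i).
have WP x : W (P x) by exact: subspace_sum.
have Po x j : tdot (x - P x) (e j) = 0.
  rewrite tdotBl /P tdot_suml (bigD1 j) //= big1 => [|i nij]; last first.
    by rewrite tdotZl (eo i j nij) mulr0.
  rewrite tdotZl addr0 divfK ?subrr //; apply/eqP => h; apply: (e0 j); exact: tdotvv_eq0.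
have [all|] := pselect (forall v, W v -> tdot (t - P t) v = 0); first by exists (P t).
move=> /existsNP[v /not_implyP[Wv nv]].
pose v' := v - P v.
have PE x : tdot (t - P t) (P x) = 0.
  by rewrite tdotC tdot_suml big1 // => i _; rewrite tdotZl (tdotC _ (t - P t)) Po mulr0.
have Wv' : W v'.
  have -> : v' = v + tscale (-1) (P v) by apply/ffunP => i; rewrite !ffunE mulN1r.
  by apply: WD => //; exact: WZ.
have nv' : v' <> 0 by move=> h; apply: nv; rewrite -[v](subrK (P v)) -/v' h add0r PE.
pose e' (i : 'I_k.+1) := if unlift ord_max i is Some j then e j else v'.
have E1 j : e' (lift ord_max j) = e j by rewrite /e' liftK.
have E2 : e' ord_max = v' by rewrite /e' unlift_none.
apply: (IH k.+1 e').
- by rewrite addSnnS.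
- by move=> i; case: (unliftP ord_max i) => [j|] ->; rewrite ?E1 ?E2.
- by move=> i; case: (unliftP ord_max i) => [j|] ->; rewrite ?E1 ?E2.
move=> i j; case: (unliftP ord_max i) => [i'|] ->; case: (unliftP ord_max j) => [j'|] ->;
  rewrite ?E1 ?E2 ?eqxx //.
- by move=> n; apply: eo; apply: contra_neq n => ->.
- by rewrite tdotC Po.
- by rewrite Po.
Qed.

(** On forms this is multiplication by [dotv x x]; on symmetric tensors it is adjoint to
    [ttrace]. *)
Definition tdelta k (y : tensor R k) : tensor R k.+2 :=
  symt (\sum_(a < 3) tmulX a (tmulX a y)).

Definition ttrace k (x : tensor R k.+2) : tensor R k :=
  \sum_(a < 3) tcontr a (tcontr a x).

Lemma tdot_tdelta k (x : tensor R k.+2) (y : tensor R k) : Sspace x ->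
  tdot x (tdelta y) = tdot (ttrace x) y.
Proof.
move=> xS; rewrite -tdot_symt symt_id // tdotC !tdot_suml; apply: eq_bigr => a _.
by rewrite !tdot_tmulX tdotC.
Qed.

Lemma tdot_tdelta_pw k (y : tensor R k) p :
  tdot (tdelta y) (pw k.+2 p) = dotv p p * tdot y (pw k p).
Proof.
rewrite tdotC tdot_tdelta; last exact: Sspace_pw.
rewrite tdot_suml dotvE mulrDl mulrDl sum3.
have c a : tdot (tcontr a (tcontr a (pw k.+2 p))) y = p a 0 * p a 0 * tdot y (pw k p).
  rewrite tcontr_pw (_ : tcontr a (tscale _ _) = tscale (p a 0) (tcontr a (pw k.+1 p))).
    by rewrite tcontr_pw !tdotZl mulrA tdotC.
  by apply/ffunP => i; rewrite !ffunE.
by rewrite !c.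
Qed.

Lemma tdelta_gact k g (y : tensor R k) : SO3 g -> tdelta (gact g y) = gact g (tdelta y).
Proof.
move=> gS; apply/eqP; rewrite -subr_eq0; apply/eqP/polarization.
  by apply: tspaceB; [exact: symt_S | apply: tspace_gact; exact: symt_S].
move=> v; rewrite tdotBl !tdot_gact gact_pw !tdot_tdelta_pw tdot_gact gact_pw.
by rewrite dotv_SO3 ?subrr //; exact: SO3_tr.
Qed.

Lemma ttraceE k (x : tensor R k.+2) i :
  ttrace x i = \sum_(a < 3) x (cons_tuple a (cons_tuple a i)).
Proof. by rewrite sum_ffunE; apply: eq_bigr => a _; rewrite !ffunE. Qed.

Lemma ttrace_S k (x : tensor R k.+2) : Sspace x -> Sspace (ttrace x).
Proof.
move=> xS s _ i; rewrite !ttraceE; apply: eq_bigr => a _.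
apply: Sspace_perm_eq => //=; rewrite !perm_cons.
by apply/tuple_permP; exists s.
Qed.

Lemma harmonic_ttrace k (x : tensor R k.+2) :
  harmonic x <-> Sspace x /\ ttrace x = 0.
Proof.
split=> [[xS hx]|[xS tx]]; split=> //.
  apply/ffunP => i; rewrite ttraceE ffunE.
  rewrite -[RHS](hx ord0 (lift ord0 ord0) isT (cons_tuple i0 (cons_tuple i0 i))).
  apply: eq_bigr => a _; congr (x _); apply: eq_from_tnth => l; rewrite tnth_mktuple.
  by rewrite !(tnth_nth a); case: l => -[|[|l]].
move=> p q pq i.
pose r := [seq l <- enum 'I_k.+2 | (l != p) && (l != q)].
have pr : perm_eq (enum 'I_k.+2) [:: p, q & r].
  apply: uniq_perm; first exact: enum_uniq.
    by rewrite /= !inE !mem_filter !eqxx !andbF /= orbF pq filter_uniq ?enum_uniq.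
  move=> l; rewrite mem_enum !inE mem_filter ?mem_enum ?andbT.
  by case: (l == p); case: (l == q).
have sr : size [seq tnth i l | l <- r] == k.
  by rewrite size_map; have := perm_size pr; rewrite size_enum_ord /= => -[<-].
have /ffunP/(_ (Tuple sr)) := tx; rewrite ttraceE ffunE => t0; rewrite -[RHS]t0.
apply: eq_bigr => a _; apply: Sspace_perm_eq => //=.
apply: (perm_trans (perm_map (fun l => if (l == p) || (l == q) then a else tnth i l) pr)).
rewrite /= eqxx !eqxx orbT !perm_cons.
apply/permPl => P; rewrite (_ : map _ r = [seq tnth i l | l <- r]) //.
apply/eq_in_map => l; rewrite mem_filter => /andP[/andP[/negbTE -> /negbTE ->] _].
by [].
Qed.

Lemma harmonic_perp k (x : tensor R k.+2) :
  harmonic x <-> Sspace x /\ forall y, Sspace y -> tdot x (tdelta y) = 0.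
Proof.
rewrite harmonic_ttrace; split=> -[xS h]; split=> //.
  by move=> y yS; rewrite tdot_tdelta // h tdot0l.
by apply: tdotvv_eq0; rewrite -tdot_tdelta // h //; exact: ttrace_S.
Qed.

Lemma harmonic1 (x : tensor R 1) : harmonic x <-> Sspace x.
Proof. by split=> [[]|xS] //; split=> // p q; rewrite !ord1 eqxx. Qed.

Lemma harmonic_gact k g (x : tensor R k.+1) : SO3 g -> harmonic x -> harmonic (gact g x).
Proof.
move=> gS; case: k x => [|k] x.
  by move=> /harmonic1 xS; apply/harmonic1; exact: tspace_gact.
move=> /harmonic_perp[xS h]; apply/harmonic_perp; split; first exact: tspace_gact.
move=> y yS; rewrite tdot_gact -tdelta_gact ?h //; first exact: tspace_gact.
exact: SO3_tr.
Qed.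

Lemma harmonic_subspace k : subspace (@harmonic R k).
Proof.
split=> [|x y [xS hx] [yS hy]|c x [xS hx]]; split.
- by move=> s _ i; rewrite !ffunE.
- by move=> p q pq i; rewrite big1 // => a _; rewrite ffunE.
- exact: tspaceD.
- move=> p q pq i; under eq_bigr => a _ do rewrite ffunE.
  by rewrite big_split /= hx // hy // addr0.
- exact: tspaceZ.
- move=> p q pq i; under eq_bigr => a _ do rewrite ffunE.
  by rewrite -mulr_sumr hx // mulr0.
Qed.

Lemma tdeltaD k (x y : tensor R k) : tdelta (x + y) = tdelta x + tdelta y.
Proof.
rewrite /tdelta -/(symt _) /symt -gavgD; congr gavg; rewrite -big_split.
by apply: eq_bigr => a _; apply/ffunP => i; rewrite !ffunE -!mulrDr.
Qed.

Lemma tdelta0 k : tdelta (0 : tensor R k) = 0.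
Proof. by apply: (@addrI _ (tdelta (0 : tensor R k))); rewrite -tdeltaD !addr0. Qed.

Lemma tdeltaZ k c (x : tensor R k) : tdelta (tscale c x) = tscale c (tdelta x).
Proof.
rewrite /tdelta /symt -gavgZ; congr gavg.
apply/ffunP => i; rewrite !(ffunE, sum_ffunE) mulr_sumr.
by apply: eq_bigr => a _; rewrite !ffunE; ring.
Qed.

Lemma harmonic_split k (x : tensor R k.+2) : Sspace x ->
  exists (h : tensor R k.+2) (y : tensor R k), [/\ harmonic h, Sspace y & x = h + tdelta y].
Proof.
move=> xS; pose W := fun w => exists2 y, Sspace y & w = tdelta y :> tensor R k.+2.
have [|w [y yS ->] hw] := @orth_decomp _ W x.
  split=> [|_ _ [y yS ->] [z zS ->]|c _ [y yS ->]].
  - exists 0; first by move=> s _ i; rewrite !ffunE.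
    by rewrite tdelta0.
  - by exists (y + z); [exact: tspaceD | rewrite tdeltaD].
  - by exists (tscale c y); [exact: tspaceZ | rewrite tdeltaZ].
exists (x - tdelta y), y; split=> //; last by rewrite subrK.
apply/harmonic_perp; split; first by apply: tspaceB => //; exact: symt_S.
by move=> z zS; apply: hw; exists z.
Qed.

(** Extends the hypothesis from H^k to S^k. By [harmonic_split] a symmetric tensor is harmonic plus
    a [tdelta]; f kills the harmonic part, and f composed with [tdelta] is an equivariant map from
    degree k - 2, of the same parity. *)
Lemma even_harmonic_S n (G : {set 'S_(2 * n)}) : even_harmonic (@tspace R (2 * n) G) ->
  forall k, odd k -> (k < 2 * n)%N -> forall f : tensor R k -> tensor R (2 * n),
    (forall x y, f (x + y) = f x + f y) -> (forall c x, f (tscale c x) = tscale c (f x)) ->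
    (forall x, Sspace x -> tspace G (f x)) ->
    (forall g x, SO3 g -> Sspace x -> f (gact g x) = gact g (f x)) ->
    forall x, Sspace x -> f x = 0.
Proof.
move=> eh; elim/ltn_ind => k IH ok kn f fD fZ fV fg x xS.
have harm (h : tensor R k) : harmonic h -> f h = 0.
  have kE : k = (2 * k./2).+1 by rewrite mul2n -[LHS]odd_double_half ok.
  have := eh k./2; rewrite -kE => /(_ _ f) ehk; apply: ehk => //.
  - by lia.
  - by move=> y [yS _]; exact: fV.
  - by move=> g y gS [yS _]; exact: fg.
case: k IH ok kn f fD fZ fV fg x xS harm => [|[|k]] // IH ok kn f fD fZ fV fg x xS harm.
  by apply/harm/harmonic1.
have [h [y [hh yS ->]]] := harmonic_split xS; rewrite fD harm // add0r.
have k2 : (k < k.+2)%N by [].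
have ok' : odd k by move: ok; rewrite /= ?negbK.
have kn' : (k < 2 * n)%N by lia.
suff H x' : Sspace x' -> (f \o @tdelta k) x' = 0 by exact: H.
move: x'; apply: IH => //=.
- by move=> a b; rewrite tdeltaD fD.
- by move=> c a; rewrite tdeltaZ fZ.
- by move=> a _; apply: fV; exact: symt_S.
- by move=> g a gS _; rewrite tdelta_gact // fg //; exact: symt_S.
Qed.

End HarmonicDecomposition.

(** * A chiral tensor from an odd harmonic component *)

Section ChiralTensors.
Variable R : realType.
Implicit Types (m n k : nat) (g h : 'M[R]_3) (p : 'cV[R]_3).

Lemma pw_scale m c p : pw m (c *: p) = tscale (c ^+ m) (pw m p) :> tensor R m.
Proof.
apply/ffunP => i; rewrite !ffunE; under eq_bigr => l _ do rewrite mxE.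
by rewrite big_split /= prodr_const card_ord.
Qed.

Lemma tscale1 m (x : tensor R m) : tscale 1 x = x.
Proof. by apply/ffunP => i; rewrite ffunE mul1r. Qed.

Lemma tscaleN1 m (x : tensor R m) : tscale (-1) x = - x.
Proof. by apply/ffunP => i; rewrite !ffunE mulN1r. Qed.

(** Take a nonzero equivariant f on H^k with k odd, and let w be the harmonic projection of the k-th
    power of e3, the zonal harmonic. Uniqueness of the projection makes w invariant under rotations
    about e3 and multiplied by (-1)^k = -1 when e3 is reversed. If f w were 0, f would vanish on the
    projections of all powers, which span H^k. *)
Lemma exists_chiral n (G : {set 'S_(2 * n)}) : ~ even_harmonic (@tspace R (2 * n) G) ->
  exists s : tensor R (2 * n), [/\ tspace G s, s <> 0,
    forall g, SO3 g -> g *m e3 R = e3 R -> gact g s = s &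
    forall g, SO3 g -> g *m e3 R = - e3 R -> gact g s = - s].
Proof.
move=> /existsNP[q /not_implyP[qn /existsNP[f]]].
set k := (2 * q).+1 in f *.
move=> /not_implyP[fD /not_implyP[fZ /not_implyP[fV /not_implyP[fg /existsNP[x0 /not_implyP[hx0 fx0]]]]]].
have fZ' c (x : tensor R k) : f (tscale c x) = tscale c (f x) by exact: fZ.
have [H0 HD HZ] := harmonic_subspace R k.
have HB (x y : tensor R k) : harmonic x -> harmonic y -> harmonic (x - y).
  by move=> hx hy; rewrite -tscaleN1; apply: HD => //; exact: HZ.
have f0 : f 0 = 0 by apply: (@addrI _ (f 0)); rewrite -fD !addr0.
have dec p : exists2 w, harmonic w & forall v, harmonic v -> tdot (pw k p - w) v = 0.
  exact: orth_decomp (harmonic_subspace R k).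
have uniq p w w' : harmonic w -> harmonic w' ->
    (forall v, harmonic v -> tdot (pw k p - w) v = 0) ->
    (forall v, harmonic v -> tdot (pw k p - w') v = 0) -> w = w'.
  move=> hw hw' h h'; apply/eqP; rewrite -subr_eq0; apply/eqP/tdotvv_eq0.
  have hd := HB _ _ hw hw'.
  have -> : tdot (w - w') (w - w') = tdot (pw k p - w') (w - w') - tdot (pw k p - w) (w - w').
    by rewrite -tdotBl; congr tdot; apply/ffunP => i; rewrite !ffunE; ring.
  by rewrite h // h' // subrr.
have [w hw wo] := dec (e3 R).
have wg g c : SO3 g -> g *m e3 R = c *: e3 R -> gact g w = tscale (c ^+ k) w.
  move=> gS ge; apply: (uniq (c *: e3 R)).
  - exact: harmonic_gact.
  - exact: HZ.
  - move=> v hv; rewrite -ge -gact_pw -gactB tdot_gact wo //.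
    by apply: harmonic_gact => //; exact: SO3_tr.
  move=> v hv; rewrite pw_scale.
  have -> : tscale (c ^+ k) (pw k (e3 R)) - tscale (c ^+ k) w = tscale (c ^+ k) (pw k (e3 R) - w).
    by apply/ffunP => i; rewrite !ffunE mulrBr.
  by rewrite tdotZl wo // mulr0.
exists (f w); split.
- exact: fV.
- move=> fw.
  have fxi p v : harmonic v -> (forall v', harmonic v' -> tdot (pw k p - v) v' = 0) -> f v = 0.
    move=> hv vo; have [p0|p0] := eqVneq p 0.
      have -> : v = 0; last exact: f0.
      apply: (uniq p) => // v' _.
      have -> : pw k p = 0 by rewrite p0 -(scale0r 0) pw_scale expr0n; apply/ffunP => i; rewrite !ffunE mul0r.
      by rewrite subr0 tdot0l.
    have [c [c0 hc]] := unit_scale p0.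
    have [g gS ge] := SO3_frame hc.
    have vE : tscale (c ^+ k) v = gact g w.
      apply: (uniq (c *: p)).
      - exact: HZ.
      - exact: harmonic_gact.
      - move=> v' hv'; rewrite pw_scale.
        have -> : tscale (c ^+ k) (pw k p) - tscale (c ^+ k) v = tscale (c ^+ k) (pw k p - v).
          by apply/ffunP => i; rewrite !ffunE mulrBr.
        by rewrite tdotZl vo // mulr0.
      move=> v' hv'; rewrite -ge -gact_pw -gactB tdot_gact wo //.
      by apply: harmonic_gact => //; exact: SO3_tr.
    have : tscale (c ^+ k) (f v) = 0.
      by rewrite -fZ' vE -actE fg // fw actE gact0.
    move=> /ffunP e; apply/ffunP => i; have := e i; rewrite !ffunE => /eqP.
    by rewrite mulf_eq0 expf_eq0 (negbTE c0) andbF => /eqP.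
  (* Subtracting from x0 its projection on the kernel of f leaves a harmonic tensor orthogonal to
     the projections of all powers, hence zero by polarization. *)
  have [y [hy fy] yo] : exists2 y, harmonic y /\ f y = 0 &
      forall v, harmonic v /\ f v = 0 -> tdot (x0 - y) v = 0.
    apply: (@orth_decomp R k (fun v => harmonic v /\ f v = 0) x0); split=> //.
      by move=> a b [ha fa] [hb fb]; split; [exact: HD | rewrite fD fa fb addr0].
    move=> c a [ha fa]; split; first exact: HZ.
    by rewrite fZ' fa; apply/ffunP => i; rewrite !ffunE mulr0.
  have z0 : x0 - y = 0.
    have hz := HB _ _ hx0 hy; apply: polarization; first by case: hz.
    move=> p; have [v hv vo] := dec p.
    rewrite -(subrK v (pw k p)) tdotDr [X in X + _]tdotC vo // add0r yo //.
    by split=> //; exact: fxi vo.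
  by apply: fx0; rewrite -(subrK y x0) z0 add0r.
- move=> g gS ge; rewrite -actE -fg // actE (wg g 1) ?scale1r // expr1n.
  by rewrite tscale1.
- move=> g gS ge; rewrite -actE -fg // actE (wg g (-1)) ?scaleN1r //.
  have -> : (-1 : R) ^+ k = -1 by rewrite -signr_odd /k /= oddM.
  by rewrite fZ' tscaleN1.
Qed.

(** The flip of v is obtained from -v by a rotation about e3. In even degree the form of s thus
    takes equal values at v and at its flip, while the hypothesis makes them opposite. *)
Lemma symt_chiral m (s : tensor R m) : ~~ odd m ->
  (forall g, SO3 g -> g *m e3 R = e3 R -> gact g s = s) ->
  gact (flip R) s = - s -> symt s = 0.
Proof.
move=> om sr sf; apply: polarization; first exact: symt_S.
move=> v; rewrite tdot_symt_pw.
have fT : (flip R)^T = flip R by mat3_tac.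
have h1 : tdot s (pw m (flip R *m v)) = - tdot s (pw m v).
  rewrite -gact_pw tdotC tdot_gact fT sf -tscaleN1 tdotZr mulN1r tdotC.
  by [].
have [r [u [_ hu a b _]]] := cunit_polar (v i0 0) (v i1 0).
pose w := - (conjc u * conjc u).
have hw : cunit w.
  by have /cunitE h := cunitM (cunitJ hu) (cunitJ hu); apply/cunitE; rewrite /w rmorphN mulrNN.
have E : flip R *m v = rot w *m (- v).
  apply: vec3P; rewrite !mulmx3 !mxE /w /= ?a ?b; case: (u) hu => c d; rewrite /cunit /= => hu.
  - transitivity (r * c * (c ^+ 2 + d ^+ 2)); [rewrite hu; ring | ring].
  - transitivity (- r * d * (c ^+ 2 + d ^+ 2)); [rewrite hu; ring | ring].
  - by ring.
have h2 : tdot s (pw m (flip R *m v)) = tdot s (pw m v).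
  rewrite E -gact_pw tdotC tdot_gact sr; last 2 first.
  - exact/SO3_tr/rot_SO3.
  - by rewrite rot_tr rot_e3.
  by rewrite -scaleN1r pw_scale -signr_odd (negbTE om) expr0 tscale1 tdotC.
by move: h1; rewrite h2 => e; lra.
Qed.

(* The symmetric part pins the isotropy group down to a dihedral group, and
   the chiral part removes the flips from it. *)
Lemma chiral_Zd n (G : {set 'S_(2 * n)}) d : (3 <= n)%N -> (d <= 2 * n)%N ->
  ~ even_harmonic (@tspace R (2 * n) G) ->
  exists2 t : tensor R (2 * n), tspace G t & forall g, isotropy t g <-> Zd d g.
Proof.
move=> n3 dn /exists_chiral[s0 [s0G s0n s0r s0f]].
have [s sS sI] := exists_Dd R n3 dn.
have sy0 : symt s0 = 0.
  apply: symt_chiral => //; first by rewrite mul2n odd_double.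
  by apply: s0f; [exact: flip_SO3 | exact: flip_e3].
have sy : symt (s0 + s) = s by rewrite /symt gavgD -/(symt s0) sy0 add0r; exact: symt_id.
exists (s0 + s); first by apply: tspaceD => //; exact: Sspace_sub.
move=> g; split=> [[gS gt]|[u hu [ud ->]]].
  have gs : isotropy s g by split=> //; rewrite -{1}sy actE -gavg_gact -actE gt.
  case/sI: gs => // -[u hu [ud gE]]; exfalso; apply: s0n.
  have [_ gs] : isotropy s g by apply/sI; right; exists u.
  have ge : g *m e3 R = - e3 R by rewrite gE -mulmxA flip_e3 mulmxN rot_e3.
  move: gt; rewrite actE gactD s0f // -[gact g s]actE gs => /addIr /ffunP e.
  by apply/ffunP => i; have := e i; rewrite !ffunE => h; lra.
have [uS us] : isotropy s (rot u) by apply/sI; left; exists u.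
split=> //; rewrite actE gactD s0r ?rot_e3 //.
by rewrite -[gact _ s]actE us.
Qed.

End ChiralTensors.

(** * Polynomial dependence of rotated tensors on the image of e3 *)

Section PolynomialOrbit.
Variable R : realType.
Local Notation C := R[i].
Local Notation Re := complex.Re.
Local Notation Im := complex.Im.
Implicit Types (m n k : nat) (g h : 'M[R]_3) (x p : 'cV[R]_3).

(** Forms of degree m - 1 on the sphere, where degree -1 leaves only zero. *)
Definition sform_pred m (P : 'cV[R]_3 -> R) : Prop :=
  if m is m'.+1 then sform m' P else forall x, dotv x x = 1 -> P x = 0.

(* On the unit sphere, [P] is a form of degree m plus a form of degree m - 1. *)
Definition biform m (P : 'cV[R]_3 -> R) := exists A B,
  [/\ sform m A, sform_pred m B & forall x, dotv x x = 1 -> P x = A x + B x].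

Lemma sform_predD m (P Q : 'cV[R]_3 -> R) : sform_pred m P -> sform_pred m Q ->
  sform_pred m (fun x => P x + Q x).
Proof.
case: m => [hP hQ x hx|m]; last exact: sformD.
by rewrite hP // hQ // addr0.
Qed.

Lemma sform_predZ m c (P : 'cV[R]_3 -> R) : sform_pred m P ->
  sform_pred m (fun x => c * P x).
Proof. by case: m => [hP x hx|m]; [rewrite hP // mulr0 | exact: sformZ]. Qed.

Lemma sform_pred_mulX m i (P : 'cV[R]_3 -> R) : sform_pred m P ->
  sform m (fun x => x i 0 * P x).
Proof.
case: m => [hP|m]; last exact: sform_mulX.
by apply: sform_ext (sform0 _ _) => x hx; rewrite hP // mulr0.
Qed.

Lemma biformD m (P Q : 'cV[R]_3 -> R) : biform m P -> biform m Q ->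
  biform m (fun x => P x + Q x).
Proof.
move=> [A [B [hA hB e]]] [A' [B' [hA' hB' e']]].
exists (fun x => A x + A' x), (fun x => B x + B' x).
by split; [exact: sformD | exact: sform_predD | move=> x hx; rewrite e // e' // addrACA].
Qed.

Lemma biformZ m c (P : 'cV[R]_3 -> R) : biform m P -> biform m (fun x => c * P x).
Proof.
move=> [A [B [hA hB e]]]; exists (fun x => c * A x), (fun x => c * B x).
by split; [exact: sformZ | exact: sform_predZ | move=> x hx; rewrite e // mulrDr].
Qed.

Lemma biform_ext m (P Q : 'cV[R]_3 -> R) : (forall x, dotv x x = 1 -> P x = Q x) ->
  biform m P -> biform m Q.
Proof.
by move=> e [A [B [hA hB e']]]; exists A, B; split=> // x hx; rewrite -e // e'.
Qed.

Lemma biform0 m : biform m (fun _ => 0).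
Proof.
exists (fun _ => 0), (fun _ => 0); split=> [||x _]; [exact: sform0 | | by rewrite addr0].
by case: m => [|m] //; exact: sform0.
Qed.

Lemma biform_mulX m i (P : 'cV[R]_3 -> R) : biform m P ->
  biform m.+1 (fun x => x i 0 * P x).
Proof.
move=> [A [B [hA hB e]]]; exists (fun x => x i 0 * A x), (fun x => x i 0 * B x).
by split; [exact: sform_mulX | exact: sform_pred_mulX | move=> x hx; rewrite e // mulrDr].
Qed.

Lemma biform_pad m (P : 'cV[R]_3 -> R) : biform m P -> biform m.+2 P.
Proof.
move=> [A [B [hA hB e]]]; exists A, B; split=> //.
  by have := sform_pad 1 hA; rewrite addn2.
case: m hB {hA} => [|m] hB; last by have := sform_pad 1 hB; rewrite addn2.
by apply: (@sform_ext R 1 (fun _ => 0)) (sform0 _ _) => x hx; rewrite hB.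
Qed.

(* The degree drops by one less than the number of slots consumed: this is
   the odd part of the pairing of a slot e+ with a slot e-. *)
Lemma biform_lift m i (P : 'cV[R]_3 -> R) : biform m P ->
  biform m.+2 (fun x => x i 0 * P x).
Proof.
move=> [A [B [hA hB e]]]; exists (fun x => x i 0 * B x), (fun x => x i 0 * A x); split.
- by have := sform_pad 1 (sform_pred_mulX i hB); rewrite addn2.
- exact: sform_mulX.
- by move=> x hx; rewrite e // mulrDr addrC.
Qed.

Definition cbiform m (P : 'cV[R]_3 -> C) :=
  biform m (fun x => Re (P x)) /\ biform m (fun x => Im (P x)).

Lemma cbiformD m (P Q : 'cV[R]_3 -> C) : cbiform m P -> cbiform m Q ->
  cbiform m (fun x => P x + Q x).
Proof.
move=> [h1 h2] [k1 k2]; split.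
  by apply: biform_ext (biformD h1 k1) => x _; rewrite ReD.
by apply: biform_ext (biformD h2 k2) => x _; case: (P x) (Q x) => [? ?] [? ?].
Qed.

Lemma cbiformZ m (c : C) (P : 'cV[R]_3 -> C) : cbiform m P ->
  cbiform m (fun x => c * P x).
Proof.
move=> [h1 h2]; split.
  apply: biform_ext (biformD (biformZ (Re c) h1) (biformZ (- Im c) h2)) => x _.
  by case: c (P x) => [a b] [a' b'] /=; ring.
apply: biform_ext (biformD (biformZ (Re c) h2) (biformZ (Im c) h1)) => x _.
by case: c (P x) => [a b] [a' b'] /=; ring.
Qed.

Lemma cbiform0 m : cbiform m (fun _ => 0).
Proof. by split; exact: biform0. Qed.

Lemma cbiform_sum m (I : Type) (r : seq I) (F : I -> 'cV[R]_3 -> C) :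
  (forall i, cbiform m (F i)) -> cbiform m (fun x => \sum_(i <- r) F i x).
Proof.
move=> h; elim: r => [|i r IH].
  have [h1 h2] := cbiform0 m.
  by split; [apply: biform_ext h1 | apply: biform_ext h2] => x _; rewrite big_nil.
have [h1 h2] := cbiformD (h i) IH.
by split; [apply: biform_ext h1 | apply: biform_ext h2] => x _; rewrite big_cons.
Qed.

Lemma cbiform_ext m (P Q : 'cV[R]_3 -> C) : (forall x, dotv x x = 1 -> P x = Q x) ->
  cbiform m P -> cbiform m Q.
Proof.
by move=> e [h1 h2]; split; [apply: biform_ext h1 | apply: biform_ext h2] => x hx; rewrite e.
Qed.

Lemma cbiform_real m m' (P : 'cV[R]_3 -> C) (f : 'cV[R]_3 -> R) :
  (forall Q, biform m Q -> biform m' (fun x => f x * Q x)) ->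
  cbiform m P -> cbiform m' (fun x => ((f x)%:C)%C * P x).
Proof.
move=> h [/h h1 /h h2]; split; [apply: biform_ext h1 | apply: biform_ext h2] => x _;
  by case: (P x) => a b /=; ring.
Qed.

Definition crossm x : 'M[R]_3 := mat3
  [:: [:: 0; x i2 0; - x i1 0]; [:: - x i2 0; 0; x i0 0]; [:: x i1 0; - x i0 0; 0]].

(** The entries of 1 - x x^T plus i times a cross-product matrix. By [frame_pair] they are the
    products of a coordinate of g (e1 - i e2) with one of g (e1 + i e2), and depend on g only
    through x = g e3. *)
Definition pairfn (a b : 'I_3) x : C :=
  ((((a == b)%:R - x a 0 * x b 0)%:C)%C + 'i%C * ((crossm x a b)%:C)%C).

Lemma cbiform_pair m a b (P : 'cV[R]_3 -> C) : cbiform m P ->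
  cbiform m.+2 (fun x => pairfn a b x * P x).
Proof.
move=> hP.
have h1 : cbiform m.+2 (fun x => (((a == b)%:R - x a 0 * x b 0)%:C)%C * P x).
  apply: (cbiform_real (f := fun x => (a == b)%:R - x a 0 * x b 0)) hP => Q hQ.
  apply: biform_ext (biformD (biformZ (a == b)%:R (biform_pad hQ))
    (biformZ (-1) (biform_mulX a (biform_mulX b hQ)))) => x _; ring.
have h2 : cbiform m.+2 (fun x => ((crossm x a b)%:C)%C * P x).
  apply: (cbiform_real (f := fun x => crossm x a b)) hP => Q hQ.
  have hl i := biform_lift i hQ.
  move: a b {h1}; apply: forall3; apply: forall3;
  first [ by apply: biform_ext (biform0 _) => x _; rewrite mxE /=; ring
    | by apply: biform_ext (hl i0) => x _; rewrite mxE /=; ring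
    | by apply: biform_ext (hl i1) => x _; rewrite mxE /=; ring
    | by apply: biform_ext (hl i2) => x _; rewrite mxE /=; ring
    | by apply: biform_ext (biformZ (-1) (hl i0)) => x _; rewrite mxE /=; ring
    | by apply: biform_ext (biformZ (-1) (hl i1)) => x _; rewrite mxE /=; ring
    | by apply: biform_ext (biformZ (-1) (hl i2)) => x _; rewrite mxE /=; ring ].
apply: cbiform_ext (cbiformD h1 (cbiformZ 'i%C h2)) => x _.
by rewrite /pairfn mulrDl mulrA.
Qed.

Definition frame g : 'M[C]_3 := cmx g *m Eb R.

Lemma frameE g a : [/\ frame g a i0 = (g a i0 -i* g a i1)%C,
  frame g a i1 = (g a i0 +i* g a i1)%C & frame g a i2 = (((g *m e3 R) a 0)%:C)%C].
Proof.
by split; rewrite /frame mulmx33 ?mulmx3 !mxE /=; apply/eqP; rewrite eq_complex /=;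
  apply/andP; split; apply/eqP; ring.
Qed.

Lemma frame_pair g a b : SO3 g -> frame g a i0 * frame g b i1 = pairfn a b (g *m e3 R).
Proof.
move=> gS; have [-> _ _] := frameE g a; have [_ -> _] := frameE g b.
have e i : (g *m e3 R) i 0 = g i i2 by rewrite mulmx3 !mxE /=; ring.
have hd : g a i0 * g b i0 + g a i1 * g b i1 = (a == b)%:R - g a i2 * g b i2.
  have := proj1 gS => /matrixP/(_ a b); rewrite mulmx33 !mxE => <-; ring.
have hc : g a i0 * g b i1 - g a i1 * g b i0 = crossm (g *m e3 R) a b.
  have gT := SO3_trK gS.
  (* A rotation equals its cofactor matrix, so its third column is the cross product of the first
     two. *)
  have adj : \adj g = g^T.
    have := mul_mx_adj g; rewrite (proj2 gS) => h.
    by rewrite -[\adj g]mul1mx -gT -mulmxA h mulmx1.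
  have co i : g i i2 = cofactor g i i2 by have /matrixP/(_ i2 i) := adj; rewrite !mxE.
  have [h0 h1 h2] : [/\ g i0 i2 = g i1 i0 * g i2 i1 - g i1 i1 * g i2 i0,
      g i1 i2 = g i2 i0 * g i0 i1 - g i2 i1 * g i0 i0 &
      g i2 i2 = g i0 i0 * g i1 i1 - g i0 i1 * g i1 i0].
    pose f (c d : nat) := g (inord c) (inord d).
    have fE (c d : 'I_3) : g c d = f c d by rewrite /f !inord_val.
    split; rewrite co /cofactor (expand_det_row _ ord0) !big_ord_recl !big_ord0 /cofactor
      !det_mx11 !mxE !fE /= /bump /= !(addr0, add0n, addn0, expr0, expr1, expr2, mul1r); ring.
  clear hd; move: a b; apply: forall3; apply: forall3; rewrite mxE /= ?e ?h0 ?h1 ?h2; ring.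
rewrite /pairfn -hc !e -hd; apply/eqP; rewrite eq_complex /=.
by apply/andP; split; apply/eqP; ring.
Qed.

(** Slots e+ and e- are equally many and cancel in pairs through [pairfn], each pair costing degree
    two; each remaining slot is e3 and contributes one coordinate of g e3. *)
Lemma frame_product (l : seq ('I_3 * 'I_3)) :
  count (fun q => q.2 == i0) l = count (fun q => q.2 == i1) l ->
  exists2 P, cbiform (size l) P &
    forall g, SO3 g -> \prod_(q <- l) frame g q.1 q.2 = P (g *m e3 R).
Proof.
have [N] := ubnP (size l); elim: N l => // N IH l; rewrite ltnS => sN cl.
have [hp|np] := boolP (has (fun q => q.2 == i0) l).
  have hm : has (fun q => q.2 == i1) l by rewrite has_count -cl -has_count.
  have [[a a'] al /= /eqP ea] := hasP hp; have [[b b'] bl /= /eqP eb] := hasP hm.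
  rewrite {}ea in al; rewrite {}eb in bl.
  have p1 := perm_to_rem al.
  have bl' : (b, i1) \in rem (a, i0) l.
    by have := perm_mem p1 (b, i1); rewrite bl inE => /esym /orP[/eqP []|].
  have p2 := perm_to_rem bl'; set l' := rem _ (rem _ l) in p2.
  have p : perm_eq l [:: (a, i0), (b, i1) & l'].
    by apply: perm_trans p1 _; rewrite perm_cons.
  have sl := perm_size p; rewrite /= in sl.
  have cl' : count (fun q => q.2 == i0) l' = count (fun q => q.2 == i1) l'.
    by move: cl; rewrite !(seq.permP p) /= => -[].
  have [|P hP PE] := IH l' _ cl'; first by rewrite sl in sN; lia.
  exists (fun x => pairfn a b x * P x); first by rewrite sl; exact: cbiform_pair.
  move=> g gS; rewrite (perm_big _ p) !big_cons /= mulrA frame_pair // PE //.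
have nm : ~~ has (fun q => q.2 == i1) l by rewrite has_count -cl -has_count.
move: np nm; clear; elim: l => [|[a b] l IH] /=.
  move=> _ _; exists (fun _ => 1); last by move=> g _; rewrite big_nil.
  split; last by apply: biform_ext (biform0 _).
  exists (fun _ => 1), (fun _ => 0); split=> // [|x _]; last by rewrite addr0.
  by exists (fun _ => 1) => //; exact: form_const.
rewrite !negb_or => /andP[b0 np] /andP[b1 nm]; have [P hP PE] := IH np nm.
exists (fun x => ((x a 0)%:C)%C * P x).
  by apply: (cbiform_real (f := fun x => x a 0)) hP => Q; exact: biform_mulX.
move=> g gS; rewrite big_cons PE //=; congr (_ * _).
have -> : b = i2 by move: b b0 b1; apply: forall3.
by have [_ _ ->] := frameE g a.
Qed.

End PolynomialOrbit.

(** * Flip-invariance of weight-0 tensors in the even-harmonic case *)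

Section EvenHarmonicFlips.
Variable R : realType.
Local Notation C := R[i].
Local Notation Re := complex.Re.
Local Notation ctensor m := {ffun m.-tuple 'I_3 -> C}.
Implicit Types (m n : nat) (g h : 'M[R]_3) (p : 'cV[R]_3).

Definition npl m (J : m.-tuple 'I_3) : nat := count (fun a => a == i0) J.
Definition nmi m (J : m.-tuple 'I_3) : nat := count (fun a => a == i1) J.

Lemma n3E m (J : m.-tuple 'I_3) : n3 J = count (fun a => a == i2) J.
Proof.
rewrite /n3 -(big_tuple _ _ J predT (fun a => (a == i2) : nat)) /=.
by elim: (val J) => [|a l IH]; rewrite ?big_nil // big_cons IH.
Qed.

Lemma slots_count m (J : m.-tuple 'I_3) : (npl J + nmi J + n3 J = m)%N.
Proof.
rewrite n3E -[RHS](size_tuple J) /npl /nmi; elim: (val J) => [|a l IH] //=.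
rewrite -IH; have : ((a == i0) + (a == i1) + (a == i2) = 1)%N by move: a; apply: forall3.
move: (nat_of_bool (a == i0)) (nat_of_bool (a == i1)) (nat_of_bool (a == i2)) => x y z.
move: (count _ l) (count _ l) (count _ l) => c0 c1 c2; clear.
by lia.
Qed.

Lemma wtE m (J : m.-tuple 'I_3) : wt J = (npl J)%:Z - (nmi J)%:Z.
Proof.
rewrite /wt -(big_tuple _ _ J predT wgt) /npl /nmi.
elim: (val J) => [|a l IH]; first by rewrite big_nil.
have wa : wgt a = (a == i0)%:Z - (a == i1)%:Z by move: a; apply: forall3.
by rewrite big_cons IH /= wa !PoszD; ring.
Qed.

Lemma cf_realE m g (t : tensor R m) i :
  ((gact g t i)%:C)%C =
  \sum_J cf (ctens t) J * \prod_(k < m) frame g (tnth i k) (tnth J k).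
Proof.
have e : ctens (gact g t) = gact (frame g) (cf (ctens t)).
  by rewrite ctens_gact /cf -gactM /frame -mulmxA EbUb mulmx1.
by move/ffunP/(_ i): e; rewrite !ffunE => ->; apply: eq_bigr => J _; rewrite mulrC.
Qed.

(** Invariance under all rotations about e3 leaves only multi-indices of weight 0, that is with as
    many e+ as e-, so [frame_product] applies to each of them. *)
Lemma gact_biform m (t : tensor R m) i :
  (forall u, cunit u -> gact (rot u) t = t) ->
  exists2 P, biform m P & forall g, SO3 g -> gact g t i = P (g *m e3 R).
Proof.
move=> inv.
have w0 J : cf (ctens t) J != 0 -> npl J = nmi J.
  move=> n0; have hN1 : cunit (-1 : C) by rewrite /cunit /= oppr0; ring.
  (* A root of -1 of index |wt J| is a rotation under which J is not invariant unless its weight is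
     0; the added boolean keeps the index positive in that case. *)
  have [|w hw wE] := @cunit_root R (`|wt J|%N + (`|wt J|%N == 0%N)) (-1) _ hN1.
    by case: (`|wt J|%N) => // ?; rewrite addn0.
  have := proj1 (rot_fix_tens t hw) (inv w hw) J n0 => /exprz_absz.
  have [e _|ne] := eqVneq `|wt J|%N 0%N; first by move: e; rewrite wtE; lia.
  move: wE; rewrite (negbTE ne) addn0 => -> /eqP.
  by rewrite eq_complex /= oppr0 eqxx andbT => /eqP E; exfalso; clear -E; lra.
have H J : exists P, cbiform m P /\ forall g, SO3 g ->
    cf (ctens t) J * \prod_(k < m) frame g (tnth i k) (tnth J k) = P (g *m e3 R).
  have [->|n0] := eqVneq (cf (ctens t) J) 0.
    by exists (fun _ => 0); split=> [|g _]; [exact: cbiform0 | rewrite mul0r].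
  pose l := [seq (tnth i k, tnth J k) | k <- enum 'I_m].
  have l2 : [seq q.2 | q <- l] = J.
    by rewrite -map_comp -[RHS](map_tnth_enum J).
  have [|P hP PE] := @frame_product R l.
    by rewrite -!(count_map snd (fun a => a == _)) l2; exact: w0.
  rewrite size_map size_enum_ord in hP.
  exists (fun x => cf (ctens t) J * P x); split; first exact: cbiformZ.
  by move=> g gS; rewrite -PE // big_map big_enum.
have [F hF] := choice H.
exists (fun x => Re (\sum_J F J x)).
  by apply: (proj1 (cbiform_sum (F := F) _ _)) => J; case: (hF J).
move=> g gS; have /(congr1 (@complex.Re R)) := cf_realE g t i; rewrite /= => ->.
by congr (Re _); apply: eq_bigr => J _; case: (hF J) => _ ->.
Qed.

Lemma odd_pred_double n : (0 < n)%N -> odd (2 * n).-1.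
Proof. by move=> n0; rewrite -[odd _]negbK -oddS prednK ?muln_gt0 // mul2n odd_double. Qed.

Lemma biform_odd n (P : 'cV[R]_3 -> R) : (0 < n)%N -> biform (2 * n) P ->
  (forall x, dotv x x = 1 -> P (- x) = - P x) -> sform (2 * n).-1 P.
Proof.
move=> n0 [A [B [[A' hA EA] hB e]]] Podd.
have hB' : sform (2 * n).-1 B by move: hB; rewrite -{1}(prednK (_ : 0 < 2 * n)%N) // muln_gt0.
have {hB} [B' hB EB] := hB'; apply: (sform_ext _ hB') => x hx.
have hNx : dotv (- x) (- x) = 1 by rewrite dotvNl dotvNr opprK.
have hA1 : A (- x) = A x.
  by rewrite -!EA // -scaleN1r (form_homog _ _ hA) exprM sqrrN !expr1n mul1r.
have hB1 : B (- x) = - B x.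
  rewrite -!EB // -scaleN1r (form_homog _ _ hB) -signr_odd.
  by rewrite odd_pred_double // expr1 mulN1r.
by have := Podd x hx; rewrite !e // hA1 hB1; lra.
Qed.

(** The difference u of t and its flip is negated by the flip, so the components of g u are odd
    functions of g e3, hence forms of degree k = 2n - 1. Pairing with these forms defines an
    equivariant map on S^k sending the k-th power of g e3 to g u; [even_harmonic_S] makes it
    vanish. *)
Lemma even_harmonic_flip n (G : {set 'S_(2 * n)}) (t : tensor R (2 * n)) : (0 < n)%N ->
  even_harmonic (@tspace R (2 * n) G) -> tspace G t ->
  (forall u, cunit u -> gact (rot u) t = t) -> gact (flip R) t = t.
Proof.
move=> n0 eh tG inv.
pose u := t - gact (flip R) t.
have uG : tspace G u by apply: tspaceB => //; exact: tspace_gact.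
have uinv w : cunit w -> gact (rot w) u = u.
  move=> hw; rewrite /u gactB inv //; congr (_ - _).
  rewrite -gactM -[w]conjcK -flip_rot gactM inv //; exact: cunitJ.
have uflip : gact (flip R) u = - u.
  by rewrite /u gactB -gactM flipK gact1 opprB.
suff : u = 0 by move/eqP; rewrite subr_eq0 => /eqP.
pose k := (2 * n).-1.
have k0 : (0 < k)%N by rewrite /k; lia.
have Hb (i : (2 * n).-tuple 'I_3) : exists b : tensor R k, forall g, SO3 g ->
    tdot b (pw k (g *m e3 R)) = gact g u i.
  have [P hP PE] := gact_biform i uinv.
  have [F [b bF] FE] : sform k P.
    apply: biform_odd => // x hx; have [g gS <-] := SO3_frame hx.
    have ge : g *m flip R *m e3 R = - (g *m e3 R) by rewrite -mulmxA flip_e3 mulmxN.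
    rewrite -ge -!PE //; last by apply: SO3_mul => //; exact: flip_SO3.
    by rewrite gactM uflip gactN ffunE.
  by exists b => g gS; rewrite bF FE ?PE // dotv_SO3 ?e3_unit.
have [b hb] := choice Hb.
(* The tensors b i come from a choice and are related only by their values on the sphere, so
   identities for f are checked on powers of g e3, which span S^k. *)
have span (y x : tensor R k) : (forall g, SO3 g -> tdot y (pw k (g *m e3 R)) = 0) ->
    Sspace x -> tdot y x = 0.
  move=> h; apply: pw_span => v; have [->|v0] := eqVneq v 0.
    by rewrite -(scale0r 0) pw_scale expr0n gtn_eqF // tdotZr mul0r.
  have [c [c0 hc]] := unit_scale v0; have [g gS ge] := SO3_frame hc.
  have := h g gS; rewrite ge pw_scale tdotZr => /eqP.
  by rewrite mulf_eq0 expf_eq0 (negbTE c0) andbF => /eqP.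
pose f (x : tensor R k) : tensor R (2 * n) := [ffun i => tdot (b i) x].
have f0 : f (pw k (e3 R)) = 0.
  apply: (even_harmonic_S eh (k := k)).
  - exact: odd_pred_double.
  - by rewrite /k; lia.
  - by move=> x y; apply/ffunP => i; rewrite !ffunE tdotDr.
  - by move=> c x; apply/ffunP => i; rewrite !ffunE tdotZr.
  - move=> x xS s sG i; rewrite !ffunE; apply/eqP; rewrite -subr_eq0 -tdotBl; apply/eqP.
    apply: span => // g gS; rewrite tdotBl !hb //.
    by rewrite (tspace_gact g uG) // subrr.
  - move=> g x gS xS; apply/ffunP => i; rewrite !ffunE.
    under eq_bigr => j _ do rewrite ffunE.
    apply/eqP; rewrite -subr_eq0; apply/eqP.
    pose y := gact g^T (b i) - \sum_j tscale (\prod_(l < 2 * n) g (tnth i l) (tnth j l)) (b j).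
    have -> : tdot (b i) (gact g x) - \sum_j (\prod_(l < 2 * n) g (tnth i l) (tnth j l)) * tdot (b j) x = tdot y x.
      rewrite /y tdotBl tdot_gact trmxK tdot_suml; congr (_ - _).
      by apply: eq_bigr => j _; rewrite tdotZl.
    apply: span => // h hS; rewrite /y tdotBl tdot_gact trmxK gact_pw mulmxA hb; last exact: SO3_mul.
    rewrite gactM tdot_suml ffunE; apply/eqP; rewrite subr_eq0; apply/eqP/eq_bigr => j _.
    by rewrite tdotZl hb.
  - exact: Sspace_pw.
apply/ffunP => i; have := hb i 1%:M (SO3_1 R); rewrite mul1mx gact1 => <-.
by have /ffunP/(_ i) := f0; rewrite !ffunE.
Qed.

End EvenHarmonicFlips.

(** * Forced flips for d = 0, 2n - 1 and 2n *)

Section ChiralExclusion.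
Variable R : realType.
Local Notation C := R[i].
Local Notation Re := complex.Re.
Local Notation ctensor m := {ffun m.-tuple 'I_3 -> C}.
Implicit Types (m n d : nat) (g h : 'M[R]_3).

(** The values c = 1 and c = ['i] recover a complex tensor, so results on real tensors extend to
    complex ones. *)
Definition repart m (c : C) (x : ctensor m) : tensor R m := [ffun i => Re (c * x i)].

Lemma repart_gact m c g (x : ctensor m) :
  repart c (gact (cmx g) x) = gact g (repart c x).
Proof.
apply/ffunP => i; rewrite !ffunE mulr_sumr.
elim/big_rec2: _ => [|j y1 y2 _ <-] //.
rewrite ReD ffunE; congr (_ + _).
have -> : \prod_(k < m) cmx g (tnth i k) (tnth j k) =
    ((\prod_(k < m) g (tnth i k) (tnth j k))%:C)%C.
  by rewrite rmorph_prod; apply: eq_bigr => k _; rewrite mxE.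
by rewrite mulrCA ReZ.
Qed.

Lemma complex_flip n (G : {set 'S_(2 * n)}) (x : ctensor (2 * n)) : (0 < n)%N ->
  even_harmonic (@tspace R (2 * n) G) -> (forall s, s \in G -> pact s x = x) ->
  (forall J, cf x J != 0 -> wt J = 0) -> gact (cmx (flip R)) x = x.
Proof.
move=> n0 eh xG x0.
have xr u : cunit u -> gact (cmx (rot u)) x = x.
  move=> hu; apply: cf_inj; apply/ffunP => J; rewrite cf_rot //.
  by have [->|/x0 ->] := eqVneq (cf x J) 0; [rewrite mulr0 | rewrite expr0z mul1r].
have H c : repart c (gact (cmx (flip R)) x) = repart c x.
  rewrite repart_gact; apply: even_harmonic_flip eh _ _ => //.
    by move=> s sG i; rewrite !ffunE; have /ffunP/(_ i) := xG s sG; rewrite ffunE => ->.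
  by move=> u hu; rewrite -repart_gact xr.
apply/ffunP => i; have /ffunP/(_ i) := H 1; have /ffunP/(_ i) := H 'i%C.
rewrite !ffunE; case: (\sum_j _) (x i) => [a b] [a' b'] /=.
by move=> h1 h2; apply/eqP; rewrite eq_complex /=; apply/andP; split; apply/eqP; lra.
Qed.

Definition wpart m (e : int) (x : ctensor m) : ctensor m :=
  gact (Eb R) [ffun J => if wt J == e then cf x J else 0].

Lemma cf_wpart m e (x : ctensor m) J : cf (wpart e x) J = if wt J == e then cf x J else 0.
Proof. by rewrite /cf /wpart -gactM UbEb gact1 ffunE. Qed.

Lemma wt_tperm m (s : 'S_m) (J : m.-tuple 'I_3) : wt (Defs.tperm s J) = wt J.
Proof.
rewrite /wt [RHS](reindex_inj (@perm_inj _ s)) /=.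
by apply: eq_bigr => k _; rewrite tnth_mktuple.
Qed.

Lemma pact_wpart m e (s : 'S_m) (x : ctensor m) : pact s x = x ->
  pact s (wpart e x) = wpart e x.
Proof.
move=> h; rewrite /wpart pact_gact; congr gact; apply/ffunP => J; rewrite [LHS]ffunE [LHS]ffunE [RHS]ffunE wt_tperm.
case: ifP => // _; have /ffunP/(_ J) : pact s (cf x) = cf x by rewrite /cf pact_gact h.
by move=> e'; rewrite -[RHS]e' [RHS]ffunE.
Qed.

Lemma cf_bar0 n (G : {set 'S_(2 * n)}) (x : ctensor (2 * n)) J : (0 < n)%N ->
  even_harmonic (@tspace R (2 * n) G) -> (forall s, s \in G -> pact s x = x) ->
  wt J = 0 -> cf x J = (-1) ^+ n3 J * cf x (bar J).
Proof.
move=> n0 eh xG J0.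
have e : gact (cmx (flip R)) (wpart 0 x) = wpart 0 x.
  apply: complex_flip eh _ _ => // [s sG|K]; first by apply: pact_wpart; exact: xG.
  by rewrite cf_wpart; case: (wt K =P 0) => // _; rewrite eqxx.
have := congr1 (fun y => cf y J) e.
by rewrite cf_flip !cf_wpart wt_bar J0 oppr0 /= => ->.
Qed.

Definition spike m (j : 'I_m) : m.-tuple 'I_3 := [tuple if k == j then i2 else i0 | k < m].

Lemma wt_top n (J : (2 * n).-tuple 'I_3) : wt J = (2 * n)%N -> J = [tuple i0 | _ < 2 * n].
Proof.
move=> w; have := slots_count J; move: w; rewrite wtE => w s.
have : npl J = size J by rewrite size_tuple; lia.
move/eqP; rewrite -all_count => /allP h; apply: eq_from_tnth => k; rewrite tnth_mktuple.
by apply/eqP/h/mem_tnth.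
Qed.

Lemma wt_spike n (J : (2 * n).-tuple 'I_3) : (0 < n)%N -> wt J = (2 * n).-1 ->
  exists j, J = spike j.
Proof.
move=> n0 w; have := slots_count J; move: w; rewrite wtE => w s.
have m0 : nmi J = 0%N by lia.
have z1 : n3 J = 1%N by lia.
have [j Jj] : exists j, tnth J j = i2.
  apply: contrapT => H; move: z1; rewrite /n3 big1 // => k _.
  by case: eqP => // e; case: H; exists k.
exists j; apply: eq_from_tnth => k; rewrite tnth_mktuple; case: eqP => [->//|/eqP kj].
move: z1; rewrite /n3 (bigD1 j) //= Jj eqxx (bigD1 k) //=.
have nk : tnth J k != i1.
  apply/negP => /eqP e; move: m0; rewrite /nmi => /eqP; rewrite -leqn0 leqNgt -has_count => /negP[].
  by apply/hasP; exists (tnth J k); rewrite ?mem_tnth // e.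
by move: (tnth J k) nk; apply: forall3.
Qed.

Definition yrot : 'M[R]_3 := mat3 [:: [:: 0; 0; 1]; [:: 0; 1; 0]; [:: -1; 0; 0]].

Lemma yrotE : let B := Ub R *m cmx yrot *m Eb R in
  [/\ B i0 i0 = 2^-1, B i1 i0 = - 2^-1 & B i2 i0 = -1] /\
  [/\ B i0 i2 = 2^-1, B i1 i2 = 2^-1 & B i2 i2 = 0].
Proof.
by split; split; rewrite ?mulmx33 !mxE /= ?rmorphN ?rmorph0 ?rmorph1;
  have := ii R; move: ('i%C : C) => j hj; field: hj.
Qed.

(** A quarter turn about the second axis carries the weight 2n - 1 part to a tensor whose weight-0
    coefficients obey [cf_bar0]. At J0, with e+ in slot a, e- in slot b and e3 elsewhere, only the
    spikes at a and b contribute, because the e3-to-e3 entry of the turn is 0. Their contributions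
    are opposite multiples and change sign between J0 and [bar J0], so equality forces the two
    coefficients to agree. *)
Lemma spike_coef n (G : {set 'S_(2 * n)}) (x : ctensor (2 * n)) a b : (0 < n)%N ->
  even_harmonic (@tspace R (2 * n) G) -> (forall s, s \in G -> pact s x = x) ->
  cf x (spike a) = cf x (spike b).
Proof.
move=> n0 eh xG; have [->//|ab] := eqVneq a b.
have ba : b != a by rewrite eq_sym.
pose y := wpart (2 * n).-1 x; pose z := gact (cmx yrot) y.
have zG s : s \in G -> pact s z = z.
  by move=> sG; rewrite /z pact_gact pact_wpart // xG.
pose J0 : (2 * n).-tuple 'I_3 := [tuple if k == a then i0 else if k == b then i1 else i2 | k < 2 * n].
have J0a : tnth J0 a = i0 by rewrite tnth_mktuple eqxx.
have J0b : tnth J0 b = i1 by rewrite tnth_mktuple (negbTE ba) eqxx.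
have J0k k : k != a -> k != b -> tnth J0 k = i2.
  by move=> ka kb; rewrite tnth_mktuple (negbTE ka) (negbTE kb).
have w0 : wt J0 = 0.
  rewrite /wt (bigD1 a) //= (bigD1 b) //= J0a J0b big1 //= => k /andP[ka kb].
  by rewrite J0k.
have wsp (j : 'I_(2 * n)) : wt (spike j) = (2 * n).-1.
  rewrite /wt (bigD1 j) //= tnth_mktuple eqxx (eq_bigr (fun _ => 1)) => [|k kj]; last first.
    by rewrite tnth_mktuple (negbTE kj).
  rewrite sumr_const add0r.
  have -> : #|[pred k | k != j]| = (2 * n).-1.
    by rewrite -[in RHS](card_ord (2 * n)) -(cardC1 j); apply: eq_card.
  by rewrite natz.
have od : (-1 : C) ^+ n3 J0 = 1.
  rewrite -signr_odd; have := slots_count J0; have := wtE J0; rewrite w0 => e s.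
  have -> : odd (n3 J0) = false; last by rewrite expr0.
  have : (n3 J0 = 2 * (n - npl J0))%N by lia.
  by move=> ->; rewrite mul2n odd_double.
have [[B00 B10 B20] [B02 B12 B22]] := yrotE.
move: B00 B10 B20 B02 B12 B22; set B := Ub R *m cmx yrot *m Eb R => B00 B10 B20 B02 B12 B22.
pose e : C := \prod_(k < 2 * n | (k != a) && (k != b)) (-1).
have e0 : e != 0 by apply/prodf_neq0 => k _; rewrite oppr_eq0 oner_eq0.
have czE (K : (2 * n).-tuple 'I_3) :
    (forall k, k != a -> k != b -> tnth K k = i2) ->
    cf z K = e * (B (tnth K a) i2 * B (tnth K b) i0 * cf x (spike a) +
                  B (tnth K a) i0 * B (tnth K b) i2 * cf x (spike b)).
  move=> Kk; rewrite /z cf_gact -/B ffunE.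
  have sab : spike b != spike a.
    apply: contra_neq ab => h; have := congr1 (fun K => tnth K a) h.
    by rewrite /= !tnth_mktuple eqxx; case: eqP.
  rewrite (bigD1 (spike a)) //= (bigD1 (spike b)) ?sab //= [X in _ + (_ + X)]big1 ?addr0 => [|J /andP[Ja Jb]].
    rewrite !cf_wpart !wsp !eqxx.
    have pr j : \prod_(k < 2 * n) B (tnth K k) (tnth (spike j) k) =
       B (tnth K a) (if a == j then i2 else i0) * (B (tnth K b) (if b == j then i2 else i0) *
       \prod_(k < 2 * n | (k != a) && (k != b)) B i2 (if k == j then i2 else i0)).
      rewrite (bigD1 a) //= (bigD1 b) //= !tnth_mktuple; congr (_ * (_ * _)).
      by apply: eq_bigr => k /andP[ka kb]; rewrite Kk // tnth_mktuple.
    have pe j : j = a \/ j = b ->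
        \prod_(k < 2 * n | (k != a) && (k != b)) B i2 (if k == j then i2 else i0) = e.
      move=> hj; apply: eq_bigr => k /andP[ka kb].
      by case: hj => ->; rewrite ?(negbTE ka) ?(negbTE kb).
    rewrite !pr !pe; [|by right|by left].
    by rewrite !eqxx (negbTE ab) (negbTE ba); ring.
  have [wJ|wJ] := eqVneq (wt J) (2 * n).-1; last by rewrite cf_wpart (negbTE wJ) mulr0.
  have [j Jj] := wt_spike n0 wJ.
  have ja : j != a by apply: contra_neq Ja => <-.
  have jb : j != b by apply: contra_neq Jb => <-.
  by rewrite (bigD1 j) //= Kk // Jj tnth_mktuple eqxx B22 !mul0r.
have := @cf_bar0 n G z J0 n0 eh zG w0; rewrite od mul1r !czE; last first.
- exact: J0k.
- by move=> k ka kb; rewrite tnth_map J0k.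
have Ja : tnth (bar J0) a = i1 by rewrite tnth_map J0a; exact: val_inj.
have Jb : tnth (bar J0) b = i0 by rewrite tnth_map J0b; exact: val_inj.
rewrite J0a J0b Ja Jb => /(mulfI e0); rewrite B00 B10 B02 B12 => E.
have h2 : (2 : C) != 0 by rewrite pnatr_eq0.
have : 2^-1 * (cf x (spike b) - cf x (spike a)) = 0.
  move: E; move: (cf x (spike a)) (cf x (spike b)) => p q E.
  have -> : 2^-1 * (q - p) = (2^-1 * 2^-1 * p + - 2^-1 * 2^-1 * q) * (-1) + (2^-1 * - 2^-1 * p + 2^-1 * 2^-1 * q) by field.
  by rewrite E; field.
by move/eqP; rewrite mulf_eq0 invr_eq0 (negbTE h2) /= subr_eq0 => /eqP.
Qed.

(** Apart from weight 0, already symmetric under flips, only the weights d and -d occur. All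
    coefficients of weight d share one value c and those of weight -d are its conjugate up to
    reindexing, so a single phase condition on v remains. *)
Lemma even_harmonic_has_flip n (G : {set 'S_(2 * n)}) (t : tensor R (2 * n)) d :
  (3 <= n)%N -> even_harmonic (@tspace R (2 * n) G) -> tspace G t -> wt_dvd d t ->
  [\/ d = 0, d = (2 * n).-1 | d = 2 * n]%N ->
  exists2 v : C, cunit v & gact (rot v *m flip R) t = t.
Proof.
move=> n3' eh tG dv dE; have n0 : (0 < n)%N by lia.
set x := ctens t in dv.
have xG s : s \in G -> pact s x = x.
  by move=> sG; apply/ffunP => i; rewrite !ffunE tG.
have w3 J : cf x J != 0 -> [\/ wt J = 0, wt J = d | wt J = - d%:Z].
  move=> n1; have := dv J n1; have := wt_le J; move: (wt J) => w wl.
  have [->|w0] := eqVneq w 0; first by constructor 1.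
  (* Weights are at most 2n in absolute value, which is less than 2 d for d = 2n - 1 and d = 2n; for
     d = 0 a nonzero weight is impossible. *)
  case/dvdnP => q qE; have q1 : q = 1%N.
    case: q qE => [|[|q]] qE //; first by lia.
    by exfalso; move: qE wl; case: dE => ->; nia.
  rewrite q1 mul1n in qE.
  have [h|h] : w = d \/ w = - d%:Z by lia.
    by constructor 2.
  by constructor 3.
have w0bar J : wt J = 0 -> cf x J = (-1) ^+ n3 J * cf x (bar J) by exact: cf_bar0 eh xG.
have [d0|d0] := eqVneq d 0%N.
  exists 1; first exact: cunit1.
  rewrite rot1 mul1mx; apply: even_harmonic_flip eh tG _ => // u hu.
  apply/rot_fix_tens => // J n1; have [->|->|->] := w3 J n1; by rewrite ?d0 ?oppr0 expr0z.
have [c hc] : exists c, forall J, wt J = d -> cf x J = c.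
  have [[K wK]|nK] := pselect (exists K : (2 * n).-tuple 'I_3, wt K = d); last first.
    by exists 0 => J wJ; case: nK; exists J.
  exists (cf x K) => J wJ; move: wJ wK d0; case: dE => -> // wJ wK _.
    have [a ->] := wt_spike n0 wJ; have [b ->] := wt_spike n0 wK.
    exact: spike_coef eh xG.
  by rewrite (wt_top wJ) (wt_top wK).
have hn3 (J : (2 * n).-tuple 'I_3) : wt J = d -> n3 J = (2 * n - d)%N.
  have := slots_count J; rewrite wtE; move: (npl J) (nmi J) (n3 J) => a b e.
  by case: dE d0 => -> // _; clear -n0; lia.
pose eps : C := (-1) ^+ (2 * n - d).
have epsJ : conjc eps = eps by rewrite /eps rmorphXn rmorphN1.
have eps1 : eps * eps = 1 by rewrite /eps -exprMn mulrNN mulr1 expr1n.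
(* The flip followed by rot v turns the coefficient c of weight d into v^d eps conj(c), with eps the
   sign of the e3 slots. It has the same modulus as c, so a d-th root of a unit number makes them
   equal. *)
have [v hv vE] : exists2 v : C, cunit v & v ^+ d * (eps * conjc c) = c.
  have [->|c0] := eqVneq c 0; first by exists 1; [exact: cunit1 | rewrite rmorph0 !mulr0].
  have cc0 : conjc c != 0 by rewrite conjc_eq0.
  have [||v hv vE] := @cunit_root R d (eps * c / conjc c).
  - by rewrite lt0n.
  - apply/cunitE; rewrite !rmorphM /= fmorphV /= conjcK epsJ.
    transitivity (eps * eps * (c / c) * (conjc c / conjc c)); first by ring.
    by rewrite eps1 !divff // !mulr1.
  exists v => //; rewrite vE.
  transitivity (eps * eps * c * (conjc c / conjc c)); first by ring.
  by rewrite eps1 divff // mulr1 mul1r.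
exists v => //; apply: ctens_inj; apply: cf_inj; apply/ffunP => J.
rewrite ctens_gact -/x cmxM gactM cf_rot // cf_flip.
have bx : cf x (bar J) = conjc (cf x J) by exact: cf_conj.
have [z|nz] := eqVneq (cf x J) 0; first by rewrite bx z rmorph0 !mulr0.
have [w|w|w] := w3 J nz.
- by rewrite w expr0z mul1r -w0bar.
- by rewrite w hn3 // bx (hc J w) -exprnP.
have wb : wt (bar J) = d by rewrite wt_bar w opprK.
have -> : cf x J = conjc (cf x (bar J)) by rewrite bx conjcK.
rewrite (hc _ wb) w -(n3_bar J) (hn3 _ wb) -/eps -exprnN -exprVn cunitV //.
by rewrite -[in RHS]vE !rmorphM /= rmorphXn /= conjcK epsJ.
Qed.

End ChiralExclusion.

(** * Comparison of symmetry classes *)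

Section MainClasses.
Variable R : realType.

Lemma Zd_no_flip d (v : R[i]) : cunit v -> ~ Zd d (rot v *m flip R).
Proof.
move=> hv [u hu [_ e]]; have := congr1 (fun g => g *m e3 R) e.
rewrite /= -mulmxA flip_e3 mulmxN !rot_e3 => /matrixP/(_ i2 0); rewrite !mxE /= => E.
by clear -E; lra.
Qed.

Lemma sym_classes_transfer m (G : {set 'S_m}) (K : 'M[R]_3 -> Prop) (t s : tensor R m) h :
  SO3 h -> (forall g, K g <-> isotropy t g) -> tspace G s ->
  (forall g, isotropy s g <-> isotropy (gact h t) g) -> sym_classes (@tspace R m G) K.
Proof.
move=> hS Kt sG st; apply/sym_classesP; exists (gact h^T s); first exact: tspace_gact.
by move=> g; rewrite Kt; exact: isotropy_gact_tr.
Qed.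

Lemma sym_classes_sub m (G G' : {set 'S_m}) (K : 'M[R]_3 -> Prop) :
  G' \subset G -> sym_classes (@tspace R m G) K -> sym_classes (@tspace R m G') K.
Proof.
move=> /subsetP sG /sym_classesP[t tG Kt]; apply/sym_classesP; exists t => //.
by move=> s sG'; apply: tG; exact: sG.
Qed.

Lemma even_harmonic_classes n (G : {set 'S_(2 * n)}) : (3 <= n)%N ->
  even_harmonic (@tspace R (2 * n) G) ->
  same_classes (@tspace R (2 * n) G) (@Sspace R (2 * n)).
Proof.
move=> n3 eh K; split; last exact/sym_classes_sub/subsetT.
move=> /sym_classesP[t tG Kt].
have [[h hS [s sS st]]|[h hS [d dn [dv hd]]]] := isotropy_class t n3.
  exact: sym_classes_transfer hS Kt sS st.
have [/andP[d0 d2]|nd] := boolP ((0 < d) && (d + 2 <= 2 * n))%N.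
  have [s sS sd] := exists_Zd R n3 d0 d2.
  by apply: sym_classes_transfer hS Kt sS _ => g; rewrite sd hd.
have dE : [\/ d = 0, d = (2 * n).-1 | d = 2 * n]%N.
  have [e|[e|e]] : (d = 0 \/ d = (2 * n).-1 \/ d = 2 * n)%N by lia.
  - by constructor 1.
  - by constructor 2.
  - by constructor 3.
have [v hv vt] := even_harmonic_has_flip n3 eh (tspace_gact h tG) dv dE.
case: (@Zd_no_flip d v hv); apply/hd; split=> //.
by apply: SO3_mul; [exact: rot_SO3 | exact: flip_SO3].
Qed.

Lemma not_even_harmonic_classes n (G : {set 'S_(2 * n)}) : (3 <= n)%N ->
  ~ even_harmonic (@tspace R (2 * n) G) ->
  same_classes (@tspace R (2 * n) G) (@Gspace R (2 * n)).
Proof.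
move=> n3 neh K; split; first exact/sym_classes_sub/sub0set.
move=> /sym_classesP[t tG Kt].
have [[h hS [s sS st]]|[h hS [d dn [_ hd]]]] := isotropy_class t n3.
  by apply: sym_classes_transfer hS Kt _ st; exact: Sspace_sub.
have [s sG sd] := chiral_Zd n3 dn neh.
by apply: sym_classes_transfer hS Kt sG _ => g; rewrite sd hd.
Qed.

End MainClasses.

Local Close Scope ring_scope.

Theorem theoremI (R : realType) (n : nat) (G : {group 'S_(2 * n)}) :
  (3 <= n)%N ->
  (even_harmonic (@tspace R (2 * n) G) ->
     same_classes (@tspace R (2 * n) G) (@Sspace R (2 * n))) /\
  (~ even_harmonic (@tspace R (2 * n) G) ->
     same_classes (@tspace R (2 * n) G) (@Gspace R (2 * n))).
Proof.
move=> n3; split.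
  exact: even_harmonic_classes.
exact: not_even_harmonic_classes.
Qed.
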